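(* There exists a finite set $\Sigma$ of dependencies that is both guarded and sticky such that instance checking for $\Sigma$ (deciding, given a database $\mathcal{D}$ and a fact $\alpha$, whether $\langle\Sigma,\mathcal{D}\rangle$ IAR-entails $\alpha$, equivalently AR-entails $\alpha$) is $\Pi^p_2$-hard with respect to data complexity.
   Context: A signature is a set of predicate symbols with arities, always containing a special 0-ary predicate $\bot$. A term is a constant or a variable; a (predicate) atom is $p(t_1,\dots,t_n)$; an inequality is $t\neq t'$. A database is a finite set of ground atoms (facts) not containing $\bot$. A conjunction with inequalities is a conjunction of at least one predicate atom or inequality. A CQ is $\exists\vec y\,\gamma$ with $\gamma$ a conjunction with inequalities; a UCQ is a finite disjunction of CQs. A dependency is a first-order sentence $\forall\vec x\,(\gamma\rightarrow Q)$ where $\gamma$ (the body) is a conjunction with inequalities whose variables are in $\vec x$, each occurring in some predicate atom of $\gamma$, and $Q$ (the head) is a UCQ whose free variables are among $\vec x$ and in which every existentially quantified variable of each disjunct occurs in a predicate atom of that disjunct. $\mathcal{D}$ is consistent with $\Sigma$ if $\mathcal{D}$ satisfies every dependency of $\Sigma$. A repair of $\langle\Sigma,\mathcal{D}\rangle$ is an inclusion-maximal subset of $\mathcal{D}$ consistent with $\Sigma$. $\langle\Sigma,\mathcal{D}\rangle$ AR-entails a sentence $\phi$ if every repair satisfies $\phi$, and IAR-entails $\phi$ if the intersection of all repairs satisfies $\phi$; for a fact $\alpha$ both mean that $\alpha$ belongs to every repair. Data complexity: $\Sigma$ and the query are fixed (here the fact $\alpha$ may be part of the fixed query), the database is the input.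 A dependency is guarded if some atom of its body contains all variables of the body. Stickiness: assume distinct dependencies use distinct variables; a variable $x$ in the body of $\tau\in\Sigma$ is marked if (i) some atom of the head of $\tau$ does not contain $x$, or (ii) there are $\tau'\in\Sigma$ and a predicate $p$ such that the head of $\tau$ contains $p(\vec t)$, the body of $\tau'$ contains $p(\vec t')$, and whenever $x$ is the $i$-th term of $\vec t$ the $i$-th term of $\vec t'$ is a marked variable (inductive definition). $\Sigma$ is sticky if, for every $\tau\in\Sigma$, every marked variable occurs at most once in the body of $\tau$. *)

(* Defs.v *)
From Stdlib Require Import List Arith Bool.
Import ListNotations.

Inductive term := TConst (c : nat) | TVar (v : nat).

Inductive pred := Bot | P (name arity : nat).

Definition arity (p : pred) : nat :=
  match p with Bot => 0 | P _ k => k end.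

Record atom := mkAtom { apred : pred; aargs : list term }.

Inductive lit := LAtom (a : atom) | LNeq (t1 t2 : term).

Record cq := mkCQ { cq_ex : list nat; cq_body : list lit }.

(* a dependency  forall xs (body -> head) ; the universally quantified
   variables are the variables of the body; the head is a UCQ *)
Record dep := mkDep { dbody : list lit; dhead : list cq }.

Definition term_vars (t : term) : list nat :=
  match t with TVar v => [v] | TConst _ => [] end.

Definition lit_terms (l : lit) : list term :=
  match l with LAtom a => aargs a | LNeq t1 t2 => [t1; t2] end.

Definition lits_vars (ls : list lit) : list nat :=
  flat_map (fun l => flat_map term_vars (lit_terms l)) ls.

Definition atom_vars (a : atom) : list nat := flat_map term_vars (aargs a).

Definition lits_atoms (ls : list lit) : list atom :=
  flat_map (fun l => match l with LAtom a => [a] | LNeq _ _ => [] end) ls.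

Definition head_atoms (d : dep) : list atom :=
  flat_map (fun q => lits_atoms (cq_body q)) (dhead d).

Definition wf_atom (a : atom) : Prop := length (aargs a) = arity (apred a).

Definition wf_lits (ls : list lit) : Prop :=
  ls <> [] /\ Forall wf_atom (lits_atoms ls).

Definition cq_free_vars (q : cq) : list nat :=
  filter (fun v => negb (existsb (Nat.eqb v) (cq_ex q))) (lits_vars (cq_body q)).

(* well-formedness of a dependency, as in the definition.  Bound
   (existential) variables are additionally required to be named apart
   from the universal ones, which is harmless (alpha-renaming). *)
Definition wf_dep (d : dep) : Prop :=
  wf_lits (dbody d) /\
  (forall x, In x (lits_vars (dbody d)) ->
     exists a, In a (lits_atoms (dbody d)) /\ In x (atom_vars a)) /\
  dhead d <> [] /\
  (forall q, In q (dhead d) ->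
     wf_lits (cq_body q) /\
     (forall x, In x (cq_free_vars q) -> In x (lits_vars (dbody d))) /\
     (forall y, In y (cq_ex q) ->
        (exists a, In a (lits_atoms (cq_body q)) /\ In y (atom_vars a)) /\
        ~ In y (lits_vars (dbody d)))).

(* ground atoms (facts); the predicate of a fact is P fname (length fargs),
   so facts never contain Bot *)
Record fact := mkFact { fname : nat; fargs : list nat }.

Definition database := list fact.

Definition fset := fact -> Prop.

Definition eval (nu : nat -> nat) (t : term) : nat :=
  match t with TConst c => c | TVar v => nu v end.

Definition atom_holds (S : fset) (nu : nat -> nat) (a : atom) : Prop :=
  match apred a with
  | Bot => False
  | P n k => length (aargs a) = k /\ S (mkFact n (map (eval nu) (aargs a)))
  end.

Definition lit_holds (S : fset) (nu : nat -> nat) (l : lit) : Prop :=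
  match l with
  | LAtom a => atom_holds S nu a
  | LNeq t1 t2 => eval nu t1 <> eval nu t2
  end.

Definition cq_holds (S : fset) (nu : nat -> nat) (q : cq) : Prop :=
  exists mu : nat -> nat,
    (forall v, ~ In v (cq_ex q) -> mu v = nu v) /\
    Forall (lit_holds S mu) (cq_body q).

Definition dep_holds (S : fset) (d : dep) : Prop :=
  forall nu : nat -> nat,
    Forall (lit_holds S nu) (dbody d) -> Exists (cq_holds S nu) (dhead d).

Definition consistent (Sigma : list dep) (S : fset) : Prop :=
  Forall (dep_holds S) Sigma.

Definition in_db (D : database) : fset := fun f => In f D.

Definition subset (A B : fset) : Prop := forall f, A f -> B f.

Definition repair (Sigma : list dep) (D : database) (R : fset) : Prop :=
  subset R (in_db D) /\ consistent Sigma R /\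
  (forall R', subset R R' -> subset R' (in_db D) -> consistent Sigma R' ->
     subset R' R).

Definition IAR_entails_fact (Sigma : list dep) (D : database) (alpha : fact)
  : Prop :=
  forall R, repair Sigma D R -> R alpha.

Definition guarded (d : dep) : Prop :=
  exists a, In a (lits_atoms (dbody d)) /\
    forall x, In x (lits_vars (dbody d)) -> In x (atom_vars a).

(* marked i x : the variable x of the body of the i-th dependency is marked
   (dependencies are identified by their position, so that distinct
   dependencies use distinct variables) *)
Inductive marked (Sigma : list dep) : nat -> nat -> Prop :=
| mark_base : forall i d x,
    nth_error Sigma i = Some d ->
    In x (lits_vars (dbody d)) ->
    (exists a, In a (head_atoms d) /\ ~ In x (atom_vars a)) ->
    marked Sigma i x
| mark_prop : forall i d x j d' a a',
    nth_error Sigma i = Some d ->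
    In x (lits_vars (dbody d)) ->
    nth_error Sigma j = Some d' ->
    In a (head_atoms d) ->
    In a' (lits_atoms (dbody d')) ->
    apred a = apred a' ->
    (forall k, nth_error (aargs a) k = Some (TVar x) ->
       exists y, nth_error (aargs a') k = Some (TVar y) /\ marked Sigma j y) ->
    marked Sigma i x.

Definition sticky (Sigma : list dep) : Prop :=
  forall i d x, nth_error Sigma i = Some d -> marked Sigma i x ->
    count_occ Nat.eq_dec (lits_vars (dbody d)) x <= 1.

Inductive dir := DL | DR | DS.

Record TM := mkTM {
  nst : nat;
  tm_start : nat;
  delta : nat -> option bool -> nat * option bool * dir;  (* None = blank *)
  halting : nat -> bool;
  accepting : nat -> bool;
  start_ok : tm_start < nst;
  delta_ok : forall q s, q < nst -> fst (fst (delta q s)) < nst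
}.

Record config := mkConfig {
  cst : nat;
  cleft : list (option bool);      (* cells left of the head, nearest first *)
  ccur : option bool;
  cright : list (option bool)
}.

Definition move (d : dir) (c : config) : config :=
  match d with
  | DS => c
  | DL => match cleft c with
          | [] => mkConfig (cst c) [] None (ccur c :: cright c)
          | h :: t => mkConfig (cst c) t h (ccur c :: cright c)
          end
  | DR => match cright c with
          | [] => mkConfig (cst c) (ccur c :: cleft c) None []
          | h :: t => mkConfig (cst c) (ccur c :: cleft c) h t
          end
  end.

Definition step (M : TM) (c : config) : config :=
  if halting M (cst c) then c else
  let '(q', w, d) := delta M (cst c) (ccur c) in
  move d (mkConfig q' (cleft c) w (cright c)).

Fixpoint run (M : TM) (n : nat) (c : config) : config :=
  match n with 0 => c | S n' => run M n' (step M c) end.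

Definition init (M : TM) (x : list bool) : config :=
  match x with
  | [] => mkConfig (tm_start M) [] None []
  | b :: t => mkConfig (tm_start M) [] (Some b) (map Some t)
  end.

Fixpoint somes (l : list (option bool)) : list bool :=
  match l with Some b :: t => b :: somes t | _ => [] end.

Definition output (c : config) : list bool := somes (ccur c :: cright c).

Definition poly (c k n : nat) : nat := c * n ^ k + c.

Definition poly_time_computable (f : list bool -> list bool) : Prop :=
  exists (M : TM) (c k : nat), forall x, exists t,
    t <= poly c k (length x) /\
    halting M (cst (run M t (init M x))) = true /\
    output (run M t (init M x)) = f x.

Definition poly_time_decidable (L : list bool -> Prop) : Prop :=
  exists (M : TM) (c k : nat), forall x, exists t,
    t <= poly c k (length x) /\
    halting M (cst (run M t (init M x))) = true /\
    (accepting M (cst (run M t (init M x))) = true <-> L x).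

(* self-delimiting encodings *)
Definition enc_bits (x : list bool) : list bool :=
  flat_map (fun b => [true; b]) x ++ [false; false].

Definition enc_triple (x y z : list bool) : list bool :=
  enc_bits x ++ enc_bits y ++ enc_bits z.

Definition PiP2 (L : list bool -> Prop) : Prop :=
  exists (V : list bool -> Prop) (c k : nat),
    poly_time_decidable V /\
    forall x, L x <->
      forall y, length y <= poly c k (length x) ->
        exists z, length z <= poly c k (length x) /\ V (enc_triple x y z).

Definition PiP2_hard (Q : list bool -> Prop) : Prop :=
  forall L, PiP2 L ->
    exists f, poly_time_computable f /\ forall x, L x <-> Q (f x).

Fixpoint nat_bits_aux (fuel n : nat) : list bool :=
  match fuel with
  | 0 => []
  | S f => if Nat.eqb n 0 then [] else Nat.odd n :: nat_bits_aux f (Nat.div2 n)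
  end.

Definition nat_bits (n : nat) : list bool := nat_bits_aux n n.

Definition enc_nat (n : nat) : list bool := enc_bits (nat_bits n).

Definition enc_list {A} (e : A -> list bool) (l : list A) : list bool :=
  flat_map (fun a => true :: e a) l ++ [false].

Definition enc_fact (f : fact) : list bool :=
  enc_nat (fname f) ++ enc_list enc_nat (fargs f).

Definition enc_db (D : database) : list bool := enc_list enc_fact D.

(* instance checking with Sigma and the fact alpha fixed (data complexity):
   the language of encodings of databases D with <Sigma,D> IAR-entailing alpha *)
Definition IAR_instance_problem (Sigma : list dep) (alpha : fact)
  : list bool -> Prop :=
  fun w => exists D : database, w = enc_db D /\ IAR_entails_fact Sigma D alpha.

(* Main.v *)
From Stdlib Require Import List Arith Bool Lia ZArith.
From Stdlib Require Import Classical ClassicalEpsilon FunctionalExtensionality IndefiniteDescription.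
Require Import Defs.
Import ListNotations.

(** The database is a dual-rail monotone Boolean circuit.  A fact V(u,0) or V(u,1)
    assigns a value to the variable u, and the first dependency lets a repair keep
    only one of them.  A fact N(v) says that the node v is true, and must be
    supported by a gate or by a literal.  Values of the variables that are not
    marked universal are only allowed together with the fact alpha = N(root).  A
    repair without alpha is thus just an assignment of the universal variables, and
    it is maximal iff no assignment of the other variables makes the root true:
    alpha is in all repairs iff "for all universal values there are values of the
    others such that the circuit outputs true".

    For a language in Pi^p_2 with verifier V, the circuit contains for all lengths
    l = |y| and lz = |z| a copy of the computation tableau of V on (x,y,z), where a
    node says that a given cell has a given content at a given time; each cell is
    determined by three cells of the previous row.  The nodes [l] form a chain:
    [l] holds iff [l+1] holds and some copy (l,lz) accepts.  Nodes are lists of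
    numbers, written in unary in the bits of a constant, so that nested loops over
    unary counters print the database.  Such loop programs are compiled to a
    language of stacks, and that to a Turing machine keeping stack r on the tape
    cells congruent to r modulo the number of stacks. *)

(** * Encodings of databases *)

(** Support of a node is a local condition, so gates on a cycle could keep each other in a repair; a
    rank that decreases along gates makes every supported node derivable. Monotone gates suffice
    because a tableau cell has one node per possible content: a wrong content only has to be
    underivable, never refuted. The verifier reads an encoding whose layout depends on the lengths
    of y and z, and separate copies per pair of lengths fix the place of every bit in the first row.
    The bits of y belong to l alone and are shared by all lz, so the length of z may be chosen after
    y. Hardness is stated for bit strings and Turing machines, so the reduction itself must be run
    by a machine; with coordinates in unary, a larger index just means emitting more copies of one
    fixed pair of bits, and the polynomial bounds become words to loop over before printing
    begins. *)

Fixpoint num (w : list bool) : nat :=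
  match w with [] => 1 | b :: w' => Nat.b2n b + 2 * num w' end.

Lemma num_pos w : 1 <= num w.
Proof. induction w; cbn [num]; lia. Qed.

Lemma nat_bits_aux_num w f : num w <= f -> nat_bits_aux f (num w) = w ++ [true].
Proof.
  revert f; induction w as [|b w IH]; intros [|f] Hf; cbn [num] in *; try lia.
  - destruct f; reflexivity.
  - pose proof (num_pos w). destruct b; lia.
  - pose proof (num_pos w).
    cbn [nat_bits_aux]. rewrite (proj2 (Nat.eqb_neq _ _)) by (destruct b; simpl; lia).
    rewrite <- app_comm_cons. f_equal.
    + rewrite Nat.odd_add, Nat.odd_mul. destruct b; reflexivity.
    + rewrite <- IH with (f := f) by (destruct b; simpl in *; lia).
      f_equal. rewrite Nat.div2_div, Nat.add_b2n_double_div2. reflexivity.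
Qed.

Lemma nat_bits_num w : nat_bits (num w) = w ++ [true].
Proof. apply nat_bits_aux_num; lia. Qed.

Lemma num_inj w w' : num w = num w' -> w = w'.
Proof.
  intros H. apply (app_inv_tail [true]). rewrite <- !nat_bits_num, H. reflexivity.
Qed.

Fixpoint unary_code (l : list nat) : list bool :=
  match l with [] => [] | i :: l' => repeat false i ++ true :: unary_code l' end.

Lemma unary_code_inj l l' : unary_code l = unary_code l' -> l = l'.
Proof.
  revert l'; induction l as [|i l IH]; intros [|i' l'] H; simpl in *; auto.
  - destruct i'; discriminate.
  - destruct i; discriminate.
  - revert i' H; induction i as [|i IHi]; intros [|i'] H; simpl in *; try discriminate.
    + injection H as H. f_equal. auto.
    + injection H as H. apply IHi in H. congruence.
Qed.

(** [num] reads the code as binary digits, least significant first, under a leading one, so that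
    [nat_bits] prints the code back. The root [[0]] gets number 3, the constant of [dep_var] and of
    the fact [fN 3]. *)
Definition node_id (l : list nat) : nat := num (unary_code l).

Lemma node_id_inj l l' : node_id l = node_id l' -> l = l'.
Proof. intros H. apply unary_code_inj, num_inj, H. Qed.

(** Horner evaluation of the digits is a left inverse as soon as the fuel suffices. *)
Lemma nat_bits_aux_inj f f' n n' : n <= f -> n' <= f' ->
  nat_bits_aux f n = nat_bits_aux f' n' -> n = n'.
Proof.
  assert (Hv : forall f n, n <= f ->
    fold_right (fun b v => Nat.b2n b + 2 * v) 0 (nat_bits_aux f n) = n).
  { clear. induction f as [|f IH]; intros n Hn; simpl; [lia|].
    destruct (Nat.eqb_spec n 0) as [->|Hn0]; [reflexivity|].
    cbn [fold_right]. pose proof (Nat.div2_odd n) as E.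
    rewrite IH; lia. }
  intros H H' E. rewrite <- (Hv f n H), <- (Hv f' n' H'), E. reflexivity.
Qed.

(** The remainders [r], [r'] make this prefix-freeness, the property that passes to concatenations
    and lists. *)
Lemma enc_bits_prefix x x' r r' :
  enc_bits x ++ r = enc_bits x' ++ r' -> x = x' /\ r = r'.
Proof.
  unfold enc_bits. revert x'; induction x as [|b x IH]; intros [|b' x'] H;
    simpl in H; try discriminate; injection H as H; subst; auto.
  apply IH in H0. destruct H0; subst; auto.
Qed.

Lemma enc_nat_prefix n n' r r' :
  enc_nat n ++ r = enc_nat n' ++ r' -> n = n' /\ r = r'.
Proof.
  intros H. apply enc_bits_prefix in H. destruct H as [H ->]. split; auto.
  exact (nat_bits_aux_inj n n' n n' (le_n _) (le_n _) H).
Qed.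

Lemma enc_list_prefix {A} (e : A -> list bool) :
  (forall a a' r r', e a ++ r = e a' ++ r' -> a = a' /\ r = r') ->
  forall l l' r r', enc_list e l ++ r = enc_list e l' ++ r' -> l = l' /\ r = r'.
Proof.
  intros He. unfold enc_list.
  induction l as [|a l IH]; intros [|a' l'] r r' H; simpl in H; try discriminate.
  - injection H; auto.
  - injection H as H. rewrite <- !app_assoc in H. apply He in H. destruct H as [-> H].
    rewrite !app_assoc in H. apply IH in H. destruct H; subst; auto.
Qed.

Lemma enc_fact_prefix f f' r r' :
  enc_fact f ++ r = enc_fact f' ++ r' -> f = f' /\ r = r'.
Proof.
  destruct f, f'; unfold enc_fact; simpl. rewrite <- !app_assoc. intros H.
  apply enc_nat_prefix in H. destruct H as [-> H].
  apply (enc_list_prefix _ enc_nat_prefix) in H. destruct H; subst; auto.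
Qed.

Lemma enc_db_inj D D' : enc_db D = enc_db D' -> D = D'.
Proof.
  intros H. apply (f_equal (fun l => l ++ [])) in H.
  apply (enc_list_prefix _ enc_fact_prefix) in H. apply H.
Qed.

(** * The dependencies and their repairs on circuits *)

Definition lat (n : nat) (ts : list term) : lit := LAtom (mkAtom (P n (length ts)) ts).

Definition fN v := mkFact 0 [v].
Definition fG v a b c := mkFact 1 [v; a; b; c].
Definition fL v u s := mkFact 2 [v; u; s].
Definition fV u s := mkFact 3 [u; s].
Definition fU u := mkFact 4 [u].
Definition fBad u := mkFact 5 [u].

(* Bad, which no circuit mentions, plays the role of the predicate Bot; as it
   contains u, the variable u, which is repeated in the body, is not marked. *)
Definition dep_choice : dep :=
  mkDep [lat 3 [TVar 0; TConst 0]; lat 3 [TVar 0; TConst 1]] [mkCQ [] [lat 5 [TVar 0]]].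

Definition dep_var : dep :=
  mkDep [lat 3 [TVar 0; TVar 1]]
        [mkCQ [] [lat 4 [TVar 0]]; mkCQ [] [lat 0 [TConst 3]]].

Definition dep_node : dep :=
  mkDep [lat 0 [TVar 0]]
        [mkCQ [1; 2; 3] [lat 1 [TVar 0; TVar 1; TVar 2; TVar 3];
                         lat 0 [TVar 1]; lat 0 [TVar 2]; lat 0 [TVar 3]];
         mkCQ [1; 2] [lat 2 [TVar 0; TVar 1; TVar 2]; lat 3 [TVar 1; TVar 2]]].

Definition Sigma_circ : list dep := [dep_choice; dep_var; dep_node].

Ltac in_cases :=
  repeat match goal with
  | H : In _ (_ :: _) |- _ => destruct H as [H|H]; subst
  | H : In _ [] |- _ => destruct H
  | H : _ \/ _ |- _ => destruct H; subst
  | H : False |- _ => destruct H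
  end.

Lemma Sigma_wf : Forall wf_dep Sigma_circ.
Proof.
  assert (Hw : forall ls, ls <> [] -> forallb (fun a => length (aargs a) =? arity (apred a)) (lits_atoms ls) = true
                     -> wf_lits ls).
  { intros ls H1 H2. split; auto. apply Forall_forall. intros a Ha.
    rewrite forallb_forall in H2. apply Nat.eqb_eq, H2, Ha. }
  repeat apply Forall_cons; try apply Forall_nil;
    (split; [apply Hw; [discriminate|reflexivity]|]);
    (split; [simpl; intros x Hx; eexists; split; [left; reflexivity|]; simpl; tauto|]);
    (split; [discriminate|]);
    simpl; intros q Hq; in_cases;
    (split; [apply Hw; [discriminate|reflexivity]|]); simpl;
    (split; [intros x Hx; in_cases; auto|]);
    intros y Hy; in_cases;
    (split; [eexists; split; [left; reflexivity|]; simpl; tauto|lia]).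
Qed.

Lemma Sigma_guarded : Forall guarded Sigma_circ.
Proof.
  repeat constructor; eexists; (split; [left; reflexivity|]); simpl; tauto.
Qed.

(** The only head atom contains the only body variable, which excludes the base case; its predicate
    occurs in no body, which excludes propagation. *)
Lemma choice_unmarked x : ~ marked Sigma_circ 0 x.
Proof.
  intros H. remember 0 as i eqn:Ei.
  destruct H as [i d y Hd Hx [a [Ha Hn]]|i d y j d' a a' Hd Hx Hd' Ha Ha' Hp _]; subst i;
    simpl in Hd; injection Hd as <-; simpl in Ha.
  - apply Hn. simpl in Hx. destruct Ha as [<-|[]]. simpl. tauto.
  - destruct j as [|[|[|[|j]]]]; simpl in Hd'; try discriminate;
      injection Hd' as <-; simpl in Ha'; in_cases; discriminate.
Qed.

(** Only [dep_choice] repeats a body variable; in the other two dependencies each variable occurs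
    once, marked or not. *)
Lemma Sigma_sticky : sticky Sigma_circ.
Proof.
  intros [|[|[|[|i]]]] d x Hd Hm; try discriminate Hd; injection Hd as <-.
  - destruct (choice_unmarked x Hm).
  - destruct x as [|[|x]]; simpl; lia.
  - destruct x as [|[|x]]; simpl; lia.
Qed.

(** * Consistency spelled out on facts *)

Definition circ_consistent (S : fset) : Prop :=
  (forall u, S (fV u 0) -> S (fV u 1) -> S (fBad u)) /\
  (forall u s, S (fV u s) -> S (fU u) \/ S (fN 3)) /\
  (forall v, S (fN v) ->
     (exists a b c, S (fG v a b c) /\ S (fN a) /\ S (fN b) /\ S (fN c)) \/
     (exists u s, S (fL v u s) /\ S (fV u s))).

Lemma consistent_Sigma_iff S : consistent Sigma_circ S <-> circ_consistent S.
Proof.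
  unfold consistent, Sigma_circ. rewrite !Forall_cons_iff. split.
  - intros (H1 & H2 & H3 & _). split; [|split].
    + intros u h0 h1. assert (E : Exists (cq_holds S (fun _ => u)) (dhead dep_choice))
        by (apply H1; repeat constructor; assumption).
      apply Exists_exists in E. destruct E as (q & Hq & mu & Hmu & Hb). simpl in Hq; in_cases. simpl in Hb.
      rewrite Forall_cons_iff in Hb. destruct Hb as [[_ Hf] _]. simpl in Hf.
      rewrite Hmu in Hf by auto. exact Hf.
    + intros u s h. assert (E : Exists (cq_holds S (fun k => match k with 0 => u | _ => s end)) (dhead dep_var))
        by (apply H2; repeat constructor; assumption).
      apply Exists_exists in E. destruct E as (q & Hq & mu & Hmu & Hb). simpl in Hq; in_cases; simpl in Hb, Hmu;
        rewrite Forall_cons_iff in Hb; destruct Hb as [[_ Hf] _]; simpl in Hf.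
      * rewrite Hmu in Hf by auto. auto.
      * auto.
    + intros v h. assert (E : Exists (cq_holds S (fun _ => v)) (dhead dep_node))
        by (apply H3; repeat constructor; assumption).
      apply Exists_exists in E. destruct E as (q & Hq & mu & Hmu & Hb). simpl in Hq; in_cases; simpl in Hb, Hmu.
      * left. rewrite !Forall_cons_iff in Hb. simpl in Hb.
        destruct Hb as ([_ h1] & [_ h2] & [_ h3] & [_ h4] & _).
        cbn in h1, h2, h3, h4. rewrite Hmu in h1 by lia. do 3 eexists; repeat split; eassumption.
      * right. rewrite !Forall_cons_iff in Hb. simpl in Hb.
        destruct Hb as ([_ h1] & [_ h2] & _).
        cbn in h1, h2. rewrite Hmu in h1 by lia. do 2 eexists; repeat split; eassumption.
  - intros (H1 & H2 & H3). split; [|split; [|split; [|constructor]]].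
    + intros nu Hb. simpl in Hb. rewrite !Forall_cons_iff in Hb. destruct Hb as ([_ h1] & [_ h2] & _).
      cbn in h1, h2. left. exists nu. split; auto. constructor; [|constructor]. split; [reflexivity|]. exact (H1 _ h1 h2).
    + intros nu Hb. simpl in Hb. rewrite !Forall_cons_iff in Hb. destruct Hb as ([_ h1] & _). cbn in h1.
      destruct (H2 _ _ h1); [left|right; left]; exists nu; (split; [auto|]);
        repeat constructor; assumption.
    + intros nu Hb. simpl in Hb. rewrite !Forall_cons_iff in Hb. destruct Hb as ([_ h1] & _). cbn in h1.
      destruct (H3 _ h1) as [(a & b & c & ha & hb & hc & hd)|(u & s & hu & hs)];
        [left|right; left].
      * exists (fun k => match k with 1 => a | 2 => b | 3 => c | _ => nu k end).
        split; [|repeat constructor; assumption].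
        intros [|[|[|[|k]]]] Hk; simpl in Hk; auto; tauto.
      * exists (fun k => match k with 1 => u | 2 => s | _ => nu k end).
        split; [|repeat constructor; assumption].
        intros [|[|[|k]]] Hk; simpl in Hk; auto; tauto.
Qed.

(** * Extending a consistent set of facts to a repair *)

Definition decide (Q : Prop) : bool := if excluded_middle_informative Q then true else false.

Lemma decide_true Q : decide Q = true <-> Q.
Proof. unfold decide. destruct (excluded_middle_informative Q); split; auto; discriminate. Qed.

Lemma decide_false Q : decide Q = false <-> ~ Q.
Proof. unfold decide. destruct (excluded_middle_informative Q); split; auto; try discriminate; tauto. Qed.

Lemma filter_length_lt {A} (f g : A -> bool) l a :
  (forall x, f x = true -> g x = true) -> In a l -> f a = false -> g a = true ->
  length (filter f l) < length (filter g l).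
Proof.
  intros Hfg. assert (Hle : forall l, length (filter f l) <= length (filter g l)).
  { induction l0 as [|x l0 IH]; simpl; auto.
    destruct (f x) eqn:E; [rewrite (Hfg _ E); simpl; lia|]. destruct (g x); simpl; lia. }
  induction l as [|x l IH]; simpl; intros Hin Hf Hg; [destruct Hin|].
  destruct Hin as [->|Hin].
  - rewrite Hf, Hg. simpl. specialize (Hle l). lia.
  - specialize (IH Hin Hf Hg). destruct (f x) eqn:E; [rewrite (Hfg _ E); simpl; lia|].
    destruct (g x); simpl; lia.
Qed.

(** Consistency is not monotone, so facts cannot be added one at a time: either [S] is maximal or
    one jumps to a larger consistent set. Induction is on the number of entries of [D] outside
    [S]. *)
Lemma repair_above Sg D S : subset S (in_db D) -> consistent Sg S ->
  exists R, repair Sg D R /\ subset S R.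
Proof.
  remember (length D - length (filter (fun f => decide (S f)) D)) as n eqn:En.
  revert S En. induction n as [n IH] using lt_wf_ind. intros S En HS HC.
  destruct (classic (exists R', subset S R' /\ subset R' (in_db D) /\ consistent Sg R' /\
                              ~ subset R' S)) as [(R' & h1 & h2 & h3 & h4)|Hno].
  - apply not_all_ex_not in h4. destruct h4 as [f h4].
    apply imply_to_and in h4. destruct h4 as [hf hnf].
    assert (length (filter (fun f => decide (S f)) D) < length (filter (fun f => decide (R' f)) D)).
    { apply filter_length_lt with f; auto.
      - intros g Hg. apply decide_true. apply h1. apply decide_true. exact Hg.
      - exact (h2 f hf).
      - apply decide_false; auto.
      - apply decide_true; auto. }
    pose proof (filter_length_le (fun f => decide (R' f)) D).
    destruct (IH (length D - length (filter (fun f => decide (R' f)) D)) ltac:(lia) R' eq_refl h2 h3)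
      as (R & HR & HSR).
    exists R. split; auto. intros g Hg. auto.
  - exists S. split; [|intros g; auto]. split; [auto|split; [auto|]].
    intros R' h1 h2 h3. apply NNPP. intros h4. apply Hno. exists R'. auto.
Qed.

(** * Circuits as databases *)

Definition node := list nat.

Inductive gitem (N : Type) :=
| Gate (v a b c : N)
| Lit (v u : N) (s : bool)
| Univ (u : N).

Arguments Gate {N}.
Arguments Lit {N}.
Arguments Univ {N}.

Definition item := gitem node.

(** A literal contributes both values of its variable, which leaves the choice to the repairs. *)
Definition item_facts (i : item) : list fact :=
  match i with
  | Gate v a b c => [fN (node_id v); fG (node_id v) (node_id a) (node_id b) (node_id c)]
  | Lit v u s => [fN (node_id v); fL (node_id v) (node_id u) (Nat.b2n s);
                  fV (node_id u) 0; fV (node_id u) 1]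
  | Univ u => [fU (node_id u)]
  end.

Definition items_db (I : list item) : database := flat_map item_facts I.

(** A least fixpoint, whereas consistency only asks that each node present be supported, a
    greatest-fixpoint condition. The rank in [IAR_circuit] reconciles the two. *)
Inductive Der (I : list item) (g : node -> bool) : node -> Prop :=
| Der_gate v a b c : In (Gate v a b c) I -> Der I g a -> Der I g b -> Der I g c -> Der I g v
| Der_lit v u : In (Lit v u (g u)) I -> Der I g v.

Lemma in_items_db I f : in_db (items_db I) f <-> exists i, In i I /\ In f (item_facts i).
Proof. unfold in_db, items_db. rewrite in_flat_map. reflexivity. Qed.

Ltac db_inv H :=
  apply in_items_db in H; destruct H as (?i & ?Hi & H);
  match goal with i : item |- _ => destruct i as [?v ?a ?b ?c|?v ?u ?s|?u] end; simpl in H;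
  repeat match type of H with
  | _ \/ _ => destruct H as [H|H]
  | False => destruct H
  end; try discriminate H; injection H; clear H; intros; 
  repeat match goal with E : node_id _ = node_id _ |- _ => apply node_id_inj in E end; subst.

Lemma db_G_inv I v a b c : in_db (items_db I) (fG v a b c) ->
  exists v' a' b' c', v = node_id v' /\ a = node_id a' /\ b = node_id b' /\ c = node_id c' /\
    In (Gate v' a' b' c') I.
Proof. intros H. db_inv H. do 4 eexists. repeat split; eauto. Qed.

Lemma db_L_inv I v u s : in_db (items_db I) (fL v u s) ->
  exists v' u' s', v = node_id v' /\ u = node_id u' /\ s = Nat.b2n s' /\ In (Lit v' u' s') I.
Proof. intros H. db_inv H. do 3 eexists. repeat split; eauto. Qed.

Lemma db_V_inv I u s : in_db (items_db I) (fV u s) ->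
  exists u' s', u = node_id u' /\ s = Nat.b2n s' /\
    forall s'', in_db (items_db I) (fV u (Nat.b2n s'')).
Proof.
  intros H. db_inv H; [exists u0, false|exists u0, true]; (split; [reflexivity|]);
    (split; [reflexivity|]); intros [|]; apply in_items_db; exists (Lit v u0 s0); simpl; auto 10.
Qed.

Lemma db_U_inv I u : in_db (items_db I) (fU u) -> exists u', u = node_id u' /\ In (Univ u') I.
Proof. intros H. db_inv H. eauto. Qed.

Lemma db_Bad_inv I u : ~ in_db (items_db I) (fBad u).
Proof. intros H. db_inv H. Qed.

Lemma Der_db I g v : Der I g v -> in_db (items_db I) (fN (node_id v)).
Proof.
  intros [? ? ? ? H|? ? H]; apply in_items_db; eexists; (split; [exact H|]); simpl; auto.
Qed.

(** The predicates of [fG], [fL] and [fU] occur in no body, so adding such facts never destroys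
    consistency. *)
Definition static (f : fact) : Prop := fname f = 1 \/ fname f = 2 \/ fname f = 4.

Theorem IAR_circuit (I : list item) (rk : node -> nat) :
  (forall v a b c, In (Gate v a b c) I -> rk a < rk v /\ rk b < rk v /\ rk c < rk v) ->
  IAR_entails_fact Sigma_circ (items_db I) (fN 3) <->
  forall be : node -> bool, exists ga : node -> bool,
    (forall u, In (Univ u) I -> ga u = be u) /\ Der I ga [0].
Proof.
  intros Hrk. set (D := items_db I). split.
  - intros HI be.
    (* Any repair above [S] is bound to follow [be] on the universal variables. *)
    set (S := fun f => in_db D f /\
      (static f \/ exists u, In (Univ u) I /\ f = fV (node_id u) (Nat.b2n (be u)))).
    assert (HS : consistent Sigma_circ S).
    { apply consistent_Sigma_iff. split; [|split].
      - intros u [_ [[H|[H|H]]|(w & _ & Hw)]] [_ [[H'|[H'|H']]|(w' & _ & Hw')]]; try discriminate.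
        injection Hw as -> Hw. injection Hw' as E Hw'. apply node_id_inj in E; subst w'.
        congruence.
      - intros u s [Hd [[H|[H|H]]|(w & Hw & E)]]; try discriminate. left.
        injection E as -> ->. split; [|left; unfold static; auto].
        apply in_items_db. exists (Univ w). simpl; auto.
      - intros v [_ [[H|[H|H]]|(w & Hw & E)]]; discriminate. }
    destruct (repair_above Sigma_circ D S) as (R & HR & HSR); [intros f [Hf _]; exact Hf|exact HS|].
    specialize (HI R HR). destruct HR as (HRD & HRC & _).
    apply consistent_Sigma_iff in HRC. destruct HRC as (C1 & C2 & C3).
    assert (Hex : forall u, R (fV u 0) -> R (fV u 1) -> False).
    { intros u h0 h1. apply (db_Bad_inv I u). apply HRD. auto. }
    (* Universal variables follow [be] even if no literal gives them a value; the others are read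
       off [R]. *)
    exists (fun u => if decide (In (Univ u) I) then be u else decide (R (fV (node_id u) 1))).
    split.
    { intros u Hu. rewrite (proj2 (decide_true _) Hu). reflexivity. }
    set (ga := fun u => _).
    assert (HV : forall (u : node) s, R (fV (node_id u) (Nat.b2n s)) -> s = ga u).
    { intros u s Hs. unfold ga. destruct (decide (In (Univ u) I)) eqn:Eu.
      - rewrite decide_true in Eu.
        destruct (db_V_inv I _ _ (HRD _ Hs)) as (_ & _ & _ & _ & Hall).
        assert (Hb : R (fV (node_id u) (Nat.b2n (be u)))).
        (* The database has both values of [u], so the one chosen by [be] is in [S], hence in [R],
           and exclusivity rules out the other. *)
        { apply HSR. split; [apply Hall|]. right; eauto. }
        destruct s, (be u); auto; exfalso; [exact (Hex _ Hb Hs)|exact (Hex _ Hs Hb)].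
      - symmetry. destruct s; [apply decide_true; auto|apply decide_false].
        intros h1. exact (Hex _ Hs h1). }
    (* Induction on the rank turns local support into a derivation. *)
    assert (HN : forall n (v : node), rk v <= n -> R (fN (node_id v)) -> Der I ga v).
    { induction n as [n IH] using lt_wf_ind. intros v Hv HRv.
      destruct (C3 _ HRv) as [(a & b & c & h1 & h2 & h3 & h4)|(u & s & h1 & h2)].
      - destruct (db_G_inv I _ _ _ _ (HRD _ h1)) as (v' & a' & b' & c' & E & -> & -> & -> & Hg).
        apply node_id_inj in E; subst v'. specialize (Hrk _ _ _ _ Hg).
        eapply Der_gate; eauto; eapply IH; eauto; lia.
      - destruct (db_L_inv I _ _ _ (HRD _ h1)) as (v' & u' & s' & E & -> & -> & Hg).
        apply node_id_inj in E; subst v'. rewrite (HV _ _ h2) in Hg. eapply Der_lit; eauto. }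
    apply (HN (rk [0])); auto.
  - intros Hall R HR. pose proof HR as (HRD & HRC & Hmax).
    apply consistent_Sigma_iff in HRC. destruct HRC as (C1 & C2 & C3).
    apply NNPP. intros Hna.
    assert (Hex : forall u, R (fV u 0) -> R (fV u 1) -> False).
    { intros u h0 h1. apply (db_Bad_inv I u). apply HRD. auto. }
    (* The assignment that [R] makes, with false where [R] has no value. *)
    destruct (Hall (fun u => decide (R (fV (node_id u) 1)))) as (ga & Hga & Hroot).
    (* Without the goal fact, [dep_var] leaves values in [R] only for universal variables, where
       [ga] copies [R]. *)
    assert (HV : forall (u : node) s, R (fV (node_id u) (Nat.b2n s)) -> s = ga u).
    { intros u s Hs. destruct (C2 _ _ Hs) as [HU|HN]; [|contradiction].
      apply HRD in HU. apply db_U_inv in HU. destruct HU as (u' & E & HU).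
      apply node_id_inj in E; subst u'. rewrite (Hga _ HU). symmetry.
      destruct s; [apply decide_true; auto|apply decide_false].
      intros h1. exact (Hex _ Hs h1). }
    (* [R] enlarged by everything the assignment [ga] justifies; if it is consistent, maximality
       puts the goal fact into [R]. *)
    set (R' := fun f => R f \/ (in_db D f /\
      (static f \/ (exists v, Der I ga v /\ f = fN (node_id v)) \/
       exists u, f = fV (node_id u) (Nat.b2n (ga u))))).
    assert (HV' : forall u s, R' (fV (node_id u) (Nat.b2n s)) -> s = ga u).
    { intros u s [H|[_ [[H|[H|H]]|[(v & _ & H)|(u' & H)]]]]; try discriminate; auto.
      injection H as E H. apply node_id_inj in E; subst u'. destruct s, (ga u); auto; discriminate. }
    assert (HD' : subset R' (in_db D)) by (intros f [H|[H _]]; auto).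
    apply Hna. apply (Hmax R').
    + intros f Hf; left; exact Hf.
    + exact HD'.
    + apply consistent_Sigma_iff. split; [|split].
      * intros u h0 h1. destruct (db_V_inv I _ _ (HD' _ h0)) as (u' & _ & -> & _).
        apply (HV' u' false) in h0. apply (HV' u' true) in h1. congruence.
      (* With the root present, the second head disjunct of [dep_var] covers all variables. *)
      * intros u s _. right. right. split; [exact (Der_db _ _ _ Hroot)|].
        right; left. exists [0]. auto.
      * intros v [H|[_ [[H|[H|H]]|[(w & H & E)|(u' & H)]]]]; try discriminate.
        { destruct (C3 _ H) as [(a & b & c & h1 & h2 & h3 & h4)|(u & s & h1 & h2)].
          - left. exists a, b, c. unfold R'; auto.
          - right. exists u, s. unfold R'; auto. }
        injection E as ->.
        assert (HDer : forall a, Der I ga a -> R' (fN (node_id a))).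
        { intros a Ha. right. split; [eapply Der_db; eauto|]. right; left; eauto. }
        destruct H as [v a b c Hi Ha Hb Hc|v u Hi].
        { left. exists (node_id a), (node_id b), (node_id c). repeat split; auto.
          right. split; [|left; left; reflexivity].
          apply in_items_db. eexists; split; [exact Hi|]. simpl; auto. }
        { right. exists (node_id u), (Nat.b2n (ga u)). split; right; split.
          - apply in_items_db. eexists; split; [exact Hi|]. simpl; auto.
          - left. right; left; reflexivity.
          - apply in_items_db. eexists; split; [exact Hi|]. simpl. destruct (ga u); auto 10.
          - right; right. eauto. }
    + right. split; [exact (Der_db _ _ _ Hroot)|]. right; left. exists [0]. auto.
Qed.

(** * Tapes as functions, and the tableau as a cellular automaton *)

Definition sym := option bool.

Record acfg := mkA { aq : nat; apos : Z; atp : Z -> sym }.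

Definition dirz (d : dir) : Z := match d with DL => -1 | DR => 1 | DS => 0 end%Z.

Definition tupd (tp : Z -> sym) (p : Z) (w : sym) : Z -> sym :=
  fun p' => if Z.eqb p' p then w else tp p'.

Definition astep (dl : nat -> sym -> nat * sym * dir) (hl : nat -> bool) (a : acfg) : acfg :=
  if hl (aq a) then a else
  let '(q, w, d) := dl (aq a) (atp a (apos a)) in
  mkA q (apos a + dirz d) (tupd (atp a) (apos a) w).

Fixpoint arun dl hl (n : nat) (a : acfg) : acfg :=
  match n with 0 => a | S n' => arun dl hl n' (astep dl hl a) end.

(** The lists are finite windows onto a two-way infinite tape; the default [None] of [nth] supplies
    the blanks beyond them. *)
Definition rep (c : config) (a : acfg) : Prop :=
  cst c = aq a /\ ccur c = atp a (apos a) /\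
  (forall i, nth i (cleft c) None = atp a (apos a - 1 - Z.of_nat i)) /\
  (forall i, nth i (cright c) None = atp a (apos a + 1 + Z.of_nat i)).

Lemma tupd_eq tp p w : tupd tp p w p = w.
Proof. unfold tupd. rewrite Z.eqb_refl. reflexivity. Qed.

Lemma tupd_neq tp p w p' : p' <> p -> tupd tp p w p' = tp p'.
Proof. intros H. unfold tupd. rewrite (proj2 (Z.eqb_neq _ _) H). reflexivity. Qed.

Lemma rep_step M c a : rep c a -> rep (step M c) (astep (delta M) (halting M) a).
Proof.
  intros (H1 & H2 & H3 & H4). unfold step, astep. rewrite <- H1, <- H2.
  destruct (halting M (cst c)); [repeat split; auto|].
  destruct (delta M (cst c) (ccur c)) as [[q w] d].
  destruct d; simpl; unfold move; simpl.
  - assert (HL : rep (match cleft c with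
        | [] => mkConfig q [] None (w :: cright c)
        | h :: t => mkConfig q t h (w :: cright c) end)
        (mkA q (apos a + -1) (tupd (atp a) (apos a) w))).
    { assert (Hr : forall i, nth i (w :: cright c) None =
          tupd (atp a) (apos a) w (apos a + -1 + 1 + Z.of_nat i)).
      { intros [|i]; simpl nth.
        - replace (apos a + -1 + 1 + Z.of_nat 0)%Z with (apos a) by lia. rewrite tupd_eq; auto.
        - rewrite tupd_neq by lia. rewrite H4. f_equal; lia. }
      assert (Hl : forall i, nth i (cleft c) None =
          tupd (atp a) (apos a) w (apos a + -1 - Z.of_nat i)).
      { intros i. rewrite tupd_neq by lia. rewrite H3. f_equal; lia. }
      destruct (cleft c) as [|h t]; repeat split; simpl; auto.
      - specialize (Hl 0). simpl in Hl. rewrite Hl. f_equal; lia.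
      - intros i. specialize (Hl (S i)). simpl nth in Hl. destruct i; rewrite Hl; f_equal; lia.
      - specialize (Hl 0). simpl in Hl. rewrite Hl. f_equal; lia.
      - intros i. specialize (Hl (S i)). simpl nth in Hl. rewrite Hl. f_equal; lia. }
    exact HL.
  - assert (HR : rep (match cright c with
        | [] => mkConfig q (w :: cleft c) None []
        | h :: t => mkConfig q (w :: cleft c) h t end)
        (mkA q (apos a + 1) (tupd (atp a) (apos a) w))).
    { assert (Hl : forall i, nth i (w :: cleft c) None =
          tupd (atp a) (apos a) w (apos a + 1 - 1 - Z.of_nat i)).
      { intros [|i]; simpl nth.
        - replace (apos a + 1 - 1 - Z.of_nat 0)%Z with (apos a) by lia. rewrite tupd_eq; auto.
        - rewrite tupd_neq by lia. rewrite H3. f_equal; lia. }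
      assert (Hr : forall i, nth i (cright c) None =
          tupd (atp a) (apos a) w (apos a + 1 + Z.of_nat i)).
      { intros i. rewrite tupd_neq by lia. rewrite H4. reflexivity. }
      destruct (cright c) as [|h t]; repeat split; simpl; auto.
      - specialize (Hr 0). simpl in Hr. rewrite Hr. f_equal; lia.
      - intros i. specialize (Hr (S i)). simpl nth in Hr. destruct i; rewrite Hr; f_equal; lia.
      - specialize (Hr 0). simpl in Hr. rewrite Hr. f_equal; lia.
      - intros i. specialize (Hr (S i)). simpl nth in Hr. rewrite Hr. f_equal; lia. }
    exact HR.
  - rewrite Z.add_0_r. repeat split; simpl.
    + rewrite tupd_eq; auto.
    + intros i. rewrite tupd_neq by lia. apply H3.
    + intros i. rewrite tupd_neq by lia. apply H4.
Qed.

Lemma rep_run M n : forall c a, rep c a -> rep (run M n c) (arun (delta M) (halting M) n a).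
Proof. induction n; simpl; intros; auto. apply IHn, rep_step; auto. Qed.

Definition word_at (x : list bool) (p0 : Z) (tp : Z -> sym) : Prop :=
  forall p, tp p = if Z.leb p0 p then nth (Z.to_nat (p - p0)) (map Some x) None else None.

Lemma rep_init M x a : aq a = tm_start M -> word_at x (apos a) (atp a) -> rep (init M x) a.
Proof.
  intros Hq Hw. unfold word_at in Hw. unfold rep.
  assert (Hl : forall i, None = atp a (apos a - 1 - Z.of_nat i)).
  { intros i. rewrite Hw. rewrite (proj2 (Z.leb_gt _ _)) by lia. reflexivity. }
  assert (Hc : nth 0 (map Some x) None = atp a (apos a)).
  { rewrite Hw, Z.leb_refl, Z.sub_diag. reflexivity. }
  assert (Hr : forall i, nth (S i) (map Some x) None = atp a (apos a + 1 + Z.of_nat i)).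
  { intros i. rewrite Hw. rewrite (proj2 (Z.leb_le _ _)) by lia.
    replace (Z.to_nat (apos a + 1 + Z.of_nat i - apos a)) with (S i) by lia. reflexivity. }
  destruct x as [|b x]; simpl in *; repeat split; auto; intros i; rewrite <- ?Hr, <- ?Hl;
    destruct i; reflexivity.
Qed.

Lemma somes_spec l w : (forall i, i < length w -> nth i l None = Some (nth i w false)) ->
  nth (length w) l None = None -> somes l = w.
Proof.
  revert l; induction w as [|b w IH]; intros l H1 H2.
  - destruct l as [|[b|] l]; simpl in *; auto; discriminate.
  - pose proof (H1 0 ltac:(simpl; lia)) as H0. destruct l as [|o l]; simpl in *; try discriminate.
    subst o. f_equal. apply IH; auto. intros i Hi. apply (H1 (S i)). lia.
Qed.

Lemma rep_output c a w : rep c a ->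
  (forall i, i < length w -> atp a (apos a + Z.of_nat i) = Some (nth i w false)) ->
  atp a (apos a + Z.of_nat (length w)) = None -> output c = w.
Proof.
  intros (_ & H2 & _ & H4) Hw Hn. unfold output.
  assert (E : forall i, nth i (ccur c :: cright c) None = atp a (apos a + Z.of_nat i)).
  { intros [|i]; simpl nth; [rewrite H2|rewrite H4]; f_equal; lia. }
  apply somes_spec; intros; rewrite E; auto.
Qed.

Lemma run_add M n m c : run M (n + m) c = run M m (run M n c).
Proof. revert c; induction n; simpl; auto. Qed.

Lemma run_halted M n c : halting M (cst c) = true -> run M n c = c.
Proof.
  intros H; induction n; simpl; auto. unfold step. rewrite H. auto.
Qed.

(** * Computations as a cellular automaton of radius one *)

Definition content := (sym * option nat)%type.

Definition cont (a : acfg) (p : Z) : content :=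
  (atp a p, if Z.eqb p (apos a) then Some (aq a) else None).

(** The state brought along by a head that leaves a cell with content [c] in direction [d]; a halted
    head never leaves. *)
Definition incoming dl hl (c : content) (d : dir) : option nat :=
  match snd c with
  | Some q => if hl q : bool then None else
      let '(q', _, d') := dl q (fst c) : nat * sym * dir in
      match d, d' with DL, DL | DR, DR => Some q' | _, _ => None end
  | None => None
  end.

Definition nextc dl hl (cl cc cr : content) : content :=
  match snd cc with
  | Some q => if hl q : bool then cc else
      let '(q', w, d) := dl q (fst cc) : nat * sym * dir in
      (w, match d with DS => Some q' | _ => None end)
  | None => (fst cc, match incoming dl hl cl DR with
                     | Some q => Some q
                     | None => incoming dl hl cr DL
                     end)
  end.

Ltac zeqb :=
  match goal with |- context [Z.eqb ?u ?v] => destruct (Z.eqb_spec u v) end.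

(* A head occupies one cell, so at most one neighbour can send it over. *)
Lemma cont_step dl hl a p :
  cont (astep dl hl a) p = nextc dl hl (cont a (p - 1)) (cont a p) (cont a (p + 1)).
Proof.
  unfold cont, astep, nextc, incoming, tupd; cbn [fst snd].
  destruct (Z.eqb_spec p (apos a)) as [->|Hp].
  - destruct (hl (aq a)); [rewrite Z.eqb_refl; reflexivity|].
    destruct (dl (aq a) (atp a (apos a))) as [[q w] d]. cbn [aq apos atp]. rewrite Z.eqb_refl.
    destruct d; cbn [dirz]; f_equal; zeqb; auto; lia.
  - destruct (Z.eqb_spec (p - 1) (apos a)) as [Hl|Hl];
      destruct (Z.eqb_spec (p + 1) (apos a)) as [Hr|Hr]; try lia.
    + rewrite <- Hl. destruct (hl (aq a)); [rewrite (proj2 (Z.eqb_neq _ _)) by lia; reflexivity|].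
      destruct (dl (aq a) (atp a (p - 1))) as [[q w] d]. cbn [aq apos atp].
      rewrite (proj2 (Z.eqb_neq p (p - 1))) by lia.
      destruct d; cbn [dirz]; zeqb; auto; lia.
    + rewrite <- Hr. destruct (hl (aq a)); [rewrite (proj2 (Z.eqb_neq _ _)) by lia; reflexivity|].
      destruct (dl (aq a) (atp a (p + 1))) as [[q w] d]. cbn [aq apos atp].
      rewrite (proj2 (Z.eqb_neq p (p + 1))) by lia.
      destruct d; cbn [dirz]; zeqb; auto; lia.
    + destruct (hl (aq a)); [rewrite (proj2 (Z.eqb_neq _ _)) by lia; reflexivity|].
      destruct (dl (aq a) (atp a (apos a))) as [[q w] d]. cbn [aq apos atp].
      rewrite (proj2 (Z.eqb_neq p (apos a))) by lia.
      destruct d; cbn [dirz]; zeqb; auto; lia.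
Qed.

(* The machine M with an extra initial state [nst M], whose head starts just
   left of the input: the initial row then does not depend on the first symbol. *)
Definition xdelta (M : TM) (q : nat) (s : sym) : nat * sym * dir :=
  if q =? nst M then (tm_start M, None, DR) else delta M q s.

Definition xhalt (M : TM) (q : nat) : bool := if q =? nst M then false else halting M q.

Definition xacc (M : TM) (q : nat) : bool :=
  if q =? nst M then false else halting M q && accepting M q.

Definition xstart (M : TM) (x : list bool) : acfg :=
  mkA (nst M) (-1) (fun p => if Z.leb 0 p then nth (Z.to_nat p) (map Some x) None else None).

Notation xrun M := (arun (xdelta M) (xhalt M)).

Lemma xrun_agree M n : forall a, aq a < nst M ->
  arun (xdelta M) (xhalt M) n a = arun (delta M) (halting M) n a /\
  aq (arun (delta M) (halting M) n a) < nst M.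
Proof.
  induction n as [|n IH]; simpl; intros a Ha; auto.
  assert (E : astep (xdelta M) (xhalt M) a = astep (delta M) (halting M) a).
  { unfold astep, xdelta, xhalt. rewrite (proj2 (Nat.eqb_neq _ _)) by lia. reflexivity. }
  rewrite E. apply IH. unfold astep. destruct (halting M (aq a)); auto.
  pose proof (delta_ok M (aq a) (atp a (apos a)) Ha) as Hd.
  destruct (delta M (aq a) (atp a (apos a))) as [[q w] d]. exact Hd.
Qed.

(** The extra first step only takes the head from -1 to 0, hence the shift from [t] to [S t]. *)
Lemma xrun_rep M x t :
  rep (run M t (init M x)) (xrun M (S t) (xstart M x)) /\ aq (xrun M (S t) (xstart M x)) < nst M.
Proof.
  cbn [arun]. set (a := astep _ _ _).
  assert (Ha : aq a = tm_start M /\ apos a = 0%Z /\ word_at x (apos a) (atp a)).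
  { unfold a, astep, xhalt, xdelta, xstart; cbn [aq apos atp]. rewrite Nat.eqb_refl.
    cbn. repeat split. intros p. unfold tupd. rewrite Z.sub_0_r.
    destruct (Z.eqb_spec p (-1)); subst; reflexivity. }
  destruct Ha as (H1 & H2 & H3).
  pose proof (start_ok M) as Hs. rewrite <- H1 in Hs.
  destruct (xrun_agree M t a Hs) as [E Hlt]. rewrite E. split; auto.
  apply rep_run, rep_init; auto.
Qed.

(** A halted configuration is a fixed point, so all halting times show the same configuration,
    whichever of [t] and [t'] comes first. *)
Lemma xacc_sound M x t t' : halting M (cst (run M t (init M x))) = true ->
  xacc M (aq (xrun M t' (xstart M x))) = true ->
  accepting M (cst (run M t (init M x))) = true.
Proof.
  intros Ht. destruct t' as [|t'].
  { unfold xacc. simpl. rewrite Nat.eqb_refl. discriminate. }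
  destruct (xrun_rep M x t') as [(E & _) Hlt]. unfold xacc. rewrite <- E in *.
  rewrite (proj2 (Nat.eqb_neq _ _)) by lia. intros H. apply andb_prop in H. destruct H as [H1 H2].
  destruct (Nat.le_ge_cases t t') as [L|L].
  - replace t' with (t + (t' - t)) in H2 by lia. rewrite run_add, run_halted in H2; auto.
  - replace t with (t' + (t - t')) by lia. rewrite run_add, run_halted; auto.
Qed.

Lemma xacc_complete M x t t' : halting M (cst (run M t (init M x))) = true ->
  accepting M (cst (run M t (init M x))) = true -> t < t' ->
  xacc M (aq (xrun M t' (xstart M x))) = true.
Proof.
  intros Ht Ha Hlt. destruct t' as [|t']; [lia|].
  destruct (xrun_rep M x t') as [(E & _) Hq]. unfold xacc. rewrite <- E in *.
  rewrite (proj2 (Nat.eqb_neq _ _)) by lia.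
  replace t' with (t + (t' - t)) by lia. rewrite run_add, run_halted; auto.
  rewrite Ht, Ha. reflexivity.
Qed.

Lemma arun_pos dl hl n : forall a, (Z.abs (apos (arun dl hl n a) - apos a) <= Z.of_nat n)%Z.
Proof.
  induction n as [|n IH]; simpl arun; intros a; [lia|].
  specialize (IH (astep dl hl a)).
  assert (Z.abs (apos (astep dl hl a) - apos a) <= 1)%Z; [|lia].
  unfold astep. destruct (hl (aq a)); [lia|].
  destruct (dl (aq a) (atp a (apos a))) as [[q w] d]. simpl. destruct d; simpl; lia.
Qed.

Lemma arun_S dl hl n a : arun dl hl (S n) a = astep dl hl (arun dl hl n a).
Proof. revert a; induction n as [|n IH]; intros a; [reflexivity|]. exact (IH (astep dl hl a)). Qed.

Lemma xrun_state M n : forall a, aq a <= nst M -> aq (xrun M n a) <= nst M.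
Proof.
  induction n as [|n IH]; simpl; intros a Ha; auto. apply IH. unfold astep, xhalt, xdelta.
  destruct (Nat.eqb_spec (aq a) (nst M)).
  - simpl. pose proof (start_ok M). lia.
  - destruct (halting M (aq a)); auto.
    pose proof (delta_ok M (aq a) (atp a (apos a)) ltac:(lia)) as Hd.
    destruct (delta M (aq a) (atp a (apos a))) as [[q w] d]. simpl in *. lia.
Qed.

(** * Stack programs and their Turing machines *)

(** Popping is bundled with the loop test: [While] is test, branch and pop in one, and the language
    has no other way to read a stack. *)
Inductive cmd :=
| Skip
| Push (r : nat) (b : bool)
| Seq (c1 c2 : cmd)
| While (r : nat) (c0 c1 : cmd).

Definition regs := nat -> list bool.

Definition upd (s : regs) (r : nat) (w : list bool) : regs :=
  fun r' => if r' =? r then w else s r'.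

Inductive exec : cmd -> regs -> regs -> nat -> Prop :=
| ex_skip s : exec Skip s s 1
| ex_push r b (s : regs) : exec (Push r b) s (upd s r (b :: s r)) 1
| ex_seq c1 c2 s1 s2 s3 n1 n2 : exec c1 s1 s2 n1 -> exec c2 s2 s3 n2 ->
    exec (Seq c1 c2) s1 s3 (n1 + n2)
| ex_done r c0 c1 (s : regs) : s r = [] -> exec (While r c0 c1) s s 1
| ex_loop r c0 c1 (s1 s2 s3 : regs) (b : bool) w n1 n2 : s1 r = b :: w ->
    exec (if b then c1 else c0) (upd s1 r w) s2 n1 ->
    exec (While r c0 c1) s2 s3 n2 ->
    exec (While r c0 c1) s1 s3 (S (n1 + n2)).

Lemma upd_eq s r w : upd s r w r = w.
Proof. unfold upd. rewrite Nat.eqb_refl. reflexivity. Qed.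

Lemma upd_neq s r w r' : r' <> r -> upd s r w r' = s r'.
Proof. intros H. unfold upd. rewrite (proj2 (Nat.eqb_neq _ _) H). reflexivity. Qed.

(** Turns a bound on running time into a bound on the stretch of tape that the head has to cross. *)
Lemma exec_size c s s' n : exec c s s' n -> forall r, length (s' r) <= length (s r) + n.
Proof.
  induction 1; intros r'; try lia.
  - unfold upd. destruct (Nat.eqb_spec r' r); subst; simpl; lia.
  - specialize (IHexec1 r'). specialize (IHexec2 r'). lia.
  - specialize (IHexec1 r'). specialize (IHexec2 r'). unfold upd in IHexec1.
    destruct (Nat.eqb_spec r' r); subst; [rewrite H; simpl|]; lia.
Qed.

Fixpoint cmd_regs (m : nat) (c : cmd) : Prop :=
  match c with
  | Skip => True
  | Push r _ => r < m
  | Seq c1 c2 => cmd_regs m c1 /\ cmd_regs m c2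
  | While r c0 c1 => r < m /\ cmd_regs m c0 /\ cmd_regs m c1
  end.

(** * Flat code for stack programs *)

Inductive instr :=
| INop (k : nat)
| IPush (r : nat) (b : bool) (k : nat)
| IPop (r ke k0 k1 : nat)
| IHalt.

Fixpoint clen (c : cmd) : nat :=
  match c with
  | Skip | Push _ _ => 1
  | Seq c1 c2 => clen c1 + clen c2
  | While _ c0 c1 => S (clen c0 + clen c1)
  end.

(** [a] is the address of the first instruction and [k] the address to continue at; the two bodies
    of a loop continue at the [IPop] that heads it. *)
Fixpoint comp (c : cmd) (a k : nat) : list instr :=
  match c with
  | Skip => [INop k]
  | Push r b => [IPush r b k]
  | Seq c1 c2 => comp c1 a (a + clen c1) ++ comp c2 (a + clen c1) k
  | While r c0 c1 =>
      IPop r k (S a) (S a + clen c0) :: comp c0 (S a) a ++ comp c1 (S a + clen c0) a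
  end.

Lemma comp_length c a k : length (comp c a k) = clen c.
Proof.
  revert a k; induction c; intros; simpl; auto; rewrite length_app, ?IHc1, ?IHc2; auto.
Qed.

Definition instr_ok (m B : nat) (i : instr) : Prop :=
  match i with
  | INop k => k <= B
  | IPush r _ k => r < m /\ k <= B
  | IPop r ke k0 k1 => r < m /\ ke <= B /\ k0 <= B /\ k1 <= B
  | IHalt => True
  end.

Lemma clen_pos c : 1 <= clen c.
Proof. induction c; simpl; lia. Qed.

Lemma comp_ok m B c : forall a k, cmd_regs m c -> a + clen c <= B -> k <= B ->
  Forall (instr_ok m B) (comp c a k).
Proof.
  induction c; simpl; intros a k Hr Ha Hk.
  - repeat constructor; auto.
  - repeat constructor; auto.
  - apply Forall_app. pose proof (clen_pos c2). split; [apply IHc1|apply IHc2]; lia || tauto.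
  - pose proof (clen_pos c1). pose proof (clen_pos c2).
    constructor; [simpl; lia|]. apply Forall_app. split; [apply IHc1|apply IHc2]; lia || tauto.
Qed.

(** * The Turing machine that runs flat code *)

Inductive ts :=
| Init0 | Init1
| Entry (pc : nat)
| Scan (pc i : nat)
| Back (pc i : nat)
| Ret (k i : nat)
| L1 (pc : nat)
| LScan (pc : nat)
| LPop (pc : nat)
| LRet (k : nat)
| Done.

Section Machine.

Context (m : nat) (code : list instr).

(** Addresses past the end read as [IHalt], so leaving the code stops the machine. *)
Definition fetch (pc : nat) : instr := nth pc code IHalt.

Definition instr_reg (i : instr) : nat :=
  match i with IPush r _ _ | IPop r _ _ _ => r | _ => 0 end.

Definition pop_next (i : instr) (s : sym) : nat :=
  match i, s with
  | IPop _ ke _ _, None => ke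
  | IPop _ _ k0 _, Some false => k0
  | IPop _ _ _ k1, Some true => k1
  | _, _ => 0
  end.

(** Between instructions the head rests on the home cell in an [Entry] state. [Scan], [Back] and
    [Ret] serve the registers on the right, with a count of cells still to cross; [L1], [LScan],
    [LPop] and [LRet] serve register 0 on the left. *)
Definition tdelta (st : ts) (s : sym) : ts * sym * dir :=
  match st with
  | Init0 => match s with Some _ => (Init0, s, DR) | None => (Init1, None, DR) end
  | Init1 => (Entry 0, Some true, DS)
  | Entry pc =>
      match fetch pc with
      | INop k => (Entry k, s, DS)
      | i => match instr_reg i with
             | 0 => (L1 pc, s, DL)
             (* This step and [r + m] further ones reach cell [m + S r], the bottom of register
                [S r]. *)
             | S r => (Scan pc (r + m), s, DR)
             end
      end
  | Scan pc (S i) => (Scan pc i, s, DR)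
  | Scan pc 0 =>
      match s with
      | Some _ => (Scan pc (m - 1), s, DR)
      | None => match fetch pc with
                | IPush r b k => (Ret k r, Some b, DS)
                (* From the first blank above the stack, [m] cells back is the top symbol, or a cell
                   left of cell [m], always blank, if the stack is empty. *)
                | _ => (Back pc (m - 1), None, DL)
                end
      end
  | Back pc (S i) => (Back pc i, s, DL)
  | Back pc 0 => (Ret (pop_next (fetch pc) s) (instr_reg (fetch pc)), None, DS)
  | Ret k (S i) => (Ret k i, s, DL)
  (* On the multiples of [m] only the home cell is nonblank among those right of cell -1, so hops of
     [m] to the left stop at home. *)
  | Ret k 0 => match s with Some _ => (Entry k, s, DS) | None => (Ret k (m - 1), s, DL) end
  | L1 pc => (LScan pc, s, DL)
  | LScan pc =>
      match s with
      | Some _ => (LScan pc, s, DL)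
      | None => match fetch pc with
                | IPush _ b k => (LRet k, Some b, DR)
                | IPop _ _ _ _ => (LPop pc, None, DR)
                | _ => (Done, None, DR)
                end
      end
  | LPop pc =>
      match s with
      | None => (Entry (pop_next (fetch pc) s), None, DR)
      | Some _ => (LRet (pop_next (fetch pc) s), None, DR)
      end
  | LRet k => match s with Some _ => (LRet k, s, DR) | None => (Entry k, s, DR) end
  | Done => (Done, s, DS)
  end.

Definition tcfg := (ts * Z * (Z -> sym))%type.

Definition tstep (c : tcfg) : tcfg :=
  let '(st, p, tp) := c in
  let '(st', w, d) := tdelta st (tp p) in (st', (p + dirz d)%Z, tupd tp p w).

Inductive tsteps : nat -> tcfg -> tcfg -> Prop :=
| ts_refl c : tsteps 0 c c
| ts_step n c c' : tsteps n (tstep c) c' -> tsteps (S n) c c'.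

Lemma tsteps_trans n1 n2 c1 c2 c3 :
  tsteps n1 c1 c2 -> tsteps n2 c2 c3 -> tsteps (n1 + n2) c1 c3.
Proof. induction 1; simpl; intros; auto. constructor; auto. Qed.

Lemma tupd_same tp p : tupd tp p (tp p) = tp.
Proof.
  extensionality p'. unfold tupd. destruct (Z.eqb_spec p' p); subst; auto.
Qed.

Lemma tupd_same' tp p w : tp p = w -> tupd tp p w = tp.
Proof. intros <-. apply tupd_same. Qed.

(* Tape layout: the home cell 0 holds [Some true]; register 0 is the contiguous
   word left of the blank cell -1, its top being the outermost symbol; register
   [r >= 1] occupies the cells [j * m + r] with [j >= 1], its bottom at [j = 1]. *)
Definition addr (r j : nat) : Z :=
  if r =? 0 then (-2 - Z.of_nat j)%Z else (Z.of_nat (S j) * Z.of_nat m + Z.of_nat r)%Z.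

Definition unaddr (p : Z) : option (nat * nat) :=
  if Z.leb p (-2) then Some (0, Z.to_nat (-2 - p))
  else if Z.leb (Z.of_nat m) p && negb (Z.eqb (p mod Z.of_nat m) 0)
  then Some (Z.to_nat (p mod Z.of_nat m), Z.to_nat (p / Z.of_nat m - 1))
  else None.

(** With [rev], offsets count from the bottom of a stack, so a push or a pop changes a single
    cell. *)
Definition lay (s : regs) (p : Z) : sym :=
  match unaddr p with
  | Some (r, j) => nth j (map Some (rev (s r))) None
  | None => if Z.eqb p 0 then Some true else None
  end.

Lemma unaddr_addr r j : r < m -> unaddr (addr r j) = Some (r, j).
Proof.
  intros Hr. unfold unaddr, addr. destruct (Nat.eqb_spec r 0) as [->|H0].
  - rewrite (proj2 (Z.leb_le _ _)) by lia. do 2 f_equal. lia.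
  - assert (Hp : (Z.of_nat m <= Z.of_nat (S j) * Z.of_nat m)%Z) by nia.
    rewrite (proj2 (Z.leb_gt _ _)) by lia.
    assert (E : ((Z.of_nat (S j) * Z.of_nat m + Z.of_nat r) mod Z.of_nat m = Z.of_nat r)%Z).
    { rewrite Z.add_comm, Z.mod_add by lia. apply Z.mod_small; lia. }
    assert (E' : ((Z.of_nat (S j) * Z.of_nat m + Z.of_nat r) / Z.of_nat m = Z.of_nat (S j))%Z).
    { rewrite Z.div_add_l by lia. rewrite Z.div_small by lia. lia. }
    rewrite E, E'. rewrite (proj2 (Z.leb_le _ _)) by lia.
    rewrite (proj2 (Z.eqb_neq _ _)) by lia. cbn [negb andb].
    replace (Z.of_nat (S j) - 1)%Z with (Z.of_nat j) by lia. rewrite !Nat2Z.id. reflexivity.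
Qed.

Lemma unaddr_inv p r j : 0 < m -> unaddr p = Some (r, j) -> p = addr r j.
Proof.
  intros Hm. unfold unaddr, addr. destruct (Z.leb_spec p (-2)).
  - intros E.
    assert (r = 0 /\ j = Z.to_nat (-2 - p)) as [-> ->] by (split; congruence).
    cbn [Nat.eqb]. lia.
  - destruct (Z.leb_spec (Z.of_nat m) p); [|discriminate].
    destruct (Z.eqb_spec (p mod Z.of_nat m) 0); [discriminate|]. cbn [negb andb].
    intros E. assert (r = Z.to_nat (p mod Z.of_nat m) /\ j = Z.to_nat (p / Z.of_nat m - 1))
      as [-> ->] by (split; congruence).
    pose proof (Z.mod_pos_bound p (Z.of_nat m) ltac:(lia)).
    pose proof (Z.div_mod p (Z.of_nat m) ltac:(lia)).
    assert (1 <= p / Z.of_nat m)%Z by (apply Z.div_le_lower_bound; lia).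
    destruct (Nat.eqb_spec (Z.to_nat (p mod Z.of_nat m)) 0); [lia|].
    rewrite Nat2Z.inj_succ, !Z2Nat.id by lia. lia.
Qed.

Lemma addr_left j : addr 0 j = (-2 - Z.of_nat j)%Z.
Proof. reflexivity. Qed.

Lemma addr_right r j : 0 < r -> addr r j = (Z.of_nat (S j) * Z.of_nat m + Z.of_nat r)%Z.
Proof. intros H. unfold addr. rewrite (proj2 (Nat.eqb_neq _ _)) by lia. reflexivity. Qed.

Lemma lay_addr s r j : r < m -> lay s (addr r j) = nth j (map Some (rev (s r))) None.
Proof. intros H. unfold lay. rewrite unaddr_addr; auto. Qed.

Lemma nth_rev_cons (b : bool) w i : nth i (map Some (rev (b :: w))) None =
  if i =? length w then Some b else nth i (map Some (rev w)) None.
Proof.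
  simpl. rewrite map_app. destruct (Nat.eqb_spec i (length w)) as [->|H].
  - rewrite app_nth2; rewrite length_map, length_rev, ?Nat.sub_diag; auto.
  - destruct (Nat.lt_ge_cases i (length w)).
    + rewrite app_nth1; auto. rewrite length_map, length_rev; auto.
    + rewrite !nth_overflow; auto; rewrite ?length_app, length_map, length_rev; simpl; lia.
Qed.

Lemma nth_rev_ge (w : list bool) i : length w <= i -> nth i (map Some (rev w)) None = None.
Proof. intros. apply nth_overflow. rewrite length_map, length_rev. auto. Qed.

Lemma nth_rev_lt (w : list bool) i : i < length w ->
  nth i (map Some (rev w)) None = Some (nth (length w - S i) w false).
Proof.
  intros H. rewrite <- rev_nth by auto. rewrite nth_indep with (d' := Some false).
  - apply map_nth.
  - rewrite length_map, length_rev; auto.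
Qed.

Lemma lay_push s r b : r < m ->
  tupd (lay s) (addr r (length (s r))) (Some b) = lay (upd s r (b :: s r)).
Proof.
  intros Hr. extensionality p. unfold tupd. destruct (Z.eqb_spec p (addr r (length (s r)))) as [->|Hp].
  - rewrite lay_addr by auto. rewrite upd_eq, nth_rev_cons, Nat.eqb_refl. reflexivity.
  - unfold lay. destruct (unaddr p) as [[r' j]|] eqn:E; auto. apply unaddr_inv in E; [|lia].
    subst p. unfold upd. destruct (Nat.eqb_spec r' r) as [->|]; auto.
    rewrite nth_rev_cons. destruct (Nat.eqb_spec j (length (s r))); subst; tauto.
Qed.

Lemma lay_pop s r b w : r < m -> s r = b :: w ->
  tupd (lay s) (addr r (length w)) None = lay (upd s r w).
Proof.
  intros Hr Hs. extensionality p. unfold tupd. destruct (Z.eqb_spec p (addr r (length w))) as [->|Hp].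
  - rewrite lay_addr by auto. rewrite upd_eq, nth_rev_ge; auto.
  - unfold lay. destruct (unaddr p) as [[r' j]|] eqn:E; auto. apply unaddr_inv in E; [|lia].
    subst p. unfold upd. destruct (Nat.eqb_spec r' r) as [->|]; auto.
    rewrite Hs, nth_rev_cons. destruct (Nat.eqb_spec j (length w)); subst; tauto.
Qed.

Lemma lay_home s : 0 < m -> lay s 0 = Some true.
Proof.
  intros. unfold lay, unaddr. simpl. rewrite (proj2 (Z.leb_gt _ _)) by lia. reflexivity.
Qed.

Lemma lay_m1 s : lay s (-1) = None.
Proof.
  unfold lay, unaddr. simpl. rewrite (proj2 (Z.leb_gt _ _)) by lia. reflexivity.
Qed.

Lemma lay_block0 s r : 0 < r -> r < m -> lay s (Z.of_nat r) = None.
Proof.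
  intros. unfold lay, unaddr. rewrite (proj2 (Z.leb_gt _ _)) by lia.
  rewrite (proj2 (Z.leb_gt _ _)) by lia. simpl. rewrite (proj2 (Z.eqb_neq _ _)) by lia. reflexivity.
Qed.

Lemma lay_track0 s j : 0 < m -> lay s (Z.of_nat (S j) * Z.of_nat m) = None.
Proof.
  intros. assert (0 < Z.of_nat (S j) * Z.of_nat m)%Z by nia.
  unfold lay, unaddr. rewrite (proj2 (Z.leb_gt _ _)) by lia.
  rewrite Z.mod_mul by lia. rewrite Z.eqb_refl, andb_false_r.
  rewrite (proj2 (Z.eqb_neq _ _)) by lia. reflexivity.
Qed.

(** * Walks of the head *)

Ltac one_step := apply ts_step; cbn [tstep tdelta].

Lemma scan_move pc tp i : forall p, tsteps i (Scan pc i, p, tp) (Scan pc 0, (p + Z.of_nat i)%Z, tp).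
Proof.
  induction i as [|i IH]; intros p.
  - rewrite Z.add_0_r. constructor.
  - one_step. rewrite tupd_same. replace (p + Z.of_nat (S i))%Z with (p + dirz DR + Z.of_nat i)%Z
      by (cbn [dirz]; lia). apply IH.
Qed.

Lemma back_move pc tp i : forall p, tsteps i (Back pc i, p, tp) (Back pc 0, (p - Z.of_nat i)%Z, tp).
Proof.
  induction i as [|i IH]; intros p.
  - rewrite Z.sub_0_r. constructor.
  - one_step. rewrite tupd_same. replace (p - Z.of_nat (S i))%Z with (p + dirz DL - Z.of_nat i)%Z
      by (cbn [dirz]; lia). apply IH.
Qed.

Lemma ret_move pc tp i : forall p, tsteps i (Ret pc i, p, tp) (Ret pc 0, (p - Z.of_nat i)%Z, tp).
Proof.
  induction i as [|i IH]; intros p.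
  - rewrite Z.sub_0_r. constructor.
  - one_step. rewrite tupd_same. replace (p - Z.of_nat (S i))%Z with (p + dirz DL - Z.of_nat i)%Z
      by (cbn [dirz]; lia). apply IH.
Qed.

Lemma scan_find pc s r d : 0 < r -> r < m -> forall j, j + d = length (s r) ->
  tsteps (d * m) (Scan pc 0, addr r j, lay s) (Scan pc 0, addr r (length (s r)), lay s).
Proof.
  intros H0 Hr. induction d as [|d IH]; intros j Hj.
  - rewrite Nat.add_0_r in Hj. subst. constructor.
  - replace (S d * m) with (S (m - 1 + d * m)) by (cbn [dirz]; lia). one_step.
    rewrite lay_addr, nth_rev_lt by lia. cbn iota beta.
    rewrite tupd_same' by (rewrite lay_addr, nth_rev_lt by lia; reflexivity).
    eapply tsteps_trans; [apply scan_move|].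
    replace (addr r j + dirz DR + Z.of_nat (m - 1))%Z with (addr r (S j)).
    + apply IH. lia.
    + rewrite !addr_right by lia. cbn [dirz]. nia.
Qed.

Lemma ret_home k s j : 0 < m ->
  tsteps (S (j * m)) (Ret k 0, (Z.of_nat j * Z.of_nat m)%Z, lay s) (Entry k, 0%Z, lay s).
Proof.
  intros Hm. induction j as [|j IH].
  - one_step. simpl Z.mul. rewrite lay_home by auto. cbn. rewrite tupd_same' by (apply lay_home; auto).
    constructor.
  - replace (S (S j * m)) with (S (m - 1 + S (j * m))) by (cbn [dirz]; lia). one_step.
    rewrite lay_track0 by auto. cbn iota beta. rewrite tupd_same' by (apply lay_track0; auto).
    eapply tsteps_trans; [apply ret_move|].
    replace (Z.of_nat (S j) * Z.of_nat m + dirz DL - Z.of_nat (m - 1))%Z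
      with (Z.of_nat j * Z.of_nat m)%Z by (cbn [dirz]; nia). exact IH.
Qed.

Lemma ret_from k s r j : 0 < m ->
  tsteps (r + S (j * m)) (Ret k r, (Z.of_nat j * Z.of_nat m + Z.of_nat r)%Z, lay s)
         (Entry k, 0%Z, lay s).
Proof.
  intros Hm. eapply tsteps_trans; [apply ret_move|].
  replace (Z.of_nat j * Z.of_nat m + Z.of_nat r - Z.of_nat r)%Z with (Z.of_nat j * Z.of_nat m)%Z by lia.
  apply ret_home; auto.
Qed.

Lemma lscan_find pc s d : 0 < m -> forall j, j + d = length (s 0) ->
  tsteps d (LScan pc, addr 0 j, lay s) (LScan pc, addr 0 (length (s 0)), lay s).
Proof.
  intros Hm. induction d as [|d IH]; intros j Hj.
  - rewrite Nat.add_0_r in Hj. subst. constructor.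
  - one_step. rewrite lay_addr, nth_rev_lt by lia. cbn iota beta.
    rewrite tupd_same' by (rewrite lay_addr, nth_rev_lt by lia; reflexivity).
    replace (addr 0 j + dirz DL)%Z with (addr 0 (S j)) by (rewrite ?addr_left; cbn [dirz length]; lia).
    apply IH. lia.
Qed.

Lemma lret_home k s : 0 < m -> forall j, j <= length (s 0) ->
  tsteps (S j) (LRet k, (-1 - Z.of_nat j)%Z, lay s) (Entry k, 0%Z, lay s).
Proof.
  intros Hm. induction j as [|j IH]; intros Hj.
  - one_step. simpl Z.sub. rewrite lay_m1. cbn. rewrite tupd_same' by apply lay_m1. constructor.
  - replace (-1 - Z.of_nat (S j))%Z with (addr 0 j) by (rewrite ?addr_left; cbn [dirz length]; lia).
    one_step. rewrite lay_addr, nth_rev_lt by lia. cbn iota beta.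
    rewrite tupd_same' by (rewrite lay_addr, nth_rev_lt by lia; reflexivity).
    replace (addr 0 j + dirz DR)%Z with (-1 - Z.of_nat j)%Z by (rewrite ?addr_left; cbn [dirz length]; lia).
    apply IH. lia.
Qed.

(** A generous bound for one instruction on stacks of at most [B] symbols: a walk out and back,
    through blocks of width [m] on the right or along register 0 on the left. *)
Definition icost (B : nat) : nat := 2 * m * (B + 5) + 2 * B + 10.

Lemma entry_left pc s : 0 < m -> (forall k, fetch pc <> INop k) -> instr_reg (fetch pc) = 0 ->
  tsteps (2 + length (s 0)) (Entry pc, 0%Z, lay s) (LScan pc, addr 0 (length (s 0)), lay s).
Proof.
  intros Hm Hn Hr. simpl Nat.add.
  assert (E : tstep (Entry pc, 0%Z, lay s) = (L1 pc, (-1)%Z, lay s)).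
  { cbn [tstep tdelta]. destruct (fetch pc); try (exfalso; eapply Hn; reflexivity);
      simpl in Hr; subst; simpl; rewrite tupd_same; reflexivity. }
  apply ts_step. rewrite E. one_step. rewrite tupd_same.
  replace (-1 + dirz DL)%Z with (addr 0 0) by (rewrite ?addr_left; cbn [dirz length]; lia).
  apply lscan_find; auto.
Qed.

Lemma entry_right pc s r : 0 < m -> 0 < r -> r < m -> (forall k, fetch pc <> INop k) ->
  instr_reg (fetch pc) = r ->
  tsteps (r + m + length (s r) * m) (Entry pc, 0%Z, lay s) (Scan pc 0, addr r (length (s r)), lay s).
Proof.
  intros Hm H0 Hrm Hn Hr. destruct r as [|r]; [lia|].
  assert (E : tstep (Entry pc, 0%Z, lay s) = (Scan pc (r + m), 1%Z, lay s)).
  { cbn [tstep tdelta]. destruct (fetch pc); try (exfalso; eapply Hn; reflexivity);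
      simpl in Hr; try lia; subst; simpl; rewrite tupd_same; reflexivity. }
  apply ts_step. rewrite E. eapply tsteps_trans; [apply scan_move|].
  replace (1 + Z.of_nat (r + m))%Z with (addr (S r) 0) by (rewrite addr_right by lia; lia).
  apply scan_find; auto.
Qed.

Lemma step_push pc s r b k B : r < m -> fetch pc = IPush r b k -> length (s r) <= B ->
  exists N, N <= icost B /\
    tsteps N (Entry pc, 0%Z, lay s) (Entry k, 0%Z, lay (upd s r (b :: s r))).
Proof.
  intros Hr Hf HB. destruct (Nat.eq_dec r 0) as [->|H0].
  - exists (2 + length (s 0) + S (S (length (s 0)))). split; [unfold icost; lia|].
    eapply tsteps_trans; [apply entry_left; [lia|congruence|rewrite Hf; reflexivity]|].
    one_step. rewrite lay_addr, nth_rev_ge by lia. rewrite Hf. cbn iota beta.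
    rewrite lay_push by auto.
    replace (addr 0 (length (s 0%nat)) + dirz DR)%Z with (-1 - Z.of_nat (length (s 0%nat)))%Z
      by (rewrite ?addr_left; cbn [dirz length]; lia).
    apply lret_home; [lia|]. rewrite upd_eq; simpl; lia.
  - exists (r + m + length (s r) * m + S (r + S (S (length (s r)) * m))). split; [unfold icost; nia|].
    eapply tsteps_trans; [apply entry_right; [lia|lia|lia|congruence|rewrite Hf; reflexivity]|].
    one_step. rewrite lay_addr, nth_rev_ge by lia. rewrite Hf. cbn iota beta.
    rewrite lay_push by auto. cbn [dirz]. rewrite Z.add_0_r.
    rewrite !addr_right by lia. apply ret_from. lia.
Qed.

Lemma step_pop_empty pc s r ke k0 k1 B : r < m -> fetch pc = IPop r ke k0 k1 -> s r = [] ->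
  exists N, N <= icost B /\ tsteps N (Entry pc, 0%Z, lay s) (Entry ke, 0%Z, lay s).
Proof.
  intros Hr Hf Hs. destruct (Nat.eq_dec r 0) as [->|H0].
  - exists (2 + length (s 0) + 2). split; [rewrite Hs; unfold icost; simpl; lia|].
    eapply tsteps_trans; [apply entry_left; [lia|congruence|rewrite Hf; reflexivity]|].
    rewrite Hs. one_step. rewrite lay_addr, nth_rev_ge by (rewrite ?Hs; simpl; lia).
    rewrite Hf. cbn iota beta.
    rewrite tupd_same' by (rewrite lay_addr, nth_rev_ge by (rewrite ?Hs; simpl; lia); reflexivity).
    one_step. replace (addr 0 (length (@nil bool)) + dirz DR)%Z with (-1)%Z by (rewrite ?addr_left; cbn [dirz length]; lia).
    rewrite lay_m1, Hf. cbn. rewrite tupd_same' by apply lay_m1. constructor.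
  - exists (r + m + length (s r) * m + S (m - 1 + S (r + S (0 * m)))). split.
    { rewrite Hs; unfold icost; simpl; nia. }
    eapply tsteps_trans; [apply entry_right; [lia|lia|lia|congruence|rewrite Hf; reflexivity]|].
    one_step. rewrite lay_addr, nth_rev_ge by lia. rewrite Hf. cbn iota beta.
    rewrite tupd_same' by (rewrite lay_addr, nth_rev_ge by (rewrite ?Hs; simpl; lia); reflexivity).
    eapply tsteps_trans; [apply back_move|].
    replace (addr r (length (s r)) + dirz DL - Z.of_nat (m - 1))%Z with (Z.of_nat r).
    2:{ rewrite Hs. rewrite !addr_right by lia. cbn [length]. cbn [dirz]. nia. }
    one_step. rewrite Hf, lay_block0 by lia. cbn [pop_next instr_reg].
    rewrite tupd_same' by (apply lay_block0; lia).
    cbn [dirz]. rewrite Z.add_0_r. apply (ret_from ke s r 0). lia.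
Qed.

Lemma step_pop pc s r ke k0 k1 b w B : r < m -> fetch pc = IPop r ke k0 k1 -> s r = b :: w ->
  length (s r) <= B ->
  exists N, N <= icost B /\
    tsteps N (Entry pc, 0%Z, lay s) (Entry (if b then k1 else k0), 0%Z, lay (upd s r w)).
Proof.
  intros Hr Hf Hs HB.
  assert (Ht : nth (length w) (map Some (rev (s r))) None = Some b).
  { rewrite Hs, nth_rev_cons, Nat.eqb_refl. reflexivity. }
  assert (Hnx : pop_next (fetch pc) (Some b) = if b then k1 else k0).
  { rewrite Hf. destruct b; reflexivity. }
  assert (Hl : length (s r) = S (length w)) by (rewrite Hs; reflexivity).
  destruct (Nat.eq_dec r 0) as [->|H0].
  - exists (2 + length (s 0) + S (S (S (length w)))). split; [unfold icost; lia|].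
    eapply tsteps_trans; [apply entry_left; [lia|congruence|rewrite Hf; reflexivity]|].
    one_step. rewrite lay_addr, nth_rev_ge by lia. rewrite Hf. cbn iota beta.
    rewrite tupd_same' by (rewrite lay_addr, nth_rev_ge by lia; reflexivity).
    replace (addr 0 (length (s 0%nat)) + dirz DR)%Z with (addr 0 (length w))
      by (rewrite Hl, !addr_left; cbn [dirz]; lia).
    one_step. rewrite lay_addr, Ht, Hnx by lia. cbn iota beta.
    rewrite (lay_pop s 0 b w) by auto.
    replace (addr 0 (length w) + dirz DR)%Z with (-1 - Z.of_nat (length w))%Z
      by (rewrite ?addr_left; cbn [dirz length]; lia).
    apply lret_home; [lia|]. rewrite upd_eq; lia.
  - exists (r + m + length (s r) * m + S (m - 1 + S (r + S (S (length w) * m)))). split.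
    { unfold icost; nia. }
    eapply tsteps_trans; [apply entry_right; [lia|lia|lia|congruence|rewrite Hf; reflexivity]|].
    one_step. rewrite lay_addr, nth_rev_ge by lia. rewrite Hf. cbn iota beta.
    rewrite tupd_same' by (rewrite lay_addr, nth_rev_ge by lia; reflexivity).
    eapply tsteps_trans; [apply back_move|].
    replace (addr r (length (s r)) + dirz DL - Z.of_nat (m - 1))%Z with (addr r (length w)).
    2:{ rewrite Hl. rewrite !addr_right by lia. cbn [dirz]. nia. }
    one_step. rewrite lay_addr, Ht, Hnx by lia. cbn iota beta.
    rewrite (lay_pop s r b w) by auto. rewrite Hf. cbn [instr_reg dirz]. rewrite Z.add_0_r.
    rewrite !addr_right by lia. apply ret_from. lia.
Qed.

Definition code_at (a : nat) (l : list instr) : Prop :=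
  forall i, i < length l -> fetch (a + i) = nth i l IHalt.

Lemma code_at_app a l1 l2 : code_at a (l1 ++ l2) -> code_at a l1 /\ code_at (a + length l1) l2.
Proof.
  intros H. split; intros i Hi.
  - rewrite H by (rewrite length_app; lia). apply app_nth1; auto.
  - rewrite <- Nat.add_assoc, H by (rewrite length_app; lia).
    rewrite app_nth2 by lia. f_equal; lia.
Qed.

Lemma code_at_cons a i l : code_at a (i :: l) -> fetch a = i /\ code_at (S a) l.
Proof.
  intros H. split.
  - specialize (H 0). rewrite Nat.add_0_r in H. apply H. simpl; lia.
  - intros j Hj. specialize (H (S j)). rewrite Nat.add_succ_r in H. apply H. simpl; lia.
Qed.

(** Stacks grow by at most the cost spent so far, so one [B] serves the whole run and every unit of
    cost takes at most [icost B] steps. *)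
Lemma comp_correct c s s' n : exec c s s' n -> forall a k B,
  cmd_regs m c -> code_at a (comp c a k) -> (forall r, r < m -> length (s r) + n <= B) -> 0 < m ->
  exists N, N <= n * icost B /\ tsteps N (Entry a, 0%Z, lay s) (Entry k, 0%Z, lay s').
Proof.
  induction 1 as [s|r b s|c1 c2 s1 s2 s3 n1 n2 E1 IH1 E2 IH2|r c0 c1 s Hs
                 |r c0 c1 s1 s2 s3 b w n1 n2 Hs E1 IH1 E2 IH2]; intros a k B Hr Hc HB Hm;
    cbn [comp cmd_regs] in *.
  - apply code_at_cons in Hc. destruct Hc as [Hf _]. exists 1. split; [unfold icost; lia|].
    one_step. rewrite Hf. rewrite tupd_same. constructor.
  - apply code_at_cons in Hc. destruct Hc as [Hf _].
    destruct (step_push a s r b k B Hr Hf) as (N & HN & Hst).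
    { specialize (HB r Hr). lia. }
    exists N. split; [lia|exact Hst].
  - apply code_at_app in Hc. destruct Hc as [Hc1 Hc2]. rewrite comp_length in Hc2.
    destruct (IH1 _ _ B ltac:(tauto) Hc1) as (N1 & HN1 & St1); auto.
    { intros r Hrm. specialize (HB r Hrm). lia. }
    destruct (IH2 _ _ B ltac:(tauto) Hc2) as (N2 & HN2 & St2); auto.
    { intros r Hrm. specialize (HB r Hrm). pose proof (exec_size _ _ _ _ E1 r). lia. }
    exists (N1 + N2). split; [rewrite Nat.mul_add_distr_r; lia|]. eapply tsteps_trans; eauto.
  - apply code_at_cons in Hc. destruct Hc as [Hf _].
    destruct (step_pop_empty a s r _ _ _ B ltac:(tauto) Hf Hs) as (N & HN & Hst).
    exists N. split; [lia|exact Hst].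
  - pose proof Hc as Hc'. apply code_at_cons in Hc. destruct Hc as [Hf Hc].
    apply code_at_app in Hc. destruct Hc as [Hc0 Hc1]. rewrite comp_length in Hc1.
    destruct Hr as (Hrm & Hr0 & Hr1).
    destruct (step_pop a s1 r _ _ _ b w B Hrm Hf Hs) as (N0 & HN0 & St0).
    { specialize (HB r Hrm). lia. }
    destruct (IH1 (if b then S a + clen c0 else S a) a B) as (N1 & HN1 & St1); auto.
    { destruct b; auto. }
    { destruct b; auto. }
    { intros r' Hr'. specialize (HB r' Hr'). unfold upd. destruct (Nat.eqb_spec r' r); [|lia].
      subst. rewrite Hs in HB. simpl in HB. lia. }
    destruct (IH2 a k B) as (N2 & HN2 & St2); simpl; auto.
    { intros r' Hr'. specialize (HB r' Hr'). pose proof (exec_size _ _ _ _ E1 r') as Hsz.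
      unfold upd in Hsz. destruct (Nat.eqb_spec r' r); [|lia].
      subst. rewrite Hs in HB. simpl in HB. lia. }
    exists (N0 + (N1 + N2)). split; [simpl; rewrite Nat.mul_add_distr_r; lia|].
    eapply tsteps_trans; [exact St0|]. eapply tsteps_trans; [|exact St2].
    destruct b; exact St1.
Qed.

Definition start_regs (x : list bool) : regs := fun r => if r =? 0 then x else [].

(** The input already lies where register 0 belongs, its first bit outermost, that is on top; the
    machine only has to walk right and mark the home cell. *)
Definition input_tape (x : list bool) : Z -> sym :=
  fun p => if Z.leb (- Z.of_nat (length x) - 1) p
           then nth (Z.to_nat (p - (- Z.of_nat (length x) - 1))) (map Some x) None else None.

Lemma init_move x d : d <= length x ->
  tsteps d (Init0, (-1 - Z.of_nat d)%Z, input_tape x) (Init0, (-1)%Z, input_tape x).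
Proof.
  induction d as [|d IH]; intros Hd; [constructor|].
  assert (Ht : exists b, input_tape x (-1 - Z.of_nat (S d)) = Some b).
  { unfold input_tape. rewrite (proj2 (Z.leb_le _ _)) by lia.
    exists (nth (length x - S d) x false).
    replace (Z.to_nat _) with (length x - S d) by lia.
    rewrite nth_indep with (d' := Some false) by (rewrite length_map; lia). apply map_nth. }
  destruct Ht as [b Hb]. one_step. rewrite Hb. cbn iota beta. rewrite tupd_same' by auto.
  replace (-1 - Z.of_nat (S d) + dirz DR)%Z with (-1 - Z.of_nat d)%Z by (cbn [dirz]; lia).
  apply IH. lia.
Qed.

Lemma init_steps x : 0 < m ->
  tsteps (length x + 2) (Init0, (- Z.of_nat (length x) - 1)%Z, input_tape x)
         (Entry 0, 0%Z, lay (start_regs x)).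
Proof.
  intros Hm. eapply tsteps_trans.
  { replace (- Z.of_nat (length x) - 1)%Z with (-1 - Z.of_nat (length x))%Z by lia.
    apply init_move; auto. }
  assert (Ht : input_tape x (-1) = None).
  { unfold input_tape. destruct (Z.leb_spec (- Z.of_nat (length x) - 1) (-1)); auto.
    apply nth_overflow. rewrite length_map. lia. }
  one_step. rewrite Ht. cbn iota beta. rewrite tupd_same' by auto. one_step. simpl.
  replace (tupd (input_tape x) 0 (Some true)) with (lay (start_regs x)); [constructor|].
  extensionality p. unfold tupd.
  destruct (Z.eqb_spec p 0) as [->|H0]; [apply lay_home; auto|].
  unfold lay. destruct (unaddr p) as [[r j]|] eqn:E.
  - apply unaddr_inv in E; auto. subst p. unfold start_regs, addr, input_tape.
    destruct (Nat.eqb_spec r 0) as [->|Hr].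
    + destruct (Nat.lt_ge_cases j (length x)).
      * rewrite nth_rev_lt by auto. rewrite (proj2 (Z.leb_le _ _)) by lia.
        replace (Z.to_nat _) with (length x - S j) by lia.
        symmetry. rewrite nth_indep with (d' := Some false) by (rewrite length_map; lia).
        apply map_nth.
      * rewrite nth_rev_ge by auto. rewrite (proj2 (Z.leb_gt _ _)) by lia. reflexivity.
    + simpl rev. simpl map. rewrite nth_overflow by (simpl; lia).
      destruct (Z.leb_spec (- Z.of_nat (length x) - 1) (Z.of_nat (S j) * Z.of_nat m + Z.of_nat r)); auto.
      symmetry. apply nth_overflow. rewrite length_map. lia.
  - rewrite (proj2 (Z.eqb_neq _ _)) by auto. unfold input_tape.
    destruct (Z.leb_spec (- Z.of_nat (length x) - 1) p) as [Hp|]; auto.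
    symmetry. apply nth_overflow. rewrite length_map.
    unfold unaddr in E. destruct (Z.leb_spec p (-2)); [discriminate|lia].
Qed.

(** The head stops on the top of register 0, so reading rightwards up to the blank at -1 yields
    exactly the stack as output. *)
Lemma halt_steps pc s : 0 < m -> fetch pc = IHalt ->
  tsteps (3 + length (s 0)) (Entry pc, 0%Z, lay s) (Done, (-1 - Z.of_nat (length (s 0%nat)))%Z, lay s).
Proof.
  intros Hm Hf. replace (3 + length (s 0)) with (2 + length (s 0) + 1) by lia.
  eapply tsteps_trans; [apply entry_left; [lia|congruence|rewrite Hf; reflexivity]|].
  one_step. rewrite lay_addr, nth_rev_ge by lia. rewrite Hf. cbn iota beta.
  rewrite tupd_same' by (rewrite lay_addr, nth_rev_ge by lia; reflexivity).
  replace (addr 0 (length (s 0%nat)) + dirz DR)%Z with (-1 - Z.of_nat (length (s 0%nat)))%Z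
    by (rewrite ?addr_left; cbn [dirz length]; lia).
  constructor.
Qed.

(** Mixed radix: 11 kinds of states, offsets below [2 * m] (the largest are set by [Entry] on its
    way to a register), then the address. *)
Definition ts_enc (st : ts) : nat :=
  let e kind pc i := (pc * (2 * m) + i) * 11 + kind in
  match st with
  | Init0 => e 0 0 0
  | Init1 => e 1 0 0
  | Entry pc => e 2 pc 0
  | Scan pc i => e 3 pc i
  | Back pc i => e 4 pc i
  | Ret k i => e 5 k i
  | L1 pc => e 6 pc 0
  | LScan pc => e 7 pc 0
  | LPop pc => e 8 pc 0
  | LRet k => e 9 k 0
  | Done => e 10 0 0
  end.

Definition ts_dec (q : nat) : ts :=
  let pc := q / 11 / (2 * m) in let i := (q / 11) mod (2 * m) in
  match q mod 11 with
  | 0 => Init0 | 1 => Init1 | 2 => Entry pc | 3 => Scan pc i | 4 => Back pc i | 5 => Ret pc i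
  | 6 => L1 pc | 7 => LScan pc | 8 => LPop pc | 9 => LRet pc | _ => Done
  end.

Definition ts_ok (st : ts) : Prop :=
  match st with
  | Init0 | Init1 | Done => True
  | Entry pc | L1 pc | LScan pc | LPop pc | LRet pc => pc <= length code
  | Scan pc i | Back pc i | Ret pc i => pc <= length code /\ i < 2 * m
  end.

Lemma enc_arith kind pc i : kind < 11 -> i < 2 * m ->
  let q := (pc * (2 * m) + i) * 11 + kind in
  q mod 11 = kind /\ (q / 11) mod (2 * m) = i /\ q / 11 / (2 * m) = pc.
Proof.
  intros Hk Hi q.
  assert (E : q / 11 = pc * (2 * m) + i).
  { unfold q. rewrite Nat.div_add_l by lia. rewrite Nat.div_small by auto. lia. }
  rewrite E. repeat split.
  - unfold q. rewrite Nat.add_comm, Nat.Div0.mod_add. apply Nat.mod_small; auto.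
  - rewrite Nat.add_comm, Nat.Div0.mod_add. apply Nat.mod_small; auto.
  - rewrite Nat.div_add_l by lia. rewrite Nat.div_small by auto. lia.
Qed.

Lemma ts_dec_enc st : 0 < m -> ts_ok st -> ts_dec (ts_enc st) = st.
Proof.
  intros Hm Hok. unfold ts_dec, ts_enc.
  destruct st; cbn [ts_ok] in Hok;
    match goal with |- context [?q mod 11] =>
      match q with (?pc * _ + ?i) * 11 + ?kd =>
        destruct (enc_arith kd pc i ltac:(lia) ltac:(lia)) as (E1 & E2 & E3); rewrite E1, ?E2, ?E3 end end;
    reflexivity.
Qed.

Definition tm_size : nat := (S (length code) * (2 * m)) * 11 + 11.

Lemma ts_enc_lt st : 0 < m -> ts_ok st -> ts_enc st < tm_size.
Proof.
  intros Hm Hok. unfold tm_size, ts_enc. destruct st; cbn [ts_ok] in Hok; nia.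
Qed.

(** [delta_ok] ranges over all numbers below [nst], also those that encode no legal state; targets
    out of range are sent to 0. *)
Definition mdelta (q : nat) (s : sym) : nat * sym * dir :=
  let '(st, w, d) := tdelta (ts_dec q) s in
  (if ts_enc st <? tm_size then ts_enc st else 0, w, d).

Lemma mdelta_ok q s : q < tm_size -> fst (fst (mdelta q s)) < tm_size.
Proof.
  intros _. unfold mdelta. destruct (tdelta (ts_dec q) s) as [[st w] d]. simpl.
  destruct (Nat.ltb_spec (ts_enc st) tm_size); auto. unfold tm_size; lia.
Qed.

Definition mhalting (q : nat) : bool := match ts_dec q with Done => true | _ => false end.

Lemma init0_lt : ts_enc Init0 < tm_size.
Proof. unfold ts_enc, tm_size. lia. Qed.

Definition machine : TM :=
  mkTM tm_size (ts_enc Init0) mdelta mhalting (fun _ => true) init0_lt mdelta_ok.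

Lemma fetch_ok pc : Forall (instr_ok m (length code)) code -> instr_ok m (length code) (fetch pc).
Proof.
  intros H. unfold fetch. destruct (Nat.lt_ge_cases pc (length code)).
  - rewrite Forall_forall in H. apply H, nth_In; auto.
  - rewrite nth_overflow by auto. exact I.
Qed.

Lemma pop_next_ok i s : instr_ok m (length code) i -> pop_next i s <= length code.
Proof. destruct i; simpl; try lia; destruct s as [[|]|]; simpl; lia. Qed.

Lemma tdelta_ok st s : 0 < m -> Forall (instr_ok m (length code)) code -> ts_ok st ->
  ts_ok (fst (fst (tdelta st s))).
Proof.
  intros Hm Hc Hok.
  destruct st as [| |pc|pc i|pc i|k i|pc|pc|pc|k|]; cbn [ts_ok] in Hok; cbn [tdelta];
    try (pose proof (fetch_ok pc Hc) as Hf; pose proof (pop_next_ok _ s Hf) as Hp).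
  - destruct s; exact I.
  - simpl. lia.
  - destruct (fetch pc) as [k|r b k|r ke k0 k1|]; simpl in Hf; simpl; try lia;
      destruct r; simpl; lia.
  - destruct i; simpl; [|lia]. destruct s; simpl; [lia|].
    destruct (fetch pc); simpl in *; lia.
  - destruct i; simpl; [|lia]. destruct (fetch pc); simpl in *; lia.
  - destruct i; simpl; [|lia]. destruct s; simpl; lia.
  - simpl; lia.
  - destruct s; simpl; [lia|]. destruct (fetch pc); simpl in *; lia.
  - destruct s; simpl; lia.
  - destruct s; simpl; lia.
  - exact I.
Qed.

Lemma machine_run N c c' : tsteps N c c' -> 0 < m -> Forall (instr_ok m (length code)) code ->
  ts_ok (fst (fst c)) -> ts_ok (fst (fst c')) /\
  arun (delta machine) (halting machine) N (mkA (ts_enc (fst (fst c))) (snd (fst c)) (snd c))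
  = mkA (ts_enc (fst (fst c'))) (snd (fst c')) (snd c').
Proof.
  intros H Hm Hc. induction H as [c|n c c' H IH]; intros Hok; [split; auto|].
  destruct c as [[st p] tp]. cbn [fst snd] in *. cbn [arun].
  pose proof (tdelta_ok st (tp p) Hm Hc Hok) as Hok'. cbn [tstep] in IH.
  assert (E : astep (delta machine) (halting machine) (mkA (ts_enc st) p tp) =
              let '(st', p', tp') := tstep (st, p, tp) in mkA (ts_enc st') p' tp').
  { unfold astep, machine; cbn [halting delta aq apos atp]. unfold mhalting, mdelta.
    rewrite ts_dec_enc by auto.
    (* [tdelta] changes nothing in [Done], so stopping there and stepping there agree. *)
    assert (Ed : (if match st with Done => true | _ => false end then mkA (ts_enc st) p tp
        else let '(q, w, d) := (let '(st', w, d) := tdelta st (tp p) in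
               (if ts_enc st' <? tm_size then ts_enc st' else 0, w, d)) in
             mkA q (p + dirz d) (tupd tp p w)) =
       (let '(q, w, d) := (let '(st', w, d) := tdelta st (tp p) in
               (if ts_enc st' <? tm_size then ts_enc st' else 0, w, d)) in
             mkA q (p + dirz d) (tupd tp p w))).
    { destruct st; auto. cbn [tdelta].
      rewrite (proj2 (Nat.ltb_lt _ _)) by (apply ts_enc_lt; auto).
      rewrite tupd_same. cbn [dirz]. rewrite Z.add_0_r. reflexivity. }
    rewrite Ed. cbn [tstep]. destruct (tdelta st (tp p)) as [[st' w] d]. cbn [fst] in Hok'.
    rewrite (proj2 (Nat.ltb_lt _ _)) by (apply ts_enc_lt; auto). reflexivity. }
  rewrite E. cbn [tstep]. destruct (tdelta st (tp p)) as [[st' w] d]. cbn [fst snd] in *.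
  apply IH; auto.
Qed.

End Machine.

Theorem cmd_machine (m : nat) (c : cmd) : 0 < m -> cmd_regs m c -> exists M : TM,
  forall x s' n, exec c (start_regs x) s' n ->
  exists t, t <= length x + 2 + n * icost m (length x + n) + (3 + (length x + n)) /\
    halting M (cst (run M t (init M x))) = true /\ output (run M t (init M x)) = s' 0.
Proof.
  intros Hm Hr. set (code := comp c 0 (clen c)). exists (machine m code).
  assert (Hlen : length code = clen c) by apply comp_length.
  assert (Hok : Forall (instr_ok m (length code)) code).
  { rewrite Hlen. apply comp_ok; auto. }
  intros x s' n He.
  destruct (comp_correct m code c _ _ _ He 0 (clen c) (length x + n) Hr) as (N & HN & Hst); auto.
  { intros i Hi. reflexivity. }
  { intros r _. unfold start_regs. destruct (r =? 0); simpl; lia. }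
  pose proof (exec_size _ _ _ _ He 0) as Hsz. change (start_regs x 0) with x in Hsz.
  pose proof (tsteps_trans _ _ _ _ _ _ _ (init_steps m code x Hm)
    (tsteps_trans _ _ _ _ _ _ _ Hst (halt_steps m code (clen c) s' Hm
       ltac:(unfold fetch; apply nth_overflow; lia)))) as Hall.
  set (t := length x + 2 + (N + (3 + length (s' 0)))) in *.
  apply machine_run in Hall; auto. 2:exact I. destruct Hall as [_ Hall]. cbn [fst snd] in Hall.
  set (a0 := mkA (ts_enc m Init0) (- Z.of_nat (length x) - 1) (input_tape x)) in Hall.
  assert (R0 : rep (init (machine m code) x) a0).
  { apply rep_init; [reflexivity|]. intros p. reflexivity. }
  apply (rep_run (machine m code) t) in R0. rewrite Hall in R0.
  exists t. split; [unfold t; lia|]. split.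
  - destruct R0 as [E _]. rewrite E. cbn [aq machine halting]. unfold mhalting.
    rewrite (ts_dec_enc m code) by (simpl; auto). reflexivity.
  - eapply rep_output; [exact R0|..]; cbn [apos atp].
    + intros i Hi. replace (-1 - Z.of_nat (length (s' 0%nat)) + Z.of_nat i)%Z
        with (addr m 0 (length (s' 0) - S i)) by (rewrite ?addr_left; cbn [dirz length]; lia).
      rewrite lay_addr, nth_rev_lt by lia. do 2 f_equal. lia.
    + replace (-1 - Z.of_nat (length (s' 0%nat)) + Z.of_nat (length (s' 0%nat)))%Z with (-1)%Z by lia.
      apply lay_m1.
Qed.

(** * Loop programs over unary counters *)

Definition polyb (f : nat -> nat) : Prop := exists c k, forall n, f n <= poly c k n.

(** Bounds of the form [c * S n ^ k], equivalent up to constants, are easier to add, multiply and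
    compose because [S n ^ k] is positive and monotone in [k]. *)
Lemma poly_le_pow c k n : poly c k n <= 2 * c * S n ^ k.
Proof.
  unfold poly. pose proof (Nat.pow_le_mono_l n (S n) k ltac:(lia)).
  assert (1 <= S n ^ k) by (apply Nat.neq_0_lt_0, Nat.pow_nonzero; lia). nia.
Qed.

Lemma pow_S_le n k : S n ^ k <= 2 ^ k * n ^ k + 2 ^ k.
Proof.
  assert (1 <= 2 ^ k) by (apply Nat.neq_0_lt_0, Nat.pow_nonzero; lia).
  destruct n as [|n]; [rewrite Nat.pow_1_l; lia|].
  rewrite <- Nat.pow_mul_l. transitivity ((2 * S n) ^ k); [|lia].
  apply Nat.pow_le_mono_l. lia.
Qed.

Lemma polyb_pow c k f : (forall n, f n <= c * S n ^ k) -> polyb f.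
Proof.
  intros H. exists (c * 2 ^ k), k. intros n. unfold poly.
  specialize (H n). pose proof (pow_S_le n k). nia.
Qed.

Lemma polyb_inv f : polyb f -> exists c k, forall n, f n <= c * S n ^ k.
Proof.
  intros (c & k & H). exists (2 * c), k. intros n. specialize (H n).
  pose proof (poly_le_pow c k n). lia.
Qed.

Lemma pow_S_mono n k k' : k <= k' -> S n ^ k <= S n ^ k'.
Proof. intros. apply Nat.pow_le_mono_r; lia. Qed.

Lemma polyb_const c : polyb (fun _ => c).
Proof. apply (polyb_pow c 0). intros; simpl; lia. Qed.

Lemma polyb_id : polyb (fun n => n).
Proof. apply (polyb_pow 1 1). intros; simpl; lia. Qed.

Lemma polyb_add f g : polyb f -> polyb g -> polyb (fun n => f n + g n).
Proof.
  intros Hf Hg. apply polyb_inv in Hf, Hg.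
  destruct Hf as (c & k & Hf), Hg as (c' & k' & Hg). apply (polyb_pow (c + c') (k + k')).
  intros n. specialize (Hf n). specialize (Hg n).
  pose proof (pow_S_mono n k (k + k') ltac:(lia)).
  pose proof (pow_S_mono n k' (k + k') ltac:(lia)). nia.
Qed.

Lemma polyb_mul f g : polyb f -> polyb g -> polyb (fun n => f n * g n).
Proof.
  intros Hf Hg. apply polyb_inv in Hf, Hg.
  destruct Hf as (c & k & Hf), Hg as (c' & k' & Hg). apply (polyb_pow (c * c') (k + k')).
  intros n. specialize (Hf n). specialize (Hg n).
  pose proof (Nat.mul_le_mono _ _ _ _ Hf Hg). rewrite Nat.pow_add_r. nia.
Qed.

Lemma polyb_comp f g : polyb f -> polyb g -> polyb (fun n => f (g n)).
Proof.
  intros Hf Hg. apply polyb_inv in Hf, Hg.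
  destruct Hf as (c & k & Hf), Hg as (c' & k' & Hg). apply (polyb_pow (c * S c' ^ k) (k' * k)).
  intros n. specialize (Hf (g n)). specialize (Hg n).
  assert (S (g n) <= S c' * S n ^ k').
  { assert (1 <= S n ^ k') by (apply Nat.neq_0_lt_0, Nat.pow_nonzero; lia). nia. }
  pose proof (Nat.pow_le_mono_l _ _ k H) as Hp. rewrite Nat.pow_mul_l, <- Nat.pow_mul_r in Hp. nia.
Qed.

(** * Loop programs and what they print *)

Inductive piece := Bits (w : list bool) | Num (v : nat).

Inductive gen (A : Type) :=
| GNil
| GOne (a : A)
| GSeq (g1 g2 : gen A)
| GFor (v : nat) (g0 g1 : gen A).

Arguments GNil {A}.
Arguments GOne {A}.
Arguments GSeq {A}.
Arguments GFor {A}.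

(* The last iteration comes first: the output stack grows at its top. *)
Fixpoint for_loop {B} (F : bool -> nat -> list B) (k : nat) (l : list bool) : list B :=
  match l with [] => [] | b :: l' => for_loop F (S k) l' ++ F b k end.

(* Loop variables are de Bruijn levels; [s v] is a word of which loops see the
   length, except that the branches [g0], [g1] also see the current bit. *)
Fixpoint dens {A B} (I : A -> regs -> B) (d : nat) (g : gen A) (s : regs) : list B :=
  match g with
  | GNil => []
  | GOne a => [I a s]
  | GSeq g1 g2 => dens I d g1 s ++ dens I d g2 s
  | GFor v g0 g1 =>
      for_loop (fun b k => if b then dens I (S d) g1 (upd s d (repeat true k))
                           else dens I (S d) g0 (upd s d (repeat true k))) 0 (s v)
  end.

Lemma for_loop_map {B C} (h : B -> C) F F' l : (forall b k, F' b k = map h (F b k)) ->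
  forall k, for_loop F' k l = map h (for_loop F k l).
Proof.
  intros H. induction l as [|b l IH]; intros k; simpl; auto. rewrite map_app, IH, H. reflexivity.
Qed.

Lemma dens_map {A B C} (h : B -> C) (I : A -> regs -> B) g : forall d s,
  dens (fun a s => h (I a s)) d g s = map h (dens I d g s).
Proof.
  induction g; intros d s; simpl; auto.
  - rewrite map_app, IHg1, IHg2. reflexivity.
  - apply for_loop_map. intros [|] k; auto.
Qed.

Lemma in_for_loop {B} (F : bool -> nat -> list B) x l : forall k0,
  In x (for_loop F k0 l) <-> exists k b, nth_error l k = Some b /\ In x (F b (k0 + k)).
Proof.
  induction l as [|b l IH]; intros k0; simpl.
  - split; [tauto|]. intros ([|k] & b & H & _); discriminate.
  - rewrite in_app_iff, IH. split.
    + intros [(k & b' & H1 & H2)|H].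
      * exists (S k), b'. rewrite Nat.add_succ_r. auto.
      * exists 0, b. rewrite Nat.add_0_r. auto.
    + intros ([|k] & b' & H1 & H2).
      * right. simpl in H1. injection H1 as ->. rewrite Nat.add_0_r in H2. exact H2.
      * left. exists k, b'. rewrite Nat.add_succ_r in H2. auto.
Qed.

(** The code of [k] zeros under [enc_bits], without the terminator. *)
Fixpoint tfs (k : nat) : list bool :=
  match k with 0 => [] | S k' => true :: false :: tfs k' end.

Definition piece_bits (p : piece) (s : regs) : list bool :=
  match p with Bits w => w | Num v => tfs (length (s v)) end.

Definition pieces_bits (ps : list piece) (s : regs) : list bool :=
  flat_map (fun p => piece_bits p s) ps.

(** * Compilation of loop programs to stack programs *)

Definition lv (v : nat) := 2 * v + 2.
(** Register 0 is the output and 1 is scratch; [lv v] holds the word of level [v], and [wk v] the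
    copy consumed by the loop that binds level [v]. *)
Definition wk (v : nat) := 2 * v + 3.

Definition mv (r r' : nat) : cmd := While r (Push r' false) (Push r' true).

Definition mv_with (r r' : nat) (c : bool -> cmd) : cmd :=
  While r (Seq (Push r' false) (c false)) (Seq (Push r' true) (c true)).

(** Reading a stack destroys it, so the word travels through register 1 and is restored and copied
    on the way back. *)
Definition dup (r q : nat) : cmd := Seq (mv r 1) (mv_with 1 r (fun b => Push q b)).

Fixpoint emit (w : list bool) : cmd :=
  match w with [] => Skip | b :: w' => Seq (emit w') (Push 0 b) end.

Definition emit_num (r : nat) : cmd :=
  Seq (mv r 1) (mv_with 1 r (fun _ => emit [true; false])).

Fixpoint emit_pieces (ps : list piece) : cmd :=
  match ps with
  | [] => Skip
  | p :: ps' => Seq (emit_pieces ps') (match p with Bits w => emit w | Num v => emit_num (lv v) end)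
  end.

(** Each round pushes one [true] on [lv d], so the body sees the index of its iteration in unary;
    the counter is emptied when the loop ends. *)
Fixpoint cgen {A} (ap : A -> list piece) (d : nat) (g : gen A) : cmd :=
  match g with
  | GNil => Skip
  | GOne a => emit_pieces (ap a)
  | GSeq g1 g2 => Seq (cgen ap d g2) (cgen ap d g1)
  | GFor v g0 g1 =>
      Seq (dup (lv v) (wk d))
        (Seq (While (wk d) (Seq (cgen ap (S d) g0) (Push (lv d) true))
                           (Seq (cgen ap (S d) g1) (Push (lv d) true)))
             (While (lv d) Skip Skip))
  end.

Definition piece_wf (d : nat) (p : piece) : Prop :=
  match p with Bits _ => True | Num v => v < d end.

Fixpoint gwf {A} (ap : A -> list piece) (d : nat) (g : gen A) : Prop :=
  match g with
  | GNil => True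
  | GOne a => Forall (piece_wf d) (ap a)
  | GSeq g1 g2 => gwf ap d g1 /\ gwf ap d g2
  | GFor v g0 g1 => v < d /\ gwf ap (S d) g0 /\ gwf ap (S d) g1
  end.

Fixpoint pieces_cost (ps : list piece) (M : nat) : nat :=
  match ps with
  | [] => 1
  | p :: ps' => pieces_cost ps' M + match p with Bits w => S (length w) | Num _ => 7 * M + 2 end
  end.

(** [M] bounds all words in scope, loop counters included. The part [7 * M + 4] pays for copying the
    word, the final loop test and clearing the counter. *)
Fixpoint gcost {A} (ap : A -> list piece) (g : gen A) (M : nat) : nat :=
  match g with
  | GNil => 1
  | GOne a => pieces_cost (ap a) M
  | GSeq g1 g2 => gcost ap g2 M + gcost ap g1 M
  | GFor _ g0 g1 => 7 * M + 4 + M * (gcost ap g0 M + gcost ap g1 M + 2)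
  end.

Ltac regs_ext :=
  let r := fresh "r" in
  extensionality r; unfold upd;
  repeat match goal with |- context [?a =? ?b] => destruct (Nat.eqb_spec a b); try subst end;
  try reflexivity; try (unfold lv, wk in *; lia); try congruence.

Lemma exec_eq c s s' s'' n : exec c s s' n -> s' = s'' -> exec c s s'' n.
Proof. intros H <-. exact H. Qed.

Lemma exec_mv r r' : r <> r' -> forall l s, s r = l ->
  exec (mv r r') s (upd (upd s r []) r' (rev l ++ s r')) (2 * length l + 1).
Proof.
  intros Hr. induction l as [|b l IH]; intros s Hs.
  - eapply exec_eq; [apply ex_done; auto|]. simpl. regs_ext.
  - simpl length. replace (2 * S (length l) + 1) with (S (1 + (2 * length l + 1))) by lia.
    eapply exec_eq.
    + eapply ex_loop; [exact Hs| |].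
      * destruct b; apply ex_push.
      * apply IH. rewrite !upd_neq by auto. apply upd_eq.
    + rewrite upd_eq, upd_neq by auto. simpl rev. rewrite <- app_assoc. simpl. destruct b; regs_ext.
Qed.

Lemma exec_dup_loop r q : r <> 1 -> q <> 1 -> r <> q -> forall l s, s 1 = l ->
  exec (mv_with 1 r (fun b => Push q b)) s
    (upd (upd (upd s 1 []) r (rev l ++ s r)) q (rev l ++ s q)) (3 * length l + 1).
Proof.
  intros H1 H2 H3. induction l as [|b l IH]; intros s Hs.
  - eapply exec_eq; [apply ex_done; auto|]. simpl. regs_ext.
  - simpl length. replace (3 * S (length l) + 1) with (S ((1 + 1) + (3 * length l + 1))) by lia.
    eapply exec_eq.
    + eapply ex_loop; [exact Hs| |].
      * destruct b; eapply ex_seq; apply ex_push.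
      * apply IH. rewrite !upd_neq by auto. apply upd_eq.
    + simpl rev. rewrite <- !app_assoc. simpl. destruct b; regs_ext.
Qed.

Lemma exec_dup r q s : r <> 1 -> q <> 1 -> r <> q -> s 1 = [] -> s q = [] ->
  exec (dup r q) s (upd s q (s r)) (5 * length (s r) + 2).
Proof.
  intros H1 H2 H3 Hs Hq.
  replace (5 * length (s r) + 2) with ((2 * length (s r) + 1) + (3 * length (rev (s r)) + 1))
    by (rewrite length_rev; lia).
  eapply exec_eq.
  - eapply ex_seq; [apply exec_mv; [exact H1|reflexivity]|].
    apply exec_dup_loop; auto. rewrite upd_eq, Hs, app_nil_r. reflexivity.
  - rewrite rev_involutive. regs_ext; rewrite ?Hs, ?Hq, ?app_nil_r; auto.
Qed.

Lemma exec_emit w s : exec (emit w) s (upd s 0 (w ++ s 0)) (S (length w)).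
Proof.
  induction w as [|b w IH].
  - eapply exec_eq; [apply ex_skip|]. simpl. regs_ext.
  - simpl length. replace (S (S (length w))) with (S (length w) + 1) by lia. eapply exec_eq.
    + eapply ex_seq; [exact IH|apply ex_push].
    + rewrite upd_eq. simpl. regs_ext.
Qed.

Lemma tfs_comm k w : tfs k ++ true :: false :: w = true :: false :: tfs k ++ w.
Proof. induction k as [|k IH]; simpl; auto. rewrite IH. reflexivity. Qed.

Lemma exec_num_loop r : r <> 1 -> r <> 0 -> forall l s, s 1 = l ->
  exec (mv_with 1 r (fun b => emit [true; false])) s
    (upd (upd (upd s 1 []) r (rev l ++ s r)) 0 (tfs (length l) ++ s 0)) (5 * length l + 1).
Proof.
  intros H1 H2. induction l as [|b l IH]; intros s Hs.
  - eapply exec_eq; [apply ex_done; auto|]. simpl. regs_ext.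
  - simpl length. replace (5 * S (length l) + 1) with (S ((1 + 3) + (5 * length l + 1))) by lia.
    set (s1 := upd s 1 l). set (s2 := upd s1 r (b :: s1 r)).
    assert (Hb : exec (if b then Seq (Push r true) (emit [true; false])
                       else Seq (Push r false) (emit [true; false]))
                      s1 (upd s2 0 ([true; false] ++ s2 0)) (1 + 3)).
    { unfold s2. destruct b; (eapply ex_seq; [apply ex_push|apply (exec_emit [true; false])]). }
    eapply exec_eq.
    + eapply ex_loop; [exact Hs|exact Hb|]. apply IH. unfold s2, s1. rewrite !upd_neq by auto. apply upd_eq.
    + unfold s2, s1. simpl rev. rewrite <- !app_assoc. simpl. regs_ext; apply tfs_comm.
Qed.

Lemma exec_num r s : r <> 1 -> r <> 0 -> s 1 = [] ->
  exec (emit_num r) s (upd s 0 (tfs (length (s r)) ++ s 0)) (7 * length (s r) + 2).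
Proof.
  intros H1 H2 Hs.
  replace (7 * length (s r) + 2) with ((2 * length (s r) + 1) + (5 * length (rev (s r)) + 1))
    by (rewrite length_rev; lia).
  eapply exec_eq.
  - eapply ex_seq; [apply exec_mv; [exact H1|reflexivity]|].
    apply exec_num_loop; auto. rewrite upd_eq, Hs, app_nil_r. reflexivity.
  - rewrite rev_involutive, length_rev. regs_ext; rewrite ?Hs, ?app_nil_r; auto.
Qed.

Definition clean (d : nat) (s : regs) : Prop :=
  s 1 = [] /\ forall v, d <= v -> s (lv v) = [] /\ s (wk v) = [].

Definition agree (d : nat) (s e : regs) : Prop := forall v, v < d -> s (lv v) = e v.

Definition bounded (d : nat) (e : regs) (M : nat) : Prop := forall v, v < d -> length (e v) <= M.

Lemma clean_upd0 d s w : clean d s -> clean d (upd s 0 w).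
Proof.
  intros [H1 H2]. split; [exact H1|]. intros v Hv. rewrite !upd_neq by (unfold lv, wk; lia). auto.
Qed.

Lemma agree_upd0 d s e w : agree d s e -> agree d (upd s 0 w) e.
Proof. intros H v Hv. rewrite upd_neq by (unfold lv; lia). auto. Qed.

Lemma exec_pieces d e M ps : Forall (piece_wf d) ps -> bounded d e M ->
  forall s, clean d s -> agree d s e ->
  exists n, n <= pieces_cost ps M /\
    exec (emit_pieces ps) s (upd s 0 (pieces_bits ps e ++ s 0)) n.
Proof.
  intros Hwf HM. induction Hwf as [|p ps Hp Hps IH]; intros s Hc Ha.
  - exists 1. split; auto. eapply exec_eq; [apply ex_skip|]. simpl. regs_ext.
  - destruct (IH s Hc Ha) as (n & Hn & He). set (s1 := upd s 0 (pieces_bits ps e ++ s 0)) in *.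
    assert (Hstep : exists n', n' <= (match p with Bits w => S (length w) | Num _ => 7 * M + 2 end) /\
      exec (match p with Bits w => emit w | Num v => emit_num (lv v) end) s1
           (upd s1 0 (piece_bits p e ++ s1 0)) n').
    { destruct p as [w|v]; simpl in Hp.
      - exists (S (length w)). split; auto. apply exec_emit.
      - exists (7 * length (e v) + 2). split; [specialize (HM v Hp); cbn iota; lia|].
        pose proof (agree_upd0 _ _ _ (pieces_bits ps e ++ s 0) Ha v Hp) as Hv. fold s1 in Hv.
        simpl. rewrite <- Hv. apply exec_num; try (unfold lv; lia). apply Hc. }
    destruct Hstep as (n' & Hn' & He'). exists (n + n'). split; [cbn [pieces_cost]; lia|].
    eapply exec_eq; [eapply ex_seq; [exact He|exact He']|].
    unfold s1. rewrite upd_eq. unfold pieces_bits. simpl. rewrite <- app_assoc. regs_ext.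
Qed.

Lemma exec_clear r : forall l s, s r = l -> exec (While r Skip Skip) s (upd s r []) (2 * length l + 1).
Proof.
  induction l as [|b l IH]; intros s Hs.
  - eapply exec_eq; [apply ex_done; auto|]. regs_ext.
  - simpl length. replace (2 * S (length l) + 1) with (S (1 + (2 * length l + 1))) by lia.
    eapply exec_eq.
    + eapply ex_loop; [exact Hs|destruct b; apply ex_skip|]. apply IH. apply upd_eq.
    + regs_ext.
Qed.

Lemma exec_gen {A} (ap : A -> list piece) (g : gen A) : forall d e M s,
  gwf ap d g -> bounded d e M -> clean d s -> agree d s e ->
  exists n, n <= gcost ap g M /\
    exec (cgen ap d g) s
      (upd s 0 (concat (dens (fun a e => pieces_bits (ap a) e) d g e) ++ s 0)) n.
Proof.
  induction g as [|a|g1 IH1 g2 IH2|v g0 IH0 g1 IH1]; intros d e M s Hwf HM Hc Ha;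
    cbn [gwf gcost cgen dens] in *.
  - exists 1. split; auto. eapply exec_eq; [apply ex_skip|]. simpl. regs_ext.
  - destruct (exec_pieces d e M _ Hwf HM s Hc Ha) as (n & Hn & He). exists n. split; auto.
    simpl. rewrite app_nil_r. exact He.
  - destruct Hwf as [Hw1 Hw2].
    destruct (IH2 d e M s Hw2 HM Hc Ha) as (n2 & Hn2 & He2).
    edestruct (IH1 d e M) as (n1 & Hn1 & He1);
      [exact Hw1|exact HM|apply clean_upd0, Hc|apply agree_upd0, Ha|].
    exists (n2 + n1). split; [lia|]. eapply exec_eq; [eapply ex_seq; [exact He2|exact He1]|].
    rewrite upd_eq, concat_app, <- app_assoc. regs_ext.
  - destruct Hwf as (Hv & Hw0 & Hw1).
    set (F := fun (b : bool) k => _ : list (list bool)).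
    set (body := While (wk d) _ _).
    set (C := gcost ap g0 M + gcost ap g1 M).
    (* Loop invariant: [k] rounds are done and [l] is still to be read; [k + length l <= M] keeps
       the counter within the bound on words. *)
    assert (Hloop : forall l k s, s (wk d) = l -> s (lv d) = repeat true k -> k + length l <= M ->
      s 1 = [] -> (forall u, d < u -> s (lv u) = [] /\ s (wk u) = []) -> agree d s e ->
      exists n, n <= length l * (C + 2) + 1 /\
        exec body s (upd (upd (upd s (wk d) []) (lv d) (repeat true (k + length l)))
                         0 (concat (for_loop F k l) ++ s 0)) n).
    { clear s Hc Ha. induction l as [|b l IH]; intros k s Hwk Hlv Hk H1 Hcl Ha.
      - exists 1. split; [simpl; lia|]. eapply exec_eq; [apply ex_done; auto|].
        simpl. rewrite Nat.add_0_r. regs_ext.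
      - set (s1 := upd s (wk d) l).
        assert (Hc1 : clean (S d) s1).
        { unfold s1. split; [rewrite upd_neq by (unfold wk; lia); auto|].
          intros u Hu. rewrite !upd_neq by (unfold lv, wk; lia). apply Hcl. lia. }
        assert (Ha1 : agree (S d) s1 (upd e d (repeat true k))).
        { intros u Hu. unfold s1. rewrite upd_neq by (unfold lv, wk; lia).
          destruct (Nat.eq_dec u d) as [->|Hud]; [rewrite upd_eq; auto|].
          rewrite upd_neq by auto. apply Ha. lia. }
        assert (HM1 : bounded (S d) (upd e d (repeat true k)) M).
        { intros u Hu. destruct (Nat.eq_dec u d) as [->|Hud].
          - rewrite upd_eq, repeat_length. lia.
          - rewrite upd_neq by auto. apply HM. lia. }
        assert (Hbody : exists n, n <= C /\
          exec (cgen ap (S d) (if b then g1 else g0)) s1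
               (upd s1 0 (concat (F b k) ++ s1 0)) n).
        { unfold F, C. destruct b.
          - destruct (IH1 _ _ M _ Hw1 HM1 Hc1 Ha1) as (n & Hn & He). exists n. split; [lia|exact He].
          - destruct (IH0 _ _ M _ Hw0 HM1 Hc1 Ha1) as (n & Hn & He). exists n. split; [lia|exact He]. }
        destruct Hbody as (n & Hn & He).
        set (s2 := upd s1 0 (concat (F b k) ++ s1 0)) in *.
        set (s3 := upd s2 (lv d) (true :: s2 (lv d))).
        destruct (IH (S k) s3) as (n' & Hn' & He').
        { unfold s3, s2, s1. rewrite !(upd_neq _ _ _ (wk d)) by (unfold lv, wk; lia). apply upd_eq. }
        { unfold s3. rewrite upd_eq. unfold s2, s1. rewrite !upd_neq by (unfold lv, wk; lia).
          rewrite Hlv. reflexivity. }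
        { simpl in Hk. lia. }
        { unfold s3, s2, s1. rewrite !upd_neq by (unfold lv, wk; lia). auto. }
        { intros u Hu. unfold s3, s2, s1. rewrite !upd_neq by (unfold lv, wk; lia). auto. }
        { intros u Hu. unfold s3, s2, s1. rewrite !upd_neq by (unfold lv, wk; lia). auto. }
        exists (S ((n + 1) + n')). split; [simpl length; lia|]. eapply exec_eq.
        + eapply ex_loop; [exact Hwk| |exact He'].
          destruct b; (eapply ex_seq; [exact He|apply ex_push]).
        + simpl for_loop. rewrite concat_app, <- app_assoc. simpl length.
          replace (k + S (length l)) with (S k + length l) by lia.
          unfold s3, s2, s1. regs_ext. }
    pose proof (HM v Hv) as Hlen. rewrite <- (Ha v Hv) in Hlen. pose proof Hc as [Hc1 Hcd].
    destruct (Hcd d (le_n d)) as [Hld Hwd].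
    pose proof (exec_dup (lv v) (wk d) s ltac:(unfold lv; lia) ltac:(unfold wk; lia)
                  ltac:(unfold lv, wk; lia) Hc1 Hwd) as Hd.
    set (s1 := upd s (wk d) (s (lv v))) in *.
    destruct (Hloop (s (lv v)) 0 s1) as (n & Hn & He).
    { apply upd_eq. }
    { unfold s1. rewrite upd_neq by (unfold lv, wk; lia). auto. }
    { lia. }
    { unfold s1. rewrite upd_neq by (unfold lv, wk; lia). auto. }
    { intros u Hu. unfold s1. rewrite !upd_neq by (unfold lv, wk; lia). apply Hcd. lia. }
    { intros u Hu. unfold s1. rewrite !upd_neq by (unfold lv, wk; lia). auto. }
    eexists. split; [|eapply exec_eq; [eapply ex_seq; [exact Hd|eapply ex_seq; [exact He|]]|]].
    2:{ eapply exec_clear. reflexivity. }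
    + rewrite upd_neq by (unfold lv; lia). rewrite upd_eq, repeat_length.
      fold C. nia.
    + rewrite <- (Ha v Hv). unfold s1. regs_ext. 
Qed.

(** * Programs that first compute unary words *)

Fixpoint cprog {A} (ap : A -> list piece) (d : nat) (gs : list (gen unit)) (g : gen A) : cmd :=
  match gs with
  (* The mark that closes [enc_list] is pushed first because it is read last. *)
  | [] => Seq (Push 0 false) (cgen ap d g)
  | h :: gs' => Seq (Seq (cgen (fun _ => [Bits [true]]) d h) (Seq (mv 0 1) (mv 1 (lv d))))
                    (cprog ap (S d) gs' g)
  end.

Definition unary_out (d : nat) (h : gen unit) (e : regs) : list bool :=
  concat (dens (fun _ _ => [true]) d h e).

Fixpoint penv (d : nat) (gs : list (gen unit)) (e : regs) : regs :=
  match gs with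
  | [] => e
  | h :: gs' => penv (S d) gs' (upd e d (unary_out d h e))
  end.

Fixpoint pwf {A} (ap : A -> list piece) (d : nat) (gs : list (gen unit)) (g : gen A) : Prop :=
  match gs with
  | [] => gwf ap d g
  | h :: gs' => gwf (fun _ => [Bits [true]]) d h /\ pwf ap (S d) gs' g
  end.

(** A printed word is no longer than the cost [c] of printing it, so [M + c] bounds the words of the
    next level. Moving it costs at most another [4 * c + 2]. *)
Fixpoint pcost {A} (ap : A -> list piece) (gs : list (gen unit)) (g : gen A) (M : nat) : nat :=
  match gs with
  | [] => 1 + gcost ap g M
  | h :: gs' => let c := gcost (fun _ => [Bits [true]]) h M in 5 * c + 2 + pcost ap gs' g (M + c)
  end.

(** A move reverses the word; two moves restore its order. *)
Lemma exec_mv0 s r : 1 < r -> s 1 = [] -> s r = [] ->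
  exec (Seq (mv 0 1) (mv 1 r)) s (upd (upd s r (s 0)) 0 []) (4 * length (s 0) + 2).
Proof.
  intros Hr H1 Hs.
  replace (4 * length (s 0) + 2) with ((2 * length (s 0) + 1) + (2 * length (rev (s 0)) + 1))
    by (rewrite length_rev; lia).
  eapply exec_eq.
  - eapply ex_seq; [apply exec_mv; [lia|reflexivity]|]. apply exec_mv; [lia|].
    rewrite upd_eq, H1, app_nil_r. reflexivity.
  - rewrite rev_involutive. regs_ext; rewrite ?Hs, ?app_nil_r; auto.
Qed.

Lemma exec_prog {A} (ap : A -> list piece) (g : gen A) gs : forall d e M s,
  pwf ap d gs g -> bounded d e M -> clean d s -> agree d s e -> s 0 = [] ->
  exists n s', n <= pcost ap gs g M /\ exec (cprog ap d gs g) s s' n /\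
    s' 0 = concat (dens (fun a e => pieces_bits (ap a) e) (d + length gs) g (penv d gs e)) ++ [false].
Proof.
  induction gs as [|h gs IH]; intros d e M s Hwf HM Hc Ha H0; cbn [pwf cprog pcost penv] in *.
  - edestruct (exec_gen ap g d e M (upd s 0 (false :: s 0))) as (n & Hn & He);
      [exact Hwf|exact HM|apply clean_upd0, Hc|apply agree_upd0, Ha|].
    eexists (1 + n), _. split; [lia|]. split; [eapply ex_seq; [apply ex_push|exact He]|].
    rewrite !upd_eq, H0, Nat.add_0_r. reflexivity.
  - destruct Hwf as [Hw Hwf].
    destruct (exec_gen (fun _ => [Bits [true]]) h d e M s Hw HM Hc Ha) as (n & Hn & He).
    change (dens (fun a e => pieces_bits [Bits [true]] e) d h e) with
      (dens (fun (a : unit) (e : regs) => [true]) d h e) in He.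
    fold (unary_out d h e) in He. rewrite H0, app_nil_r in He.
    set (w := unary_out d h e) in *.
    pose proof (exec_size _ _ _ _ He 0) as Hsz. rewrite upd_eq, H0 in Hsz. simpl in Hsz.
    destruct Hc as [Hc1 Hcd]. destruct (Hcd d (le_n d)) as [Hld Hwd].
    pose proof (exec_mv0 (upd s 0 w) (lv d)) as Hm. rewrite upd_eq in Hm.
    specialize (Hm ltac:(unfold lv; lia)). rewrite !upd_neq in Hm by (unfold lv; lia).
    specialize (Hm Hc1 Hld).
    set (s1 := upd (upd (upd s 0 w) (lv d) w) 0 []) in *.
    destruct (IH (S d) (upd e d w) (M + gcost (fun _ => [Bits [true]]) h M) s1)
      as (n' & s' & Hn' & He' & Hs').
    + exact Hwf.
    + intros v Hv. destruct (Nat.eq_dec v d) as [->|Hvd]; [rewrite upd_eq; lia|].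
      rewrite upd_neq by auto. specialize (HM v). lia.
    + unfold s1. split; [rewrite !upd_neq by (unfold lv; lia); auto|]. intros v Hv.
      rewrite !upd_neq by (unfold lv, wk; lia). apply Hcd. lia.
    + intros v Hv. unfold s1. rewrite upd_neq by (unfold lv; lia).
      destruct (Nat.eq_dec v d) as [->|Hvd]; [rewrite !upd_eq; auto|].
      rewrite !upd_neq by (unfold lv; lia). apply Ha. lia.
    + apply upd_eq.
    + exists (n + (4 * length w + 2) + n'), s'. split; [lia|]. split.
      * eapply ex_seq; [eapply ex_seq; [exact He|exact Hm]|exact He'].
      * rewrite Hs'. simpl length. rewrite Nat.add_succ_r. reflexivity.
Qed.

(** * The cost is polynomial *)

Ltac polyb_tac :=
  repeat first [assumption | apply polyb_const | apply polyb_id | apply polyb_add | apply polyb_mul].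

Lemma polyb_pieces ps : polyb (pieces_cost ps).
Proof.
  induction ps as [|[w|v] ps IH]; cbn [pieces_cost].
  - apply polyb_const.
  - apply (polyb_add (pieces_cost ps) (fun _ => S (length w))); polyb_tac.
  - apply (polyb_add (pieces_cost ps) (fun M => 7 * M + 2)); polyb_tac.
Qed.

Lemma polyb_gcost {A} (ap : A -> list piece) g : polyb (gcost ap g).
Proof.
  induction g; cbn [gcost].
  - apply polyb_const.
  - apply polyb_pieces.
  - apply (polyb_add (gcost ap g2) (gcost ap g1)); auto.
  - apply (polyb_add (fun M => 7 * M + 4) (fun M => M * (gcost ap g1 M + gcost ap g2 M + 2))); polyb_tac.
Qed.

Lemma polyb_pcost {A} (ap : A -> list piece) (g : gen A) gs : polyb (pcost ap gs g).
Proof.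
  induction gs as [|h gs IH]; cbn [pcost].
  - apply (polyb_add (fun _ => 1) (gcost ap g)); [apply polyb_const|apply polyb_gcost].
  - pose proof (polyb_gcost (fun _ : unit => [Bits [true]]) h) as Hh.
    set (c := gcost _ h) in *.
    apply (polyb_add (fun M => 5 * c M + 2) (fun M => pcost ap gs g (M + c M))); [polyb_tac|].
    apply (polyb_comp (pcost ap gs g) (fun M => M + c M)); polyb_tac.
Qed.

Lemma cmd_regs_mono m m' c : m <= m' -> cmd_regs m c -> cmd_regs m' c.
Proof.
  intros H. induction c; simpl; auto; intros; try lia; intuition lia.
Qed.

Lemma cmd_regs_ex c : exists m, 0 < m /\ cmd_regs m c.
Proof.
  induction c as [|r b|c1 (m1 & H1 & R1) c2 (m2 & H2 & R2)|r c1 (m1 & H1 & R1) c2 (m2 & H2 & R2)].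
  - exists 1. simpl; auto.
  - exists (S r). simpl; lia.
  - exists (m1 + m2). split; [lia|]. split; eapply cmd_regs_mono; try eassumption; lia.
  - exists (S r + m1 + m2). split; [lia|]. split; [lia|].
    split; eapply cmd_regs_mono; try eassumption; lia.
Qed.

Definition input_env (x : list bool) : regs := fun v => if v =? 0 then x else [].

Theorem gen_computable {A} (ap : A -> list piece) (gs : list (gen unit)) (g : gen A) :
  pwf ap 1 gs g ->
  poly_time_computable (fun x =>
    concat (dens (fun a e => pieces_bits (ap a) e) (S (length gs)) g (penv 1 gs (input_env x)))
      ++ [false]).
Proof.
  (* The output needs register 0, so the input is first moved to level 0. *)
  intros Hwf. set (c := Seq (Seq (mv 0 1) (mv 1 (lv 0))) (cprog ap 1 gs g)).
  destruct (cmd_regs_ex c) as (m & Hm & Hr).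
  destruct (cmd_machine m c Hm Hr) as [M HM].
  set (N := fun n => 4 * n + 2 + pcost ap gs g n).
  assert (HN : polyb N) by (apply polyb_add; [polyb_tac|apply polyb_pcost]).
  assert (HT : polyb (fun n => n + 2 + N n * icost m (n + N n) + (3 + (n + N n)))).
  { unfold icost. polyb_tac. }
  destruct HT as (p & k & HT). exists M, p, k. intros x.
  pose proof (exec_mv0 (start_regs x) (lv 0) ltac:(unfold lv; lia) eq_refl eq_refl) as Hmv.
  change (start_regs x 0) with x in Hmv.
  destruct (exec_prog ap g gs 1 (input_env x) (length x) (upd (upd (start_regs x) (lv 0) x) 0 []))
    as (n & s' & Hn & He & Hs').
  - exact Hwf.
  - intros v Hv. unfold input_env. destruct (v =? 0); simpl; lia.
  - split; [reflexivity|]. intros v Hv. rewrite !upd_neq by (unfold lv, wk; lia).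
    unfold start_regs, lv, wk. rewrite !(proj2 (Nat.eqb_neq _ _)) by lia. auto.
  - intros v Hv. replace v with 0 by lia. reflexivity.
  - reflexivity.
  - destruct (HM x s' (4 * length x + 2 + n)) as (t & Ht & Hh & Ho).
    { eapply ex_seq; [exact Hmv|exact He]. }
    exists t. split; [|split; auto].
    + etransitivity; [exact Ht|]. etransitivity; [|apply HT].
      assert (4 * length x + 2 + n <= N (length x)) by (unfold N; lia).
      assert (icost m (length x + (4 * length x + 2 + n)) <= icost m (length x + N (length x))).
      { unfold icost. nia. }
      pose proof (Nat.mul_le_mono _ _ _ _ H H0). lia.
    + rewrite Ho, Hs'. reflexivity.
Qed.

(** * Printing circuits *)

Definition gitem_map {N N'} (h : N -> N') (i : gitem N) : gitem N' :=
  match i with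
  | Gate v a b c => Gate (h v) (h a) (h b) (h c)
  | Lit v u s => Lit (h v) (h u) s
  | Univ u => Univ (h u)
  end.

(* [(k, vs)] stands for [k] plus the current values of the loop variables [vs]. *)
Definition nexp := (nat * list nat)%type.

Definition nexp_val (e : regs) (x : nexp) : nat :=
  fst x + list_sum (map (fun v => length (e v)) (snd x)).

Definition titem := gitem (list nexp).

Definition inst (t : titem) (e : regs) : item := gitem_map (map (nexp_val e)) t.

(** One coordinate of [unary_code] under [enc_bits]: a pair for each zero, then the pair of the one
    that closes it. *)
Definition coord_pieces (x : nexp) : list piece :=
  Bits (tfs (fst x)) :: map Num (snd x) ++ [Bits [true; true]].

(** [[true; true]] is the leading one supplied by [num], and [[false; false]] the terminator of
    [enc_bits]. *)
Definition node_pieces (n : list nexp) : list piece :=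
  flat_map coord_pieces n ++ [Bits [true; true; false; false]].

Definition const_pieces (c : nat) : list piece := [Bits (enc_nat c)].

(** The first [true] is the mark by which [enc_list] announces another fact of the database. *)
Definition fact_pieces (name : nat) (args : list (list piece)) : list piece :=
  Bits (true :: enc_nat name) :: flat_map (fun a => Bits [true] :: a) args ++ [Bits [false]].

Definition item_pieces (t : titem) : list piece :=
  match t with
  | Gate v a b c =>
      fact_pieces 0 [node_pieces v] ++
      fact_pieces 1 [node_pieces v; node_pieces a; node_pieces b; node_pieces c]
  | Lit v u s =>
      fact_pieces 0 [node_pieces v] ++
      fact_pieces 2 [node_pieces v; node_pieces u; const_pieces (Nat.b2n s)] ++
      fact_pieces 3 [node_pieces u; const_pieces 0] ++
      fact_pieces 3 [node_pieces u; const_pieces 1]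
  | Univ u => fact_pieces 4 [node_pieces u]
  end.

Lemma pieces_bits_app ps qs e : pieces_bits (ps ++ qs) e = pieces_bits ps e ++ pieces_bits qs e.
Proof. apply flat_map_app. Qed.

Lemma tfs_add a b : tfs (a + b) = tfs a ++ tfs b.
Proof. induction a as [|a IH]; simpl; auto. rewrite IH. reflexivity. Qed.

Lemma coord_bits x e : pieces_bits (coord_pieces x) e = tfs (nexp_val e x) ++ [true; true].
Proof.
  destruct x as [k vs]. unfold coord_pieces, nexp_val. cbn [fst snd]. rewrite tfs_add, <- app_assoc.
  simpl. f_equal. rewrite pieces_bits_app. simpl. f_equal.
  induction vs as [|v vs IH]; simpl; auto. rewrite IH, tfs_add. reflexivity.
Qed.

Definition enc_pairs (x : list bool) : list bool := flat_map (fun b => [true; b]) x.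

Lemma enc_pairs_app x y : enc_pairs (x ++ y) = enc_pairs x ++ enc_pairs y.
Proof. apply flat_map_app. Qed.

Lemma node_bits n e : pieces_bits (node_pieces n) e = enc_nat (node_id (map (nexp_val e) n)).
Proof.
  unfold node_pieces, enc_nat, node_id. rewrite nat_bits_num, pieces_bits_app. unfold enc_bits.
  fold (enc_pairs (unary_code (map (nexp_val e) n) ++ [true])). rewrite enc_pairs_app, <- app_assoc.
  f_equal. induction n as [|x n IH]; auto. cbn [flat_map map unary_code].
  rewrite pieces_bits_app, IH, coord_bits, enc_pairs_app, <- app_assoc. cbn. f_equal.
  generalize (nexp_val e x). induction n0 as [|k IHk]; simpl; auto. rewrite IHk. reflexivity.
Qed.

Lemma fact_bits name args vals e : Forall2 (fun a v => pieces_bits a e = enc_nat v) args vals ->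
  pieces_bits (fact_pieces name args) e = true :: enc_fact (mkFact name vals).
Proof.
  intros H. unfold fact_pieces, enc_fact, enc_list. simpl. f_equal. f_equal.
  change (pieces_bits (flat_map (fun a => Bits [true] :: a) args ++ [Bits [false]]) e =
          flat_map (fun a => true :: enc_nat a) vals ++ [false]).
  rewrite pieces_bits_app. f_equal.
  induction H as [|a v args vals Ha _ IH]; auto. cbn [flat_map].
  rewrite pieces_bits_app, IH.
  change (pieces_bits (Bits [true] :: a) e) with (true :: pieces_bits a e). rewrite Ha. reflexivity.
Qed.

Lemma item_bits t e : pieces_bits (item_pieces t) e =
  flat_map (fun f => true :: enc_fact f) (item_facts (inst t e)).
Proof.
  assert (Hc : forall c, pieces_bits (const_pieces c) e = enc_nat c).
  { intros c. apply app_nil_r. }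
  pose proof (fun n => node_bits n e) as Hn.
  destruct t; cbn [item_pieces inst gitem_map item_facts flat_map];
    rewrite ?pieces_bits_app, ?app_nil_r;
    repeat (match goal with |- pieces_bits (fact_pieces _ _) _ = _ => idtac
                          | |- pieces_bits (fact_pieces _ _) _ ++ _ = _ => idtac end;
            erewrite fact_bits by (repeat constructor; auto);
            rewrite ?app_comm_cons; f_equal); reflexivity.
Qed.

(** * The tableau circuit *)

Definition gfor {A} (v : nat) (g : gen A) : gen A := GFor v g g.

Definition glist {A} (l : list A) : gen A := fold_right (fun a => GSeq (GOne a)) GNil l.

Definition gseqs {A} (l : list (gen A)) : gen A := fold_right GSeq GNil l.

(** * Unary words of polynomial length *)

Fixpoint nest (v k : nat) : gen unit :=
  match k with 0 => GOne tt | S k' => gfor v (nest v k') end.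

Definition grep (n : nat) (g : gen unit) : gen unit := gseqs (repeat g n).

Definition gpoly (c k v : nat) : gen unit := GSeq (grep c (nest v k)) (grep c (GOne tt)).

Lemma unary_out_seq d g1 g2 e : unary_out d (GSeq g1 g2) e = unary_out d g1 e ++ unary_out d g2 e.
Proof. apply concat_app. Qed.

Lemma length_for_loop_const {B} (F : bool -> nat -> list B) n l :
  (forall b k, length (F b k) = n) -> forall k, length (for_loop F k l) = length l * n.
Proof.
  intros H. induction l as [|b l IH]; intros k; simpl; auto. rewrite length_app, IH, H. lia.
Qed.

Lemma unary_out_length d g e :
  length (unary_out d g e) = length (dens (fun (_ : unit) (_ : regs) => tt) d g e).
Proof.
  unfold unary_out.
  change (fun (_ : unit) (_ : regs) => [true]) with
    (fun (a : unit) (e : regs) => (fun _ : unit => [true]) ((fun _ _ => tt) a e)).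
  rewrite dens_map. induction (dens _ d g e) as [|a l IH]; simpl; auto.
Qed.

Lemma nest_length v k : forall d e, v < d -> length (unary_out d (nest v k) e) = length (e v) ^ k.
Proof.
  intros d e Hv. rewrite unary_out_length. revert d e Hv.
  induction k as [|k IH]; intros d e Hv; simpl; auto.
  rewrite length_for_loop_const with (n := length (e v) ^ k); auto.
  intros [|] i; rewrite IH by lia; rewrite upd_neq by lia; reflexivity.
Qed.

Lemma grep_length d n g e : length (unary_out d (grep n g) e) = n * length (unary_out d g e).
Proof.
  induction n as [|n IH]; auto. unfold grep in *. cbn [repeat gseqs fold_right].
  rewrite unary_out_seq, length_app. unfold gseqs in IH. rewrite IH. reflexivity.
Qed.

Lemma one_length d e : length (unary_out d (GOne tt) e) = 1.
Proof. reflexivity. Qed.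

Lemma gpoly_length c k v d e : v < d ->
  length (unary_out d (gpoly c k v) e) = poly c k (length (e v)).
Proof.
  intros Hv. unfold gpoly, poly.
  rewrite unary_out_seq, length_app, !grep_length, nest_length, one_length by auto. lia.
Qed.

Notation uwf := (gwf (fun _ : unit => [Bits [true]])).

Lemma nest_wf v k : forall d, v < d -> uwf d (nest v k).
Proof. induction k; simpl; intros; repeat constructor; auto. Qed.

Lemma grep_wf d n g : uwf d g -> uwf d (grep n g).
Proof. intros H. induction n; simpl; auto. Qed.

Lemma gpoly_wf c k v d : v < d -> uwf d (gpoly c k v).
Proof. intros H. split; apply grep_wf; [apply nest_wf; auto|repeat constructor]. Qed.

Lemma in_gfor {A B} (I : A -> regs -> B) d v g e x :
  In x (dens I d (gfor v g) e) <->
  exists k, k < length (e v) /\ In x (dens I (S d) g (upd e d (repeat true k))).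
Proof.
  simpl. rewrite in_for_loop. split.
  - intros (k & b & H1 & H2). exists k. split.
    + apply nth_error_Some. congruence.
    + destruct b; exact H2.
  - intros (k & H1 & H2). destruct (nth_error (e v) k) as [b|] eqn:E.
    + exists k, b. split; auto. destruct b; exact H2.
    + apply nth_error_None in E. lia.
Qed.

Lemma dens_glist {A B} (I : A -> regs -> B) d l e : dens I d (glist l) e = map (fun a => I a e) l.
Proof. induction l as [|a l IH]; simpl; auto. rewrite <- IH. reflexivity. Qed.

Lemma in_gseqs {A B} (I : A -> regs -> B) d l e x :
  In x (dens I d (gseqs l) e) <-> Exists (fun g => In x (dens I d g e)) l.
Proof.
  induction l as [|g l IH]; simpl.
  - rewrite Exists_nil. tauto.
  - rewrite in_app_iff, IH, Exists_cons. tauto.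
Qed.

(** * Cell contents and the initial row *)

Definition scode (s : sym) : nat :=
  match s with None => 0 | Some false => 1 | Some true => 2 end.

Definition ccode (c : content) : nat :=
  scode (fst c) + 3 * match snd c with None => 0 | Some q => S q end.

Lemma ccode_inj c c' : ccode c = ccode c' -> c = c'.
Proof.
  destruct c as [s o], c' as [s' o']. unfold ccode; cbn [fst snd]. intros H.
  assert (Hs : scode s <= 2 /\ scode s' <= 2) by (destruct s as [[|]|], s' as [[|]|]; simpl; lia).
  assert (E1 : scode s = scode s') by lia.
  f_equal.
  - destruct s as [[|]|], s' as [[|]|]; simpl in E1; congruence.
  - destruct o as [q|], o' as [q'|]; f_equal; lia.
Qed.

Definition conts (M : TM) : list content :=
  list_prod [None; Some false; Some true] (None :: map Some (seq 0 (S (nst M)))).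

Lemma in_conts M a p : aq a <= nst M -> In (cont a p) (conts M).
Proof.
  intros H. unfold conts, cont. apply in_prod.
  - destruct (atp a p) as [[|]|]; simpl; auto.
  - destruct (p =? apos a)%Z; [|left; reflexivity]. right. apply in_map, in_seq. lia.
Qed.

Definition acc_content (M : TM) (c : content) : bool :=
  match snd c with Some q => xacc M q | None => false end.

(** The origin of an initial cell: a content known when the circuit is printed, or a bit chosen by
    the variable [u]. *)
Inductive src := SConst (d : nat) | SBit (u : node).

Definition src_val (g : node -> bool) (s : src) : nat :=
  match s with SConst d => d | SBit u => scode (Some (g u)) end.

Definition nx (k : nat) (vs : list nat) : nexp := (k, vs).
Notation "% v" := (nx 0 [v]) (at level 5, format "% v").
Notation "! k" := (nx k []) (at level 5, format "! k").

(* A cell whose content does not depend on the choices is justified by both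
   literals of a dummy variable. *)
Definition cell_items {N} (cell : nat -> N) (dummy : N) (s : nat + N) : list (gitem N) :=
  match s with
  | inl d => [Lit (cell d) dummy false; Lit (cell d) dummy true]
  | inr u => [Lit (cell 1) u false; Lit (cell 2) u true]
  end.

Definition src_sum (s : src) : nat + node := match s with SConst d => inl d | SBit u => inr u end.

Definition src_items (l lz j : nat) (s : src) : list item :=
  cell_items (fun d => [l; lz; 0; j; d]) [] (src_sum s).

Definition row_in (l lz base : nat) (srcs : list src) (it : item) : Prop :=
  exists j s, nth_error srcs j = Some s /\ In it (src_items l lz (base + j) s).

Lemma row_in_nil l lz base it : row_in l lz base [] it <-> False.
Proof. split; [|tauto]. intros ([|j] & s & H & _); discriminate. Qed.

Lemma row_in_app l lz base s1 s2 it : row_in l lz base (s1 ++ s2) it <->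
  row_in l lz base s1 it \/ row_in l lz (base + length s1) s2 it.
Proof.
  split.
  - intros (j & s & H1 & H2). destruct (Nat.lt_ge_cases j (length s1)).
    + left. rewrite nth_error_app1 in H1 by auto. exists j, s. auto.
    + right. rewrite nth_error_app2 in H1 by auto. exists (j - length s1), s. split; auto.
      replace (base + length s1 + (j - length s1)) with (base + j) by lia. auto.
  - intros [(j & s & H1 & H2)|(j & s & H1 & H2)].
    + exists j, s. split; auto. rewrite nth_error_app1; auto. apply nth_error_Some. congruence.
    + exists (length s1 + j), s. split; [rewrite nth_error_app2 by lia; rewrite <- H1; f_equal; lia|].
      rewrite Nat.add_assoc. auto.
Qed.

Lemma row_in_one l lz base s it : row_in l lz base [s] it <-> In it (src_items l lz base s).
Proof.
  split.
  - intros ([|[|j]] & s' & H1 & H2); try discriminate. injection H1 as <-.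
    rewrite Nat.add_0_r in H2. exact H2.
  - intros H. exists 0, s. rewrite Nat.add_0_r. auto.
Qed.

Lemma row_in_two l lz base s1 s2 it : row_in l lz base [s1; s2] it <->
  In it (src_items l lz base s1) \/ In it (src_items l lz (base + 1) s2).
Proof.
  change [s1; s2] with ([s1] ++ [s2]). rewrite row_in_app, !row_in_one. reflexivity.
Qed.

Fixpoint mapi {A} (F : bool -> nat -> list A) (k : nat) (w : list bool) : list A :=
  match w with [] => [] | b :: w' => F b k ++ mapi F (S k) w' end.

Lemma row_in_mapi l lz (F : bool -> nat -> list src) n w it :
  (forall b k, length (F b k) = n) -> forall base k0,
  row_in l lz base (mapi F k0 w) it <->
  exists k b, nth_error w k = Some b /\ row_in l lz (base + n * k) (F b (k0 + k)) it.
Proof.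
  intros Hn. induction w as [|b w IH]; intros base k0; cbn [mapi].
  - rewrite row_in_nil. split; [tauto|]. intros ([|k] & b & H & _); discriminate.
  - rewrite row_in_app, Hn, IH. split.
    + intros [H|(k & b' & H1 & H2)].
      * exists 0, b. rewrite Nat.mul_0_r, !Nat.add_0_r. auto.
      * exists (S k), b'. split; auto. rewrite Nat.add_succ_r. simpl in H2.
        replace (base + n * S k) with (base + n + n * k) by lia. auto.
    + intros ([|k] & b' & H1 & H2).
      * left. injection H1 as ->. rewrite Nat.mul_0_r, !Nat.add_0_r in H2. auto.
      * right. exists k, b'. split; auto. rewrite Nat.add_succ_r in H2. simpl.
        replace (base + n + n * k) with (base + n * S k) by lia. auto.
Qed.

Lemma mapi_length {A} (F : bool -> nat -> list A) n w : (forall b k, length (F b k) = n) ->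
  forall k, length (mapi F k w) = n * length w.
Proof.
  intros H. induction w as [|b w IH]; intros k; simpl; [lia|]. rewrite length_app, H, IH. lia.
Qed.

(* Levels: 0 the input x, 1 |y|, |z| <= P (length P + 1), 2 a bound on the length of
   the input of the verifier, 3 the time T, 4 the number of cells; then the loop
   variables l = |y| (5), lz = |z| (6), and two more (7, 8). *)
Definition params (c k c2 k2 : nat) : list (gen unit) :=
  [GSeq (gpoly c k 0) (GOne tt);
   gseqs [grep 2 (nest 0 1); grep 4 (nest 1 1); grep 6 (GOne tt)];
   GSeq (grep 2 (gpoly c2 k2 2)) (grep 4 (GOne tt));
   GSeq (grep 2 (nest 3 1)) (grep 4 (GOne tt))].

(** The length of a name shows its role: 0 the dummy variable, 1 chain nodes, 2 bits of y, 3 bits of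
    z, 5 tableau cells, which list l, lz, time, position and content. *)
Definition tcell (t j : nexp) (d : nat) : list nexp := [%5; %6; t; j; !d].

Definition row_items (j : nexp) (s : nat + list nexp) : gen titem :=
  glist (cell_items (tcell !0 j) [] s).

Definition tr := scode (Some true).
Definition fl := scode (Some false).

(** Follows [row] zone by zone. An index adds up the lengths of the zones to its left; levels are
    listed twice because an encoded bit takes two cells. *)
Definition row_gen (M : TM) : gen titem :=
  gseqs
    [gfor 3 (row_items %7 (inl (scode None)));
     row_items %3 (inl (ccode (None, Some (nst M))));
     GFor 0 (GSeq (row_items (nx 1 [3; 7; 7]) (inl tr)) (row_items (nx 2 [3; 7; 7]) (inl fl)))
            (GSeq (row_items (nx 1 [3; 7; 7]) (inl tr)) (row_items (nx 2 [3; 7; 7]) (inl tr)));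
     row_items (nx 1 [3; 0; 0]) (inl fl);
     row_items (nx 2 [3; 0; 0]) (inl fl);
     gfor 5 (GSeq (row_items (nx 3 [3; 0; 0; 7; 7]) (inl tr))
                  (row_items (nx 4 [3; 0; 0; 7; 7]) (inr [%5; %7])));
     row_items (nx 3 [3; 0; 0; 5; 5]) (inl fl);
     row_items (nx 4 [3; 0; 0; 5; 5]) (inl fl);
     gfor 6 (GSeq (row_items (nx 5 [3; 0; 0; 5; 5; 7; 7]) (inl tr))
                  (row_items (nx 6 [3; 0; 0; 5; 5; 7; 7]) (inr [%5; %6; %7])));
     row_items (nx 5 [3; 0; 0; 5; 5; 6; 6]) (inl fl);
     row_items (nx 6 [3; 0; 0; 5; 5; 6; 6]) (inl fl);
     gfor 3 (row_items (nx 7 [3; 0; 0; 5; 5; 6; 6; 7]) (inl (scode None)))].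

(** The case distinction over contents depends on [M] alone and is written out in full; loops are
    left for lengths, times and positions. *)
Definition gate_list (M : TM) : list titem :=
  flat_map (fun a => flat_map (fun b => map (fun c =>
      Gate (tcell (nx 1 [7]) (nx 1 [8]) (ccode (nextc (xdelta M) (xhalt M) a b c)))
           (tcell %7 %8 (ccode a)) (tcell %7 (nx 1 [8]) (ccode b)) (tcell %7 (nx 2 [8]) (ccode c)))
    (conts M)) (conts M)) (conts M) ++
  (* Gates have three inputs, so the next chain node is listed twice. *)
  map (fun a => Gate [%5] (tcell (nx 1 [7]) (nx 1 [8]) (ccode a)) [nx 1 [5]] [nx 1 [5]])
    (filter (acc_content M) (conts M)).

Definition circuit_gen (M : TM) : gen titem :=
  GSeq (glist [Lit [%1] [] false; Lit [%1] [] true])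
    (gfor 1 (GSeq (gfor 5 (GOne (Univ [%5; %6])))
                  (gfor 1 (GSeq (row_gen M) (gfor 3 (gfor 4 (glist (gate_list M)))))))).

Definition xpairs (x : list bool) : list src :=
  mapi (fun b _ => [SConst tr; SConst (scode (Some b))]) 0 x.

Definition vpairs (k : nat) (u : nat -> node) : list src :=
  mapi (fun _ i => [SConst tr; SBit (u i)]) 0 (repeat true k).

Definition blanks (T : nat) : list src := mapi (fun _ _ => [SConst (scode None)]) 0 (repeat true T).

(** Index [j] stands for tape position [j - T - 1]: the start state sits at -1 and the encoded
    triple begins at 0, with [T] blanks on either side. *)
Definition row (M : TM) (x : list bool) (T l lz : nat) : list src :=
  blanks T ++ [SConst (ccode (None, Some (nst M)))] ++
  xpairs x ++ [SConst fl] ++ [SConst fl] ++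
  vpairs l (fun i => [l; i]) ++ [SConst fl] ++ [SConst fl] ++
  vpairs lz (fun i => [l; lz; i]) ++ [SConst fl] ++ [SConst fl] ++
  blanks T.

(** Specification of the printed circuit without loop variables; its correctness is proved from this
    description only. *)
Inductive circuit_item (M : TM) (x : list bool) (P T W : nat) : item -> Prop :=
| ci_end b : circuit_item M x P T W (Lit [S P] [] b)
| ci_univ l i : l <= P -> i < l -> circuit_item M x P T W (Univ [l; i])
| ci_row l lz it : l <= P -> lz <= P -> row_in l lz 0 (row M x T l lz) it ->
    circuit_item M x P T W it
| ci_step l lz t j a b c : l <= P -> lz <= P -> t < T -> j < W ->
    In a (conts M) -> In b (conts M) -> In c (conts M) ->
    circuit_item M x P T W
      (Gate [l; lz; S t; S j; ccode (nextc (xdelta M) (xhalt M) a b c)]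
            [l; lz; t; j; ccode a] [l; lz; t; S j; ccode b] [l; lz; t; S (S j); ccode c])
| ci_acc l lz t j a : l <= P -> lz <= P -> t < T -> j < W ->
    In a (conts M) -> acc_content M a = true ->
    circuit_item M x P T W (Gate [l] [l; lz; S t; S j; ccode a] [S l] [S l]).

Lemma nth_repeat_iff k n : (exists b, nth_error (repeat true n) k = Some b) <-> k < n.
Proof.
  split.
  - intros [b H]. rewrite <- (repeat_length true n). apply nth_error_Some. congruence.
  - intros H. exists true. apply nth_error_repeat. auto.
Qed.

Lemma nexp_val_var e v : nexp_val e (%v) = length (e v).
Proof. apply Nat.add_0_r. Qed.

Lemma nexp_val_const e k : nexp_val e (!k) = k.
Proof. apply Nat.add_0_r. Qed.

Lemma tcell_val e t j d : map (nexp_val e) (tcell t j d) =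
  [length (e 5); length (e 6); nexp_val e t; nexp_val e j; d].
Proof. unfold tcell. cbn [map]. rewrite !nexp_val_var, nexp_val_const. reflexivity. Qed.

Lemma in_row_items d e l lz j s ss : length (e 5) = l -> length (e 6) = lz ->
  match s, ss with
  | inl c, SConst c' => c = c'
  | inr u, SBit u' => map (nexp_val e) u = u'
  | _, _ => False
  end ->
  forall it, In it (dens inst d (row_items j s) e) <-> In it (src_items l lz (nexp_val e j) ss).
Proof.
  intros Hl Hlz Hs it. unfold row_items. rewrite dens_glist. unfold src_items.
  destruct s as [c|u], ss as [c'|u']; try tauto; subst;
    cbn [cell_items map src_sum]; unfold inst; cbn [gitem_map];
    rewrite !tcell_val, !nexp_val_const; reflexivity.
Qed.

Lemma or_iff (A B C D : Prop) : (A <-> B) -> (C <-> D) -> (A \/ C <-> B \/ D).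
Proof. tauto. Qed.

Lemma or_False_iff (A B : Prop) : (A <-> B) -> (A \/ False <-> B).
Proof. tauto. Qed.

Lemma gfor_zone {A B} (I : A -> regs -> B) d v g e x (Q : nat -> Prop) :
  (forall k, k < length (e v) -> In x (dens I (S d) g (upd e d (repeat true k))) <-> Q k) ->
  (In x (dens I d (gfor v g) e) <->
   exists k b, nth_error (repeat true (length (e v))) k = Some b /\ Q k).
Proof.
  intros H. rewrite in_gfor. split.
  - intros (k & H1 & H2). destruct (proj2 (nth_repeat_iff k (length (e v))) H1) as [b Hb].
    exists k, b. split; auto. apply H; auto.
  - intros (k & b & H1 & H2). assert (Hk : k < length (e v)) by (apply nth_repeat_iff; eauto).
    exists k. split; auto. apply H; auto.
Qed.

Ltac nexp_solve :=
  unfold nexp_val; cbn [nx fst snd map list_sum fold_right upd Nat.eqb];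
  rewrite ?repeat_length; lia.

Ltac row_item s :=
  etransitivity; [refine (in_row_items _ _ _ _ _ _ s _ _ _ _);
    first [reflexivity|cbn [map]; rewrite !nexp_val_var; unfold upd; cbn [Nat.eqb];
                       rewrite repeat_length; reflexivity]|];
  match goal with |- In _ (src_items _ _ ?a _) <-> In _ (src_items _ _ ?b _) =>
    replace a with b by nexp_solve; reflexivity end.

Ltac pair_zone s1 s2 :=
  rewrite row_in_two; cbn [dens]; rewrite in_app_iff;
  apply or_iff; [row_item s1|row_item s2].

Lemma in_row_gen M e l lz it :
  length (e 5) = l -> length (e 6) = lz ->
  In it (dens inst 7 (row_gen M) e) <->
  row_in l lz 0 (row M (e 0) (length (e 3)) l lz) it.
Proof.
  intros <- <-. set (l := length (e 5)). set (lz := length (e 6)). unfold row_gen. rewrite in_gseqs.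
  unfold row. rewrite !row_in_app, !row_in_one.
  unfold blanks, xpairs, vpairs.
  rewrite !(row_in_mapi l lz (fun _ _ => [SConst (scode None)]) 1) by reflexivity.
  rewrite (row_in_mapi l lz (fun b _ => [SConst tr; SConst (scode (Some b))]) 2) by reflexivity.
  rewrite (row_in_mapi l lz (fun _ i => [SConst tr; SBit [l; i]]) 2) by reflexivity.
  rewrite (row_in_mapi l lz (fun _ i => [SConst tr; SBit [l; lz; i]]) 2) by reflexivity.
  rewrite !(mapi_length _ 1), !(mapi_length _ 2), !repeat_length by reflexivity.
  cbn [length]. set (X := length (e 0)).
  repeat rewrite Exists_cons. rewrite Exists_nil.
  repeat match goal with |- (_ \/ _) <-> (_ \/ _) => apply or_iff end.
  - apply gfor_zone. intros k Hk. rewrite row_in_one. row_item (SConst (scode None)).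
  - row_item (SConst (ccode (None, Some (nst M)))).
  - cbn [dens]. rewrite in_for_loop. fold X.
    assert (Hz : forall k (b : bool), In it (if b
        then dens inst 8 (GSeq (row_items (nx 1 [3; 7; 7]) (inl tr)) (row_items (nx 2 [3; 7; 7]) (inl tr)))
               (upd e 7 (repeat true k))
        else dens inst 8 (GSeq (row_items (nx 1 [3; 7; 7]) (inl tr)) (row_items (nx 2 [3; 7; 7]) (inl fl)))
               (upd e 7 (repeat true k))) <->
       row_in l lz (0 + 1 * length (e 3) + 1 + 2 * k) [SConst tr; SConst (scode (Some b))] it).
    { intros k b. destruct b; [pair_zone (SConst tr) (SConst tr)|pair_zone (SConst tr) (SConst fl)]. }
    split; intros (k & b & H1 & H2); exists k, b; (split; [exact H1|]); apply Hz; exact H2.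
  - row_item (SConst fl).
  - row_item (SConst fl).
  - apply gfor_zone. intros k Hk. pair_zone (SConst tr) (SBit [l; k]).
  - row_item (SConst fl).
  - row_item (SConst fl).
  - apply gfor_zone. intros k Hk. pair_zone (SConst tr) (SBit [l; lz; k]).
  - row_item (SConst fl).
  - row_item (SConst fl).
  - apply or_False_iff, gfor_zone. intros k Hk. rewrite row_in_one. row_item (SConst (scode None)).
Qed.

Definition circuit (M : TM) (e : regs) : list item := dens inst 5 (circuit_gen M) e.

Lemma in_gate_list M e l lz t j it : length (e 5) = l -> length (e 6) = lz ->
  length (e 7) = t -> length (e 8) = j ->
  In it (map (fun a => inst a e) (gate_list M)) <->
  (exists a b c, In a (conts M) /\ In b (conts M) /\ In c (conts M) /\
     it = Gate [l; lz; S t; S j; ccode (nextc (xdelta M) (xhalt M) a b c)]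
            [l; lz; t; j; ccode a] [l; lz; t; S j; ccode b] [l; lz; t; S (S j); ccode c]) \/
  (exists a, In a (conts M) /\ acc_content M a = true /\
     it = Gate [l] [l; lz; S t; S j; ccode a] [S l] [S l]).
Proof.
  intros Hl Hlz Ht Hj.
  assert (Hnx : forall k v, nexp_val e (nx k [v]) = k + length (e v)).
  { intros k v. unfold nexp_val. simpl. lia. }
  unfold gate_list. rewrite map_app, in_app_iff. apply or_iff.
  - rewrite in_map_iff. split.
    + intros (g & <- & Hg). rewrite in_flat_map in Hg. destruct Hg as (a & Ha & Hg).
      rewrite in_flat_map in Hg. destruct Hg as (b & Hb & Hg).
      rewrite in_map_iff in Hg. destruct Hg as (c & <- & Hc).
      exists a, b, c. repeat (split; [assumption|]).
      unfold inst. cbn [gitem_map]. rewrite !tcell_val, !Hnx, Hl, Hlz, Ht, Hj. reflexivity.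
    + intros (a & b & c & Ha & Hb & Hc & ->). eexists. split.
      2:{ rewrite in_flat_map. exists a. split; [exact Ha|]. rewrite in_flat_map. exists b.
          split; [exact Hb|]. rewrite in_map_iff. exists c. split; [reflexivity|exact Hc]. }
      unfold inst. cbn [gitem_map]. rewrite !tcell_val, !Hnx, Hl, Hlz, Ht, Hj. reflexivity.
  - rewrite map_map, in_map_iff. split.
    + intros (a & <- & Ha). apply filter_In in Ha. exists a. split; [tauto|]. split; [tauto|].
      unfold inst. cbn [gitem_map]. cbn [map]. fold (tcell (nx 1 [7]) (nx 1 [8]) (ccode a)).
      rewrite !tcell_val, !Hnx, Hl, Hlz, Ht, Hj. reflexivity.
    + intros (a & Ha & Hacc & ->). exists a. split; [|apply filter_In; auto].
      unfold inst. cbn [gitem_map]. cbn [map]. fold (tcell (nx 1 [7]) (nx 1 [8]) (ccode a)).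
      rewrite !tcell_val, !Hnx, Hl, Hlz, Ht, Hj. reflexivity.
Qed.

Lemma in_circuit M e P it : length (e 1) = S P ->
  In it (circuit M e) <-> circuit_item M (e 0) P (length (e 3)) (length (e 4)) it.
Proof.
  intros HP. revert it.
  set (e5 := fun l => upd e 5 (repeat true l)).
  set (e6 := fun l lz => upd (e5 l) 6 (repeat true lz)).
  assert (Hbody : forall it l, In it (dens inst 6 (GSeq (gfor 5 (GOne (Univ [%5; %6])))
        (gfor 1 (GSeq (row_gen M) (gfor 3 (gfor 4 (glist (gate_list M))))))) (e5 l)) <->
     (exists i, i < l /\ it = Univ [l; i]) \/
     (exists lz, lz < S P /\ (row_in l lz 0 (row M (e 0) (length (e 3)) l lz) it \/
        exists t, t < length (e 3) /\ exists j, j < length (e 4) /\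
        In it (map (fun a => inst a (upd (upd (e6 l lz) 7 (repeat true t)) 8 (repeat true j)))
                  (gate_list M))))).
  { intros it l. cbn [dens]. rewrite in_app_iff. rewrite !in_gfor. apply or_iff.
    - unfold e5 at 1. cbn [upd Nat.eqb]. rewrite repeat_length. cbn [dens In].
      unfold inst. cbn [gitem_map map]. setoid_rewrite nexp_val_var. unfold e5, upd. cbn [Nat.eqb].
      split.
      + intros (k & H1 & [H2|[]]). rewrite !repeat_length in H2. exists k. auto.
      + intros (k & H1 & H2). exists k. rewrite !repeat_length. auto.
    - change (length (e5 l 1)) with (length (e 1)). rewrite HP.
      split; intros (lz & H1 & H2); exists lz; (split; [exact H1|]).
      + cbn [dens] in H2. rewrite in_app_iff in H2. destruct H2 as [H2|H2]; [left|right].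
        * apply in_row_gen with (l := l) (lz := lz) in H2; [exact H2|apply repeat_length|apply repeat_length].
        * rewrite in_gfor in H2. destruct H2 as (t & Ht & H2). exists t. split; [exact Ht|].
          rewrite in_gfor in H2. destruct H2 as (j & Hj & H2). exists j. split; [exact Hj|].
          rewrite dens_glist in H2. exact H2.
      + cbn [dens]. rewrite in_app_iff. destruct H2 as [H2|H2]; [left|right].
        * apply in_row_gen with (l := l) (lz := lz); [apply repeat_length|apply repeat_length|exact H2].
        * destruct H2 as (t & Ht & j & Hj & H2). rewrite in_gfor. exists t. split; [exact Ht|].
          rewrite in_gfor. exists j. split; [exact Hj|]. rewrite dens_glist. exact H2. }
  assert (Hg : forall l lz t j it, In it (map (fun a => inst a
      (upd (upd (e6 l lz) 7 (repeat true t)) 8 (repeat true j))) (gate_list M)) <-> _)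
    by (intros l lz t j it'; apply (in_gate_list M _ l lz t j); apply repeat_length).
  intros it. unfold circuit, circuit_gen.
  cbn [dens]. rewrite in_app_iff. rewrite in_gfor, dens_glist. cbn [map In].
  unfold inst at 1 2. cbn [gitem_map map]. rewrite nexp_val_var, HP.
  split.
  - intros [[H|[H|[]]]|(l & Hl & H)]; [subst; constructor..|].
    apply Hbody in H. destruct H as [(i & Hi & ->)|(lz & Hlz & [H|(t & Ht & j & Hj & H)])].
    + constructor; lia.
    + apply ci_row with l lz; auto; lia.
    + apply Hg in H. destruct H as [(a & b & c & Ha & Hb & Hc & ->)|(a & Ha & Hacc & ->)];
        constructor; auto; lia.
  - intros [b|l i Hl Hi|l lz it' Hl Hlz H|l lz t j a b c Hl Hlz Ht Hj Ha Hb Hc|l lz t j a Hl Hlz Ht Hj Ha Hacc].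
    + left. destruct b; auto.
    + right. exists l. split; [lia|]. apply Hbody. left. eauto.
    + right. exists l. split; [lia|]. apply Hbody. right. exists lz. split; [lia|]. left; auto.
    + right. exists l. split; [lia|]. apply Hbody. right. exists lz. split; [lia|]. right.
      exists t. split; auto. exists j. split; auto. apply Hg. left. exists a, b, c. auto.
    + right. exists l. split; [lia|]. apply Hbody. right. exists lz. split; [lia|]. right.
      exists t. split; auto. exists j. split; auto. apply Hg. right. exists a. auto.
Qed.

(** [m] exceeds [2 * n + 2 * l + 2 * lz + 6], the length of the encoded triple. Doubling the time
    bound of the verifier and taking [2 * T + 4] cells meets the demands of [node_complete]. *)
Lemma params_length c k c2 k2 x :
  let e := penv 1 (params c k c2 k2) (input_env x) in
  let n := length x in
  let P := poly c k n in
  let m := 2 * n + 4 * S P + 6 in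
  e 0 = x /\ length (e 1) = S P /\
  length (e 3) = 2 * poly c2 k2 m + 4 /\ length (e 4) = 2 * length (e 3) + 4.
Proof.
  intros e n P m. unfold e, params. cbn [penv].
  set (e0 := input_env x). set (w1 := unary_out 1 _ e0). set (e1 := upd e0 1 w1).
  set (w2 := unary_out 2 _ e1). set (e2 := upd e1 2 w2).
  set (w3 := unary_out 3 _ e2). set (e3 := upd e2 3 w3).
  set (w4 := unary_out 4 _ e3). set (e4 := upd e3 4 w4).
  assert (H1 : length w1 = S P).
  { unfold w1. rewrite unary_out_seq, length_app, gpoly_length, one_length by lia.
    unfold P, n. change (e0 0) with x. lia. }
  assert (H2 : length w2 = m).
  { unfold w2, gseqs. cbn [fold_right]. rewrite !unary_out_seq, !length_app.
    rewrite !grep_length, !nest_length, one_length by lia.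
    change (e1 0) with x. change (e1 1) with w1. rewrite H1. unfold m, n. cbn. lia. }
  assert (H3 : length w3 = 2 * poly c2 k2 m + 4).
  { unfold w3. rewrite unary_out_seq, length_app, !grep_length, gpoly_length, one_length by lia.
    change (e2 2) with w2. rewrite H2. lia. }
  assert (H4 : length w4 = 2 * length w3 + 4).
  { unfold w4. rewrite unary_out_seq, length_app, !grep_length, nest_length, one_length by lia.
    change (e3 3) with w3. cbn. lia. }
  split; [reflexivity|]. split; [exact H1|]. split; [exact H3|exact H4].
Qed.

(** * Scoping of the loop variables *)

Lemma fact_pieces_wf d name args : Forall (Forall (piece_wf d)) args ->
  Forall (piece_wf d) (fact_pieces name args).
Proof.
  intros H. constructor; [exact I|]. apply Forall_app. split; [|repeat constructor].
  induction H; cbn [flat_map]; [constructor|]. constructor; [exact I|]. apply Forall_app; auto.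
Qed.

Definition nodes_wf (d : nat) (n : list nexp) : Prop :=
  Forall (fun x => Forall (fun v => v < d) (snd x)) n.

Definition item_wf (d : nat) (t : titem) : Prop :=
  match t with
  | Gate v a b c => nodes_wf d v /\ nodes_wf d a /\ nodes_wf d b /\ nodes_wf d c
  | Lit v u _ => nodes_wf d v /\ nodes_wf d u
  | Univ u => nodes_wf d u
  end.

Lemma node_pieces_wf d n : nodes_wf d n -> Forall (piece_wf d) (node_pieces n).
Proof.
  intros H. apply Forall_app. split; [|repeat constructor].
  induction H as [|x n Hx _ IH]; cbn [flat_map]; [constructor|]. apply Forall_app. split; auto.
  constructor; [exact I|]. apply Forall_app. split; [|repeat constructor].
  apply Forall_map. exact Hx.
Qed.

Lemma item_pieces_wf d t : item_wf d t -> Forall (piece_wf d) (item_pieces t).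
Proof.
  assert (Hc : forall c, Forall (piece_wf d) (const_pieces c)) by (repeat constructor).
  pose proof (node_pieces_wf d) as Hn.
  destruct t; cbn [item_wf item_pieces]; intros H;
    repeat (apply Forall_app; split); apply fact_pieces_wf; repeat constructor; auto; apply Hn, H.
Qed.

Lemma glist_wf {A} (ap : A -> list piece) d l :
  Forall (fun a => Forall (piece_wf d) (ap a)) l -> gwf ap d (glist l).
Proof. induction 1; simpl; auto. Qed.

Lemma gseqs_wf {A} (ap : A -> list piece) d l : Forall (gwf ap d) l -> gwf ap d (gseqs l).
Proof. induction 1; simpl; auto. Qed.

Lemma gfor_wf {A} (ap : A -> list piece) d v g : v < d -> gwf ap (S d) g -> gwf ap d (gfor v g).
Proof. simpl. auto. Qed.

Lemma row_items_wf d j s : 6 < d -> Forall (fun v => v < d) (snd j) ->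
  match s with inl _ => True | inr u => nodes_wf d u end ->
  gwf item_pieces d (row_items j s).
Proof.
  intros Hd Hj Hs. apply glist_wf.
  assert (Hc : forall c, nodes_wf d (tcell !0 j c)).
  { intros c. repeat first [apply Forall_cons | apply Forall_nil]; auto; repeat constructor; lia. }
  destruct s as [c|u]; cbn [cell_items];
    (apply Forall_cons; [|apply Forall_cons; [|apply Forall_nil]]);
    apply item_pieces_wf; (split; [apply Hc|first [exact Hs|apply Forall_nil]]).
Qed.

Lemma circuit_gen_wf M : gwf item_pieces 5 (circuit_gen M).
Proof.
  split.
  { apply glist_wf. repeat constructor; apply item_pieces_wf; cbn; repeat constructor. }
  assert (Hg : gwf item_pieces 9 (glist (gate_list M))).
  { apply glist_wf, Forall_forall. intros t Ht. apply item_pieces_wf.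
    unfold gate_list in Ht. rewrite in_app_iff in Ht. destruct Ht as [Ht|Ht].
    - rewrite in_flat_map in Ht. destruct Ht as (a & _ & Ht). rewrite in_flat_map in Ht.
      destruct Ht as (b & _ & Ht). rewrite in_map_iff in Ht. destruct Ht as (c & <- & _).
      cbn [item_wf]. repeat split; unfold nodes_wf, tcell; repeat (constructor; cbn; try lia).
    - rewrite in_map_iff in Ht. destruct Ht as (a & <- & _).
      cbn [item_wf]. repeat split; unfold nodes_wf, tcell; repeat (constructor; cbn; try lia). }
  assert (Hr : gwf item_pieces 7 (row_gen M)).
  { apply gseqs_wf. repeat (apply Forall_cons || apply Forall_nil);
      repeat match goal with
      | |- gwf _ _ (gfor _ _) => apply gfor_wf; [lia|]
      | |- gwf _ _ (GSeq _ _) => split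
      | |- gwf _ _ (GFor _ _ _) => split; [lia|split]
      end;
      (apply row_items_wf; [lia|repeat (constructor; cbn; try lia)|]);
      try exact I; unfold nodes_wf; repeat (constructor; cbn; try lia). }
  assert (Hu : Forall (piece_wf 7) (item_pieces (Univ [%5; %6]))).
  { apply item_pieces_wf. cbn. repeat (constructor; cbn; try lia). }
  repeat match goal with
  | |- gwf _ _ (gfor _ _) => apply gfor_wf; [lia|]
  | |- gwf _ _ (GSeq _ _) => split
  end; assumption.
Qed.

Lemma params_wf M c k c2 k2 : pwf item_pieces 1 (params c k c2 k2) (circuit_gen M).
Proof.
  assert (H1 : forall d, uwf d (GOne tt)) by (repeat constructor).
  cbn [pwf params]. split; [|split; [|split; [|split]]].
  - split; [apply gpoly_wf; lia|apply H1].
  - apply gseqs_wf. repeat (apply Forall_cons || apply Forall_nil); apply grep_wf;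
      try apply nest_wf; try apply H1; lia.
  - split; apply grep_wf; [apply gpoly_wf; lia|apply H1].
  - split; apply grep_wf; [apply nest_wf; lia|apply H1].
  - apply circuit_gen_wf.
Qed.

Lemma circuit_output M e :
  concat (dens (fun t e => pieces_bits (item_pieces t) e) 5 (circuit_gen M) e) ++ [false] =
  enc_db (items_db (circuit M e)).
Proof.
  unfold enc_db, enc_list, items_db, circuit. f_equal.
  set (h := fun it => flat_map (fun f => true :: enc_fact f) (item_facts it)).
  assert (E : (fun t e => pieces_bits (item_pieces t) e) = (fun t e => h (inst t e))).
  { extensionality t. extensionality e'. apply item_bits. }
  rewrite E, dens_map. generalize (dens inst 5 (circuit_gen M) e). intros l.
  induction l as [|it l IH]; auto. cbn [map concat flat_map]. rewrite IH, flat_map_app. reflexivity.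
Qed.

(** * Correctness of the reduction *)

Definition sb (b : bool) : nat := scode (Some b).

Definition choice_word (g : node -> bool) (u : nat -> node) (k : nat) : list bool :=
  map (fun i => g (u i)) (seq 0 k).

Definition input_word (g : node -> bool) (x : list bool) (l lz : nat) : list bool :=
  enc_triple x (choice_word g (fun i => [l; i]) l) (choice_word g (fun i => [l; lz; i]) lz).

Lemma xpairs_val g x k : map (src_val g) (mapi (fun b _ => [SConst tr; SConst (scode (Some b))]) k x)
  = map sb (enc_pairs x).
Proof. revert k; induction x as [|b x IH]; intros k; simpl; auto. rewrite IH. reflexivity. Qed.

Lemma vpairs_val g u n : forall k,
  map (src_val g) (mapi (fun _ i => [SConst tr; SBit (u i)]) k (repeat true n))
  = map sb (enc_pairs (map (fun i => g (u i)) (seq k n))).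
Proof. induction n as [|n IH]; intros k; simpl; auto. rewrite IH. reflexivity. Qed.

Lemma blanks_val g T : map (src_val g) (blanks T) = repeat 0 T.
Proof.
  unfold blanks. generalize 0 at 1. induction T as [|T IH]; intros k; simpl; auto. rewrite IH. reflexivity.
Qed.

Lemma row_val g M x T l lz : map (src_val g) (row M x T l lz) =
  repeat 0 T ++ ccode (None, Some (nst M)) :: map sb (input_word g x l lz) ++ repeat 0 T.
Proof.
  unfold row, xpairs, vpairs. rewrite !map_app, !blanks_val, xpairs_val, !vpairs_val.
  unfold input_word, choice_word, enc_triple, enc_bits.
  fold (enc_pairs x). 
  change (flat_map (fun b => [true; b])) with enc_pairs.
  rewrite !map_app, <- !app_assoc. reflexivity.
Qed.

(** The default 0 of [nth] is the code of a blank cell without head, so the equation also holds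
    beyond the end of the row. *)
Lemma cont_start M w T j :
  ccode (cont (xstart M w) (Z.of_nat j - Z.of_nat T - 1)) =
  nth j (repeat 0 T ++ ccode (None, Some (nst M)) :: map sb w ++ repeat 0 T) 0.
Proof.
  unfold cont, xstart; cbn [atp apos aq].
  destruct (Nat.lt_trichotomy j T) as [Hj|[->|Hj]].
  - rewrite (proj2 (Z.leb_gt _ _)), (proj2 (Z.eqb_neq _ _)) by lia.
    rewrite app_nth1 by (rewrite repeat_length; auto). rewrite nth_repeat. reflexivity.
  - rewrite (proj2 (Z.leb_gt _ _)), (proj2 (Z.eqb_eq _ _)) by lia.
    rewrite app_nth2 by (rewrite repeat_length; auto). rewrite repeat_length, Nat.sub_diag. reflexivity.
  - rewrite (proj2 (Z.leb_le _ _)), (proj2 (Z.eqb_neq _ _)) by lia.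
    rewrite app_nth2 by (rewrite repeat_length; lia). rewrite repeat_length.
    replace (j - T) with (S (j - T - 1)) by lia. cbn [nth].
    replace (Z.to_nat _) with (j - T - 1) by lia. set (i := j - T - 1).
    destruct (Nat.lt_ge_cases i (length w)) as [Hi|Hi].
    + rewrite app_nth1 by (rewrite length_map; auto).
      rewrite nth_indep with (d' := Some false) by (rewrite length_map; auto).
      rewrite (nth_indep (map sb w)) with (d' := sb false) by (rewrite length_map; auto).
      rewrite !map_nth. unfold ccode, sb. cbn [fst snd]. lia.
    + rewrite app_nth2 by (rewrite length_map; auto). rewrite nth_repeat.
      rewrite nth_overflow by (rewrite length_map; auto). reflexivity.
Qed.

Lemma src_items_lit l lz j s g v u : In (Lit v u (g u)) (src_items l lz j s) ->
  v = [l; lz; 0; j; src_val g s].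
Proof.
  destruct s as [d|w]; unfold src_items; simpl; intros [H|[H|[]]].
  - injection H; intros; subst; reflexivity.
  - injection H; intros; subst; reflexivity.
  - injection H as <- <- E. rewrite <- E. reflexivity.
  - injection H as <- <- E. rewrite <- E. reflexivity.
Qed.

Lemma src_items_gate l lz j s v a b c : ~ In (Gate v a b c) (src_items l lz j s).
Proof. destruct s; simpl; intros [H|[H|[]]]; discriminate. Qed.

Lemma src_items_univ l lz j s u : ~ In (Univ u) (src_items l lz j s).
Proof. destruct s; simpl; intros [H|[H|[]]]; discriminate. Qed.

Lemma src_items_self l lz j s g : exists u, In (Lit [l; lz; 0; j; src_val g s] u (g u)) (src_items l lz j s).
Proof.
  destruct s as [d|w]; unfold src_items; simpl.
  - exists []. destruct (g []); auto.
  - exists w. destruct (g w); auto.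
Qed.

(** * What the circuit derives *)

Section Circuit.

Context (M : TM) (x : list bool) (P T W : nat) (I : list item) (g : node -> bool).
Context (HI : forall it, In it I <-> circuit_item M x P T W it).

Let start l lz := xstart M (input_word g x l lz).

Lemma gate_inv v a b c : In (Gate v a b c) I ->
  (exists l lz t j ca cb cc, l <= P /\ lz <= P /\ t < T /\
     v = [l; lz; S t; S j; ccode (nextc (xdelta M) (xhalt M) ca cb cc)] /\
     a = [l; lz; t; j; ccode ca] /\ b = [l; lz; t; S j; ccode cb] /\
     c = [l; lz; t; S (S j); ccode cc]) \/
  (exists l lz t j ca, l <= P /\ lz <= P /\ t < T /\ acc_content M ca = true /\
     v = [l] /\ a = [l; lz; S t; S j; ccode ca] /\ b = [S l] /\ c = [S l]).
Proof.
  intros H. apply HI in H. remember (Gate v a b c) as it eqn:E.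
  destruct H as [b'|l i Hl Hi|l lz it' Hl Hlz (j & s & _ & H)|l lz t j ca cb cc Hl Hlz Ht Hj Ha Hb Hc
                |l lz t j ca Hl Hlz Ht Hj Ha Hacc]; try discriminate.
  - subst. destruct (src_items_gate _ _ _ _ _ _ _ _ H).
  - injection E as <- <- <- <-. left. exists l, lz, t, j, ca, cb, cc. repeat split; auto.
  - injection E as <- <- <- <-. right. exists l, lz, t, j, ca. repeat split; auto.
Qed.

Lemma lit_inv v u : In (Lit v u (g u)) I -> v = [S P] \/
  exists l lz j s, nth_error (row M x T l lz) j = Some s /\ v = [l; lz; 0; j; src_val g s].
Proof.
  intros H. apply HI in H. remember (Lit v u (g u)) as it eqn:E.
  destruct H as [b'|l i Hl Hi|l lz it' Hl Hlz (j & s & Hs & H)|l lz t j ca cb cc Hl Hlz Ht Hj Ha Hb Hc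
                |l lz t j ca Hl Hlz Ht Hj Ha Hacc]; try discriminate.
  - injection E; intros; subst; auto.
  - subst. apply src_items_lit in H. right. eauto 10.
Qed.

(** A derived cell comes from three derived cells of the previous row; their contents are right by
    induction, and injectivity of [ccode] makes them the arguments of [nextc]. *)
Lemma cell_sound l lz t : forall j d, Der I g [l; lz; t; j; d] ->
  d = ccode (cont (xrun M t (start l lz)) (Z.of_nat j - Z.of_nat T - 1)).
Proof.
  induction t as [|t IH]; intros j d H; remember [l; lz; _; j; d] as v eqn:E;
    destruct H as [v a b c Hg Ha Hb Hc|v u Hu].
  - apply gate_inv in Hg.
    destruct Hg as [(l' & lz' & t' & j' & ca & cb & cc & _ & _ & _ & -> & _)
                   |(l' & lz' & t' & j' & ca & _ & _ & _ & _ & -> & _)]; discriminate.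
  - apply lit_inv in Hu. destruct Hu as [->|(l' & lz' & j' & s & Hs & ->)]; [discriminate|].
    injection E as -> -> -> <-. cbn [arun]. unfold start. rewrite cont_start, <- row_val.
    symmetry. apply nth_error_nth. rewrite nth_error_map, Hs. reflexivity.
  - apply gate_inv in Hg.
    destruct Hg as [(l' & lz' & t' & j' & ca & cb & cc & _ & _ & _ & -> & -> & -> & ->)
                   |(l' & lz' & t' & j' & ca & _ & _ & _ & _ & -> & _)]; [|discriminate].
    injection E as -> -> -> <- <-.
    apply IH, ccode_inj in Ha. apply IH, ccode_inj in Hb. apply IH, ccode_inj in Hc.
    subst. rewrite arun_S, cont_step. do 3 f_equal; lia.
  - apply lit_inv in Hu. destruct Hu as [->|(l' & lz' & j' & s & Hs & ->)]; discriminate.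
Qed.

Lemma node_sound l : l <= P -> Der I g [l] ->
  Der I g [S l] /\ exists lz t, lz <= P /\ xacc M (aq (xrun M t (start l lz))) = true.
Proof.
  intros Hl H. remember [l] as v eqn:E. destruct H as [v a b c Hg Ha Hb Hc|v u Hu].
  - apply gate_inv in Hg.
    destruct Hg as [(l' & lz' & t' & j' & ca & cb & cc & _ & _ & _ & -> & _)
                   |(l' & lz' & t' & j' & ca & _ & Hlz & _ & Hacc & -> & -> & -> & ->)];
      [discriminate|].
    injection E as ->. split; auto. exists lz', (S t'). split; auto.
    apply cell_sound, ccode_inj in Ha. subst ca. unfold acc_content, cont in Hacc. cbn [snd] in Hacc.
    destruct (Z.of_nat (S j') - Z.of_nat T - 1 =? _)%Z; [exact Hacc|discriminate].
  (* The only chain node justified by literals is [[S P]], outside the range of [l]. *)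
  - apply lit_inv in Hu. destruct Hu as [->|(l' & lz' & j' & s & Hs & ->)]; [|discriminate].
    injection E as E. lia.
Qed.

Lemma nodes_sound l : l <= P -> Der I g [0] -> Der I g [l].
Proof.
  induction l as [|l IH]; intros Hl H0; auto. apply node_sound; [lia|]. apply IH; auto; lia.
Qed.

(** Each step needs neighbours on both sides, so the derivable region loses a cell at either end per
    row; the conditions on [j] describe this cone. *)
Lemma cell_complete l lz : l <= P -> lz <= P -> forall t j, t <= T -> t <= j ->
  j + t < length (row M x T l lz) -> j + t <= W ->
  Der I g [l; lz; t; j; ccode (cont (xrun M t (start l lz)) (Z.of_nat j - Z.of_nat T - 1))].
Proof.
  intros Hl Hlz. induction t as [|t IH]; intros j Ht Hj Hr HW.
  - cbn [arun]. unfold start. rewrite cont_start, <- row_val.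
    destruct (nth_error (row M x T l lz) j) as [s|] eqn:Es.
    2:{ apply nth_error_None in Es. lia. }
    assert (E : nth j (map (src_val g) (row M x T l lz)) 0 = src_val g s).
    { apply nth_error_nth. rewrite nth_error_map, Es. reflexivity. }
    rewrite E. destruct (src_items_self l lz j s g) as [u Hu]. apply Der_lit with u.
    apply HI, ci_row with l lz; auto. exists j, s. auto.
  - destruct j as [|j]; [lia|]. rewrite arun_S, cont_step.
    assert (Hin : forall p, In (cont (xrun M t (start l lz)) p) (conts M)).
    { intros p. apply in_conts, xrun_state. apply le_n. }
    pose proof (IH j ltac:(lia) ltac:(lia) ltac:(lia) ltac:(lia)) as D1.
    pose proof (IH (S j) ltac:(lia) ltac:(lia) ltac:(lia) ltac:(lia)) as D2.
    pose proof (IH (S (S j)) ltac:(lia) ltac:(lia) ltac:(lia) ltac:(lia)) as D3.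
    replace (Z.of_nat (S j) - Z.of_nat T - 1 - 1)%Z with (Z.of_nat j - Z.of_nat T - 1)%Z by lia.
    replace (Z.of_nat (S j) - Z.of_nat T - 1 + 1)%Z with (Z.of_nat (S (S j)) - Z.of_nat T - 1)%Z by lia.
    eapply Der_gate; [|exact D1|exact D2|exact D3]. apply HI. constructor; auto; lia.
Qed.

Lemma row_length l lz : length (row M x T l lz) = 2 * T + 1 + length (input_word g x l lz).
Proof.
  rewrite <- (length_map (src_val g)), row_val, length_app. cbn [length].
  rewrite length_app, length_map, repeat_length. lia.
Qed.

(** At time [t] the head is within [t] of -1, at an index from [T - t] to [T + t]; [2 * t <= T] puts
    this inside the cone of [cell_complete], and [2 * T + 4 <= W] keeps it off the right edge. *)
Lemma node_complete l lz t : l <= P -> lz <= P -> 0 < t -> 2 * t <= T -> 2 * T + 4 <= W ->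
  xacc M (aq (xrun M t (start l lz))) = true -> Der I g [S l] -> Der I g [l].
Proof.
  intros Hl Hlz Ht HT HW Hacc HS. set (a := xrun M t (start l lz)) in *.
  pose proof (arun_pos (xdelta M) (xhalt M) t (start l lz)) as Hp. fold a in Hp.
  cbn [start xstart apos] in Hp.
  set (j := Z.to_nat (apos a + Z.of_nat T + 1)).
  pose proof (cell_complete l lz Hl Hlz t j ltac:(lia) ltac:(lia)
                ltac:(rewrite row_length; lia) ltac:(lia)) as Hc.
  fold a in Hc. replace (Z.of_nat j - Z.of_nat T - 1)%Z with (apos a) in Hc by lia.
  (* An accepting gate reads time [S t] and index [S j]; both are positive here since
     [0 < t <= j]. *)
  destruct t as [|t]; [lia|]. destruct j as [|j'] eqn:Ej; [lia|].
  eapply Der_gate; [|exact Hc|exact HS|exact HS]. apply HI. constructor; auto; try lia.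
  - apply in_conts, xrun_state. apply le_n.
  - unfold acc_content, cont. cbn [snd]. rewrite Z.eqb_refl. exact Hacc.
Qed.

Lemma end_complete : Der I g [S P].
Proof. apply Der_lit with []. apply HI. constructor. Qed.

End Circuit.

(** Cells are ranked by time; chain nodes lie above all cells and rank lower the further they are
    from the root. *)
Definition node_rank (P T : nat) (v : node) : nat :=
  match v with
  | [l] => T + 1 + (P + 1 - l)
  | [_; _; t; _; _] => t
  | _ => 0
  end.

Lemma circuit_ranked M x P T W I : (forall it, In it I <-> circuit_item M x P T W it) ->
  forall v a b c, In (Gate v a b c) I ->
  node_rank P T a < node_rank P T v /\ node_rank P T b < node_rank P T v /\
  node_rank P T c < node_rank P T v.
Proof.
  intros HI v a b c H. apply (gate_inv M x P T W I HI) in H.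
  destruct H as [(l & lz & t & j & ca & cb & cc & Hl & Hlz & Ht & -> & -> & -> & ->)
                |(l & lz & t & j & ca & Hl & Hlz & Ht & _ & -> & -> & -> & ->)];
    cbn [node_rank]; lia.
Qed.

Lemma length_enc_bits x : length (enc_bits x) = 2 * length x + 2.
Proof.
  unfold enc_bits. rewrite length_app. induction x as [|b x IH]; simpl in *; lia.
Qed.

Lemma length_choice_word g u k : length (choice_word g u k) = k.
Proof. unfold choice_word. rewrite length_map, length_seq. reflexivity. Qed.

Lemma length_input_word g x l lz : length (input_word g x l lz) = 2 * length x + 2 * l + 2 * lz + 6.
Proof.
  unfold input_word, enc_triple. rewrite !length_app, !length_enc_bits, !length_choice_word. lia.
Qed.

Lemma choice_word_ext g u y : (forall i, i < length y -> g (u i) = nth i y false) ->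
  choice_word g u (length y) = y.
Proof.
  intros H. unfold choice_word. apply nth_ext with false false.
  - rewrite length_map, length_seq. reflexivity.
  - intros i Hi. rewrite length_map, length_seq in Hi.
    rewrite nth_indep with (d' := g (u 0)) by (rewrite length_map, length_seq; auto).
    rewrite (map_nth (fun i => g (u i))), seq_nth by auto. simpl. auto.
Qed.

Lemma poly_mono c k n n' : n <= n' -> poly c k n <= poly c k n'.
Proof. intros H. unfold poly. pose proof (Nat.pow_le_mono_l n n' k H). nia. Qed.

Theorem circuit_correct (M : TM) (c2 k2 : nat) (V : list bool -> Prop) (x : list bool)
    (P T W : nat) (I : list item) :
  (forall w, exists t, t <= poly c2 k2 (length w) /\
     halting M (cst (run M t (init M w))) = true /\
     (accepting M (cst (run M t (init M w))) = true <-> V w)) ->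
  (forall it, In it I <-> circuit_item M x P T W it) ->
  2 * poly c2 k2 (2 * length x + 4 * S P + 6) + 4 <= T -> 2 * T + 4 <= W ->
  (forall y, length y <= P -> exists z, length z <= P /\ V (enc_triple x y z)) <->
  (forall be : node -> bool, exists ga : node -> bool,
     (forall u, In (Univ u) I -> ga u = be u) /\ Der I ga [0]).
Proof.
  intros HM HI HT HW. split.
  - intros Hyz be.
    assert (Hz : forall l, exists z, l <= P -> length z <= P /\
        V (enc_triple x (choice_word be (fun i => [l; i]) l) z)).
    { intros l. destruct (Nat.le_gt_cases l P) as [Hl|Hl]; [|exists []; lia].
      destruct (Hyz (choice_word be (fun i => [l; i]) l)) as [z Hz].
      - rewrite length_choice_word. auto.
      - exists z. auto. }
    (* One witness z for each length l, in answer to the bits that [be] gives to the copies of that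
       length. *)
    apply functional_choice in Hz. destruct Hz as [zf Hzf].
    (* Names of length 2, the bits of y, stay with [be]. For each l the accepting copy will be the
       one with lz the length of [zf l]. *)
    set (ga := fun u : node => match u with [l; _; i] => nth i (zf l) false | _ => be u end).
    exists ga. split.
    { intros u Hu. apply HI in Hu. remember (Univ u) as it eqn:E.
      destruct Hu as [b'|l i Hl Hi|l lz it' Hl Hlz (j & s & _ & H)|l lz t j ca cb cc Hl Hlz Ht Hj Ha Hb Hc
                |l lz t j ca Hl Hlz Ht Hj Ha Hacc]; try discriminate.
      - injection E as <-. reflexivity.
      - subst. destruct (src_items_univ _ _ _ _ _ H). }
    (* The chain is climbed from its end [[S P]] down to the root [[0]]. *)
    assert (Hd : forall d, d <= S P -> Der I ga [S P - d]).
    { induction d as [|d IHd]; intros Hd.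
      - rewrite Nat.sub_0_r. apply (end_complete M x P T W I ga HI).
      - set (l := S P - S d). assert (Hl : l <= P) by lia.
        destruct (Hzf l Hl) as [Hlz HV].
        set (w := input_word ga x l (length (zf l))).
        assert (Ew : w = enc_triple x (choice_word be (fun i => [l; i]) l) (zf l)).
        { unfold w, input_word. f_equal. apply choice_word_ext. reflexivity. }
        destruct (HM w) as (t & Ht & Hh & Hacc).
        assert (Hlen : length w <= 2 * length x + 4 * S P + 6).
        { unfold w. rewrite length_input_word. lia. }
        apply (poly_mono c2 k2) in Hlen.
        (* [S t] accounts for the extra initial step. *)
        apply (node_complete M x P T W I ga HI l (length (zf l)) (S t)); auto; try lia.
        + apply xacc_complete with t; auto. apply Hacc. rewrite Ew. exact HV.
        + replace (S l) with (S P - d) by lia. apply IHd. lia. }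
    replace 0 with (S P - S P) by lia. apply Hd. auto.
  - intros Hbe y Hy.
    (* The word y is offered to the copies of every length; the copy with l the length of y then
       reads exactly y. *)
    destruct (Hbe (fun u : node => match u with [_; i] => nth i y false | _ => false end))
      as (ga & Hga & Hroot).
    assert (Hl : Der I ga [length y]) by (eapply nodes_sound; eauto).
    apply (node_sound M x P T W I ga HI) in Hl; auto.
    destruct Hl as (_ & lz & t & Hlz & Hacc).
    exists (choice_word ga (fun i => [length y; lz; i]) lz). rewrite length_choice_word. split; auto.
    assert (Ew : input_word ga x (length y) lz =
                 enc_triple x y (choice_word ga (fun i => [length y; lz; i]) lz)).
    { unfold input_word. f_equal. apply choice_word_ext. intros i Hi. apply Hga.
      apply HI. constructor; auto. }
    rewrite <- Ew. destruct (HM (input_word ga x (length y) lz)) as (t' & _ & Hh & Hiff).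
    apply Hiff. eapply xacc_sound; eauto.
Qed.

Theorem theorem7 :
  exists (Sigma : list dep) (alpha : fact),
    Forall wf_dep Sigma /\
    Forall guarded Sigma /\
    sticky Sigma /\
    PiP2_hard (IAR_instance_problem Sigma alpha).
Proof.
  exists Sigma_circ, (fN 3).
  split; [exact Sigma_wf|]. split; [exact Sigma_guarded|]. split; [exact Sigma_sticky|].
  intros L (V & c & k & (M & c2 & k2 & HM) & HL).
  set (env := fun x => penv 1 (params c k c2 k2) (input_env x)).
  set (db := fun x => items_db (circuit M (env x))).
  exists (fun x => enc_db (db x)). split.
  - destruct (gen_computable item_pieces (params c k c2 k2) (circuit_gen M) (params_wf M c k c2 k2))
      as (N & c' & k' & HN).
    exists N, c', k'. intros x. destruct (HN x) as (t & Ht & Hh & Ho). exists t.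
    split; [exact Ht|]. split; [exact Hh|]. rewrite Ho. apply circuit_output.
  - intros x.
    destruct (params_length c k c2 k2 x) as (E0 & E1 & E3 & E4). fold (env x) in E0, E1, E3, E4.
    set (P := poly c k (length x)) in *.
    assert (HI : forall it, In it (circuit M (env x)) <->
      circuit_item M x P (length (env x 3)) (length (env x 4)) it).
    { intros it. rewrite <- E0 at 2. apply in_circuit. exact E1. }
    assert (Hiff : L x <-> IAR_entails_fact Sigma_circ (db x) (fN 3)).
    { rewrite HL. unfold db.
      rewrite (IAR_circuit _ (node_rank P (length (env x 3)))) by (eapply circuit_ranked; eauto).
      eapply circuit_correct; [exact HM|exact HI|rewrite E3; apply le_n|rewrite E4; lia]. }
    rewrite Hiff. split.
    + intros H. exists (db x). auto.
    (* The problem asks for some database with the given code; injectivity of the code makes it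
       [db x]. *)
    + intros (D & HD & H). apply enc_db_inj in HD. subst D. exact H.
Qed.
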